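(* Let $t>0$ and $\rho\in\mathbb{R}^d$ with $|\rho|=1$ be fixed, and suppose that the spatial mesh sizes $\lambda=\lambda_n>0$ satisfy $\lambda_n\to0$ as $n\to\infty$. Then the second-order spatial variation $\mathbf{V}_{\mathrm{sp}}$ satisfies $$\sqrt{n}\left(\frac{\lambda^{\beta-2}}{n}\mathbf{V}_{\mathrm{sp}}-\mathbb{E}\left[\frac{\lambda^{\beta-2}}{n}\mathbf{V}_{\mathrm{sp}}\right]\right)\xrightarrow{d}N\left(0,\frac{t^2}{\vartheta^2}C_{\mathrm{sp},\mathbb{V}}\right),\qquad n\to\infty.$$
   Context: Let $d\in\mathbb{N}$, $\beta\in(0,\min(2,d))$ and $\vartheta>0$. $u=(u(t,x))_{t\ge0,x\in\mathbb{R}^d}$ denotes the solution of the stochastic wave equation $\partial_{tt}^2u=\vartheta\Delta u+\dot W_\beta$ on $\mathbb{R}^d$ with $u(0,\cdot)=\partial_tu(0,\cdot)\equiv0$, driven by centred Gaussian noise that is white in time and has Riesz-kernel spatial covariance (proportional to $|x-y|^{-\beta}$) with spectral density $|\xi|^{\beta-d}$. That is, $u$ is the centred Gaussian process with covariance $$\mathbb{E}[u(t,x)u(s,y)]=\frac{1}{(2\pi)^d}\int_0^{t\wedge s}\int_{\mathbb{R}^d}e^{\mathrm{i}(x-y)\cdot\xi}\,\frac{\sin((t-r)\sqrt\vartheta|\xi|)}{\sqrt\vartheta|\xi|}\,\frac{\sin((s-r)\sqrt\vartheta|\xi|)}{\sqrt\vartheta|\xi|}\,|\xi|^{\beta-d}\,d\xi\,dr.$$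 Observation points: $x_k=\lambda k\rho$, $k=0,\dots,n+1$. Define $\mathbf{I}_{\mathrm{sp},k}=u(t,x_{k+1})+u(t,x_{k-1})-2u(t,x_k)$ for $k=1,\dots,n$ and $\mathbf{V}_{\mathrm{sp}}=\sum_{k=1}^n\mathbf{I}_{\mathrm{sp},k}^2$. Constant: with $g_{\mathrm{sp}}(\omega)=\sin^4(\rho\cdot\omega/2)|\omega|^{\beta-d-2}$ and $\mathcal{F}_c(f)(\xi)=\int_{\mathbb{R}^d}\cos(\xi\cdot\omega)f(\omega)\,d\omega$, $$C_{\mathrm{sp},\mathbb{V}}=\frac{128}{(2\pi)^{2d}}\sum_{k\in\mathbb{Z}}\big(\mathcal{F}_c(g_{\mathrm{sp}})(k\rho)\big)^2.$$ *)

(* Defs.v *)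
From HB Require Import structures.
From mathcomp Require Import all_boot all_order all_algebra.
From mathcomp Require Import all_classical all_reals all_analysis.
From mathcomp Require Import complex.

Set Implicit Arguments.
Unset Strict Implicit.
Unset Printing Implicit Defensive.

Import Order.TTheory GRing.Theory Num.Theory.
Import numFieldNormedType.Exports.
Import numFieldTopology.Exports.

Local Open Scope classical_set_scope.
Local Open Scope ring_scope.

(* Borel sets of R^n: the sigma-algebra generated by the coordinates. *)
Section measurable_rV.
Context {R : realType} (n : nat).

Let coord (i : 'I_n) (x : 'rV[R]_n) : measurableTypeR R := x ord0 i.

Let rV_set0 : g_sigma_preimage coord set0.
Proof. exact: sigma_algebra0. Qed.

Let rV_setC A : g_sigma_preimage coord A -> g_sigma_preimage coord (~` A).
Proof. exact: sigma_algebraC. Qed.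

Let rV_bigcup (F : _^nat) : (forall i, g_sigma_preimage coord (F i)) ->
  g_sigma_preimage coord (\bigcup_i (F i)).
Proof. exact: sigma_algebra_bigcup. Qed.

HB.instance Definition _ := @isMeasurable.Build default_measure_display
  'rV[R]_n (g_sigma_preimage coord) rV_set0 rV_setC rV_bigcup.

Lemma measurable_coord (i : 'I_n) :
  measurable_fun [set: 'rV[R]_n] (fun x : 'rV[R]_n => x ord0 i).
Proof.
move=> _ Y mY; rewrite setTI; apply: sub_sigma_algebra => /=.
rewrite -bigcup_seq/=; exists i => /=; first by rewrite mem_index_enum.
by exists Y => //; rewrite setTI.
Qed.

Lemma measurable_fun_rV d (T : measurableType d) (f : T -> 'rV[R]_n) :
  (forall i, measurable_fun [set: T] (fun x => f x ord0 i)) ->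
  measurable_fun [set: T] f.
Proof.
move=> mf.
suff : g_sigma_preimage (fun i => coord i \o f) `<=` measurable.
  rewrite g_sigma_preimage_comp => sub _ A mA.
  by apply: sub; exists A.
apply: smallest_sub; first exact: sigma_algebra_measurable.
by rewrite -bigcup_seq/=; apply: bigcup_sub => i _ A [B mB <-]; exact: mf.
Qed.

End measurable_rV.

Lemma sigma_finite_prod d1 d2 (T1 : measurableType d1)
    (T2 : measurableType d2) (R : realType)
    (m1 : {sigma_finite_measure set T1 -> \bar R})
    (m2 : {sigma_finite_measure set T2 -> \bar R}) :
  sigma_finite setT (m1 \x m2)%E.
Proof.
have /sigma_finiteP[F [TF ndF Foo]] := sigma_finiteT m1.
have /sigma_finiteP[G [TG ndG Goo]] := sigma_finiteT m2.
exists (fun n => F n `*` G n).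
  rewrite -setXTT TF TG predeqE => -[x y]; split.
    move=> [/= [n _ Fnx] [k _ Gky]]; exists (maxn n k) => //; split.
    - by move: x Fnx; exact/subsetPset/ndF/leq_maxl.
    - by move: y Gky; exact/subsetPset/ndG/leq_maxr.
  by move=> [n _ []/= ? ?]; split; exists n.
move=> k; have [? ?] := Foo k; have [? ?] := Goo k.
split; first exact: measurableX.
by rewrite product_measure1E// lte_mul_pinfty// ge0_fin_numE.
Qed.

Section lebesgue_rV.
Context {R : realType}.

Definition rV_cons n (p : measurableTypeR R * 'rV[R]_n) : 'rV[R]_n.+1 :=
  \row_i if unlift ord0 i is Some j then p.2 ord0 j else p.1.

Definition rV_uncons n (x : 'rV[R]_n.+1) : measurableTypeR R * 'rV[R]_n :=
  (x ord0 ord0, \row_j x ord0 (lift ord0 j)).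

Lemma rV_consK n : cancel (@rV_cons n) (@rV_uncons n).
Proof.
move=> [a x]; rewrite /rV_uncons /rV_cons mxE unlift_none; congr pair.
by apply/rowP => j; rewrite !mxE liftK.
Qed.

Lemma measurable_rV_cons n : measurable_fun setT (@rV_cons n).
Proof.
apply: measurable_fun_rV => i; case: (unliftP ord0 i) => [j|] ->.
  rewrite (_ : (fun p => _) = (fun x : 'rV[R]_n => x ord0 j) \o snd).
    by apply: measurableT_comp; [exact: measurable_coord|].
  by apply/funext => p /=; rewrite mxE liftK.
rewrite (_ : (fun p => _) = fst) //.
by apply/funext => p /=; rewrite mxE unlift_none.
Qed.

Lemma measurable_rV_uncons n : measurable_fun setT (@rV_uncons n).
Proof.
apply: measurable_fun_pair; first exact: measurable_coord.
apply: measurable_fun_rV => j.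
rewrite (_ : (fun p => _) = fun x : 'rV[R]_n.+1 => x ord0 (lift ord0 j)).
  exact: measurable_coord.
by apply/funext => x; rewrite mxE.
Qed.

Section step.
Variables (n : nat) (mu : {sigma_finite_measure set 'rV[R]_n -> \bar R}).

Definition lebesgue_rV_step : set 'rV[R]_n.+1 -> \bar R :=
  pushforward (@lebesgue_measure R \x mu)%E (@rV_cons n).

Let step0 : lebesgue_rV_step set0 = 0%E.
Proof. by rewrite /lebesgue_rV_step /pushforward preimage_set0 measure0. Qed.

Let step_ge0 A : (0 <= lebesgue_rV_step A)%E.
Proof. by rewrite /lebesgue_rV_step /pushforward measure_ge0. Qed.

Let step_sigma_additive : semi_sigma_additive lebesgue_rV_step.
Proof.
have mcons (A : set 'rV[R]_n.+1) : measurable A ->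
    measurable (@rV_cons n @^-1` A).
  by move=> mA; rewrite -[X in measurable X]setTI; exact: measurable_rV_cons.
move=> F mF tF mUF; rewrite /lebesgue_rV_step /pushforward preimage_bigcup.
apply: measure_semi_sigma_additive.
- by move=> k; exact: mcons.
- apply/trivIsetP => /= i j _ _ ij; rewrite -preimage_setI.
  by move/trivIsetP : tF => /(_ _ _ Logic.I Logic.I ij) ->; rewrite preimage_set0.
- by rewrite -preimage_bigcup; exact: mcons.
Qed.

HB.instance Definition _ := isMeasure.Build _ _ _ lebesgue_rV_step
  step0 step_ge0 step_sigma_additive.

Let sigma_finite_step : sigma_finite setT lebesgue_rV_step.
Proof.
have [F UF Foo] := sigma_finite_prod (@lebesgue_measure R) mu.
exists (fun k => @rV_uncons n @^-1` F k).
  by rewrite -preimage_bigcup -UF.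
move=> k; have [mF Fk] := Foo k; split.
  by rewrite -[X in measurable X]setTI; exact: measurable_rV_uncons.
rewrite /lebesgue_rV_step /pushforward -comp_preimage.
by rewrite (_ : _ \o _ = id)//; apply/funext => p /=; rewrite rV_consK.
Qed.

HB.instance Definition _ := @Measure_isSigmaFinite.Build _ _ _
  lebesgue_rV_step sigma_finite_step.

End step.

Fixpoint lebesgue_rV (n : nat) : {sigma_finite_measure set 'rV[R]_n -> \bar R} :=
  if n is m.+1 then lebesgue_rV_step (lebesgue_rV m) else \d_(0 : 'rV[R]_0).

Lemma lebesgue_rV_box n (A : 'I_n -> set (measurableTypeR R)) :
  (forall i, measurable (A i)) ->
  lebesgue_rV n [set x | forall i, A i (x ord0 i)] =
  (\prod_(i < n) lebesgue_measure (A i))%E.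
Proof.
elim: n A => [|n IH] A mA.
  by rewrite big_ord0 /= diracE mem_set//; case.
have mB : measurable [set x : 'rV[R]_n | forall j, A (lift ord0 j) (x ord0 j)].
  rewrite (_ : mkset _ = \bigcap_(j in [set: 'I_n])
      [set x : 'rV[R]_n | A (lift ord0 j) (x ord0 j)]).
    apply: fin_bigcap_measurable => [|j _]; first exact: finite_finset.
    rewrite -[X in measurable X]setTI.
    exact: (measurable_coord j measurableT (mA (lift ord0 j))).
  by apply/seteqP; split => x /= Ax j; [move=> _; exact: Ax|exact: (Ax j)].
rewrite big_ord_recl -IH// -product_measure1E//=.
rewrite /lebesgue_rV_step /pushforward; congr product_measure1.
apply/seteqP; split => -[a x] /=.
  move=> H; split=> [|j]; first by have := H ord0; rewrite mxE unlift_none.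
  by have := H (lift ord0 j); rewrite mxE liftK.
move=> [Aa Ax] i; rewrite mxE.
by case: (unliftP ord0 i) => [j|] ->; [exact: Ax|].
Qed.

End lebesgue_rV.
Arguments lebesgue_rV : clear implicits.

(* The Euclidean structure; `|x| on 'rV[R]_d is the sup norm. *)
Definition dot {R : realType} {d : nat} (x y : 'rV[R]_d) : R :=
  \sum_(i < d) x ord0 i * y ord0 i.

Definition enorm {R : realType} {d : nat} (x : 'rV[R]_d) : R :=
  Num.sqrt (dot x x).

Section complex_integral.
Local Open Scope complex_scope.
Context {R : realType}.

Definition expi (x : R) : R[i] := cos x +i* sin x.

Definition Cintegral d (T : measurableType d)
    (mu : {measure set T -> \bar R}) (D : set T) (f : T -> R[i]) : R[i] :=
  (\int[mu]_(x in D) complex.Re (f x)) +i* (\int[mu]_(x in D) complex.Im (f x)).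

(* The Ito isometry for the stochastic convolution of the wave kernel, whose
   spatial Fourier transform at time t is sin(t sqrt(theta)|xi|) /
   (sqrt(theta)|xi|), against noise with spectral density |xi|^(beta - d).
   At xi = 0, a null set, the quotient is 0 here. *)
Definition wave_cov (d : nat) (beta theta : R)
    (t : R) (x : 'rV[R]_d) (s : R) (y : 'rV[R]_d) : R[i] :=
  ((2 * pi) ^- d)%:C *
  Cintegral lebesgue_measure `[0, Num.min t s] (fun r =>
    Cintegral (lebesgue_rV R d) setT (fun xi =>
      expi (dot (x - y) xi) *
      (sin ((t - r) * Num.sqrt theta * enorm xi) / (Num.sqrt theta * enorm xi) *
       (sin ((s - r) * Num.sqrt theta * enorm xi) / (Num.sqrt theta * enorm xi)) *
       enorm xi `^ (beta - d%:R))%:C)).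

End complex_integral.

Section gaussian.
Context {R : realType}.

(* N(m, v), v being the variance; normal_prob takes the standard deviation and
   is not a Dirac mass when it is 0. *)
Definition gaussian_prob (m v : R) : probability (measurableTypeR R) R :=
  if v == 0 then (\d_(m : measurableTypeR R) : probability (measurableTypeR R) R)
  else (normal_prob m (Num.sqrt v) : probability (measurableTypeR R) R).

Context d (T : measurableType d) (P : probability T R).

(* All finite linear combinations are centred, possibly degenerate, Gaussian. *)
Definition centered_gaussian (I : Type) (D : set I) (X : I -> {RV P >-> R}) :=
  forall (n : nat) (i : 'I_n -> I) (a : 'I_n -> R), (forall k, D (i k)) ->
  exists2 v : R, 0 <= v & forall A : set R, measurable A ->
    P [set w | A (\sum_(k < n) a k * X (i k) w)] = gaussian_prob 0 v A.

(* Convergence of distribution functions at the continuity points of the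
   limiting one; the X n are meant to be random variables. *)
Definition cvg_in_distribution (X : nat -> T -> R)
    (mu : probability (measurableTypeR R) R) :=
  forall x : R, {for x, continuous (fun y : R => mu [set` `]-oo, y]])} ->
  P [set w | X n w <= x] @[n --> \oo] --> mu [set` `]-oo, x]].

End gaussian.

Section wave.
Context {R : realType} (dim : nat).
Context d (T : measurableType d) (P : probability T R).
Implicit Types (u : R -> 'rV[R]_dim -> {RV P >-> R}) (rho : 'rV[R]_dim).

(* The solution of d_tt u = theta Laplacian(u) + dW_beta with null initial data,
   through its law as a Gaussian random field; only times t >= 0 matter. *)
Definition wave_solution (beta theta : R) u :=
  centered_gaussian [set tx : R * 'rV[R]_dim | 0 <= tx.1]
    (fun tx => u tx.1 tx.2) /\
  forall (t s : R) (x y : 'rV[R]_dim), 0 <= t -> 0 <= s ->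
    (fine 'E_P[u t x \* u s y])%:C%C = wave_cov beta theta t x s y.

Definition obs (lambda : R) rho (k : nat) : 'rV[R]_dim :=
  (lambda * k%:R) *: rho.

Definition I_sp u (t lambda : R) rho (k : nat) (w : T) : R :=
  u t (obs lambda rho k.+1) w + u t (obs lambda rho k.-1) w
    - 2 * u t (obs lambda rho k) w.

Definition V_sp u (t lambda : R) rho (n : nat) (w : T) : R :=
  \sum_(1 <= k < n.+1) I_sp u t lambda rho k w ^+ 2.

End wave.

Definition Fc {R : realType} {d : nat} (f : 'rV[R]_d -> R) (xi : 'rV[R]_d) : R :=
  \int[lebesgue_rV R d]_omega (cos (dot xi omega) * f omega).

Definition g_sp {R : realType} {d : nat} (beta : R) (rho omega : 'rV[R]_d) : R :=
  sin (dot rho omega / 2) ^+ 4 * enorm omega `^ (beta - d%:R - 2).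

(* The series has nonnegative terms, so its sum over the integers is esum. *)
Definition C_spV {R : realType} {d : nat} (beta : R) (rho : 'rV[R]_d) : R :=
  128 / (2 * pi) ^+ (2 * d) *
  fine (\esum_(k in [set: int]) ((Fc (g_sp beta rho) (k%:~R *: rho)) ^+ 2)%:E).

(* Main.v *)
(* In row n put X_k = n^(-1/4) lambda^((beta-2)/2) I_k. After the substitution
   omega = lambda xi in the Ito isometry, X is Gaussian with Toeplitz covariance
   n^(-1/2) int cos((k-l) rho.omega) G_n(omega) domega, where G_n is dominated by
   a multiple of g_sp and converges in L^1 to a multiple of g_sp. The statistic is
   Q - E Q with Q = |X|^2. Averaging over shifts of omega that make the phase run
   through a full period gives
   int |sum_k a_k exp(i k rho.omega)|^2 g_sp(omega) domega <= B sum_k a_k^2,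
   so the eigenvalues a_j of the covariance are O(n^(-1/2)), while sum_j a_j^2
   converges, by Cesaro's lemma, to half of the limiting variance. Q has the law
   of sum_j a_j Z_j^2 with Z_j independent standard normal: the Laplace transform
   of Q factorizes, and it determines the expectations of logistic functions of Q,
   which are series in exponentials. Replacing a_j (Z_j^2 - 1) one at a time by
   Gaussians of the same variance (Lindeberg) costs at most a multiple of
   sum_j a_j^3 <= max_j a_j sum_j a_j^2, which tends to 0, and logistic functions
   approximate the indicators of half-lines. *)

Require Import Defs.
From HB Require Import structures.
From mathcomp Require Import all_boot all_order all_algebra.
From mathcomp Require Import all_classical all_reals all_analysis.
From mathcomp Require Import complex measurable_realfun ring lra.
Set Implicit Arguments.
Unset Strict Implicit.
Unset Printing Implicit Defensive.
Import Order.TTheory GRing.Theory Num.Theory.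
Import numFieldNormedType.Exports.
Local Open Scope classical_set_scope.
Local Open Scope ring_scope.

(** * Real-valued integrals *)

(** The hypothesis on u only gives the law of one linear combination at a time. Hence no joint
    density and no family of independent normals is ever built: everything about Q is extracted from
    one-dimensional characteristic functions, and weighted sums of squared normals exist only as
    nested one-dimensional integrals. Logistic test functions are chosen for three properties at
    once. On y >= 0 they are uniform limits of polynomials in exp(-y/e), which takes the place of a
    uniqueness theorem for Laplace transforms; their derivatives are polynomials in themselves,
    which gives the Taylor bounds for Lindeberg; and they are nearly 0 or 1 at distance much larger
    than e from their centre. The delicate estimate is the eigenvalue bound. Shifting along a
    coordinate costs one dimension near the origin, where a cube of side r counts as r^(d-1) instead
    of r^d; the fourth power of the sine pays for this. The same bound gives square summability of
    the Fourier coefficients of [g_sp], so that the series in [C_spV] is finite. *)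

Local Notation rint mu f := (mu.-integrable [set: _] (EFin \o f)).

Section real_integrals.
Context d (T : measurableType d) (R : realType).
Variable mu : {measure set T -> \bar R}.
Implicit Types f g : T -> R.

Lemma rintegrable_le f g : measurable_fun [set: T] f ->
  (forall x, `|f x| <= g x) -> rint mu g -> rint mu f.
Proof.
move=> mf fg ig; apply: le_integrable ig => //; first exact/measurable_EFinP.
by move=> x _ /=; rewrite lee_fin (le_trans (fg x))// ler_norm.
Qed.

Lemma rintegrableD f g : rint mu f -> rint mu g -> rint mu (fun x => f x + g x).
Proof. by move=> fi gi; have := integrableD measurableT fi gi. Qed.

Lemma rintegrableB f g : rint mu f -> rint mu g -> rint mu (fun x => f x - g x).
Proof. by move=> fi gi; have := integrableB measurableT fi gi. Qed.

Lemma rintegrableZ c f : rint mu f -> rint mu (fun x => c * f x).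
Proof. by move=> fi; have := integrableZl measurableT c fi. Qed.

Lemma rintegrable_sum (I : Type) (s : seq I) (F : I -> T -> R) :
  (forall i, rint mu (F i)) -> rint mu (fun x => \sum_(i <- s) F i x).
Proof.
move=> iF; elim: s => [|i s IH].
  under eq_fun do rewrite big_nil.
  exact: integrable0.
under eq_fun do rewrite big_cons.
exact: rintegrableD.
Qed.

Lemma rintegrable_mulb f g M : measurable_fun [set: T] g ->
  (forall x, `|g x| <= M) -> rint mu f -> rint mu (fun x => g x * f x).
Proof.
move=> mg gM fi; have mf := measurable_int _ fi.
apply: (@rintegrable_le _ (fun x => M * `|f x|)).
- by apply: measurable_funM => //; exact/measurable_EFinP.
- by move=> x; rewrite normrM ler_wpM2r.
- by apply: rintegrableZ; exact: integrable_abse fi.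
Qed.

Lemma rintegral_sum (I : Type) (s : seq I) (F : I -> T -> R) :
  (forall i, rint mu (F i)) ->
  \int[mu]_x (\sum_(i <- s) F i x) = \sum_(i <- s) \int[mu]_x F i x.
Proof.
move=> iF; elim: s => [|i s IH].
  under eq_Rintegral do rewrite big_nil.
  by rewrite /Rintegral integral0 big_nil.
under eq_Rintegral do rewrite big_cons.
rewrite big_cons -IH RintegralD//; exact: rintegrable_sum.
Qed.

Lemma rintegral_norm_le f g : measurable_fun [set: T] f ->
  (forall x, `|f x| <= g x) -> rint mu g -> `|\int[mu]_x f x| <= \int[mu]_x g x.
Proof.
move=> mf fg ig; have fi := rintegrable_le mf fg ig.
apply: (le_trans (le_normr_Rintegral measurableT fi)).
by apply: le_Rintegral => //; exact: integrable_abse fi.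
Qed.

Lemma rintegral_EFin f : rint mu f ->
  (\int[mu]_x f x)%:E = (\int[mu]_x (f x)%:E)%E.
Proof. by move=> fi; rewrite /Rintegral fineK//; exact: integrable_fin_num fi. Qed.

Lemma ge0_rintegral_EFin f : measurable_fun [set: T] f -> (forall x, 0 <= f x) ->
  (\int[mu]_x (f x)%:E < +oo)%E -> rint mu f.
Proof.
move=> mf f0 foo; apply/integrableP; split; first exact/measurable_EFinP.
by under eq_integral do rewrite /= ger0_norm//.
Qed.

End real_integrals.

Section probability_integrals.
Context d (T : measurableType d) (R : realType) (P : probability T R).
Implicit Types f g : T -> R.

Lemma rintegrable_bounded f M : measurable_fun [set: T] f ->
  (forall x, `|f x| <= M) -> rint P f.
Proof.
move=> mf fM; apply: (@rintegrable_le _ _ _ _ f (cst M)) => //.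
exact: finite_measure_integrable_cst.
Qed.

Lemma rintegral_cst c : \int[P]_x c = c.
Proof. rewrite Rintegral_cst// (_ : fine _ = 1) ?mulr1//.
by have /= -> := @probability_setT _ _ _ P. Qed.

Lemma rintegral_normr_le f K : measurable_fun [set: T] f ->
  (forall x, `|f x| <= K) -> `|\int[P]_x f x| <= K.
Proof.
move=> mf fK; rewrite -[leRHS](rintegral_cst).
by apply: rintegral_norm_le => //; exact: finite_measure_integrable_cst.
Qed.

Lemma rintegral_dist2 f g K : rint P f -> rint P g ->
  (forall x, `|f x - g x| <= K) ->
  `|\int[P]_x f x - \int[P]_x g x| <= K.
Proof.
move=> fi gi fgK; rewrite -RintegralB//.
have /measurable_EFinP mf := measurable_int _ fi.
have /measurable_EFinP mg := measurable_int _ gi.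
by apply: rintegral_normr_le => //; exact: measurable_funB.
Qed.

End probability_integrals.

Section real_fubini.
Context d1 d2 (T1 : measurableType d1) (T2 : measurableType d2) (R : realType).
Variables (m1 : {sigma_finite_measure set T1 -> \bar R}).
Variables (m2 : {sigma_finite_measure set T2 -> \bar R}).

Lemma rintegral_fubini (f : T1 * T2 -> R) :
  (m1 \x m2)%E.-integrable [set: T1 * T2] (EFin \o f) ->
  (forall x, rint m2 (fun y => f (x, y))) ->
  (forall y, rint m1 (fun x => f (x, y))) ->
  \int[m1]_x \int[m2]_y f (x, y) = \int[m2]_y \int[m1]_x f (x, y).
Proof.
move=> fi f1 f2; rewrite /Rintegral; congr fine.
under eq_integral do rewrite -/(Rintegral m2 setT (fun y => f (_, y))) rintegral_EFin//.
under [RHS]eq_integral do rewrite -/(Rintegral m1 setT (fun x => f (x, _))) rintegral_EFin//.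
exact: (Fubini fi).
Qed.

(** A product majorant makes every section integrable, not only almost every one, as the real-valued
    iterated integrals require. It is meant for a time indicator times a weight in the frequency. *)
Lemma rintegral_fubini_dom (f : T1 * T2 -> R) (I : T1 -> R) (W : T2 -> R) :
  measurable_fun [set: T1 * T2] f -> (forall x y, `|f (x, y)| <= I x * W y) ->
  rint m1 I -> rint m2 W -> (forall x, 0 <= I x) -> (forall y, 0 <= W y) ->
  \int[m1]_x \int[m2]_y f (x, y) = \int[m2]_y \int[m1]_x f (x, y).
Proof.
move=> mf fIW iI iW I0 W0.
have mf1 x : measurable_fun setT (fun y => f (x, y)) :=
  measurableT_comp mf (pair1_measurable x).
have mf2 y : measurable_fun setT (fun x => f (x, y)) :=
  measurableT_comp mf (pair2_measurable y).
have mI : measurable_fun [set: T1] (fun x => (I x)%:E) := measurable_int _ iI.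
apply: rintegral_fubini.
- apply/integrable12ltyP; first exact/measurable_EFinP.
  apply: (@le_lt_trans _ _ (\int[m1]_x ((I x)%:E * \int[m2]_y (W y)%:E))%E).
    apply: ge0_le_integral => //.
    + by move=> x _; exact: integral_ge0.
    + apply: (@measurable_fun_fubini_tonelli_F _ _ _ _ _ m2 (fun z => `|(f z)%:E|)%E) => //.
      by apply: measurableT_comp => //; exact/measurable_EFinP.
    + by apply: emeasurable_funM.
    + move=> x _; rewrite -(@ge0_integralZl _ _ R m2 _ measurableT).
      * apply: ge0_le_integral => //.
        -- by apply: measurableT_comp => //; exact/measurable_EFinP.
        -- by apply: emeasurable_funM => //; exact: (measurable_int _ iW).
        -- by move=> y _; rewrite -EFinM lee_fin.
      * exact: (measurable_int _ iW).
      * by move=> y _; rewrite lee_fin.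
      * by rewrite lee_fin.
  rewrite -(rintegral_EFin iW) (@ge0_integralZr _ _ R m1 _ measurableT _ mI).
  + by rewrite -(rintegral_EFin iI) -EFinM ltry.
  + by move=> x _; rewrite lee_fin.
  + by rewrite lee_fin; apply: Rintegral_ge0 => y _; exact: W0.
- move=> x; apply: (@rintegrable_le _ _ _ _ _ (fun y => I x * W y)) => //.
  exact: rintegrableZ.
- move=> y; apply: (@rintegrable_le _ _ _ _ _ (fun x => W y * I x)) => //.
    by move=> x; rewrite mulrC.
  exact: rintegrableZ.
Qed.

End real_fubini.

Section prob_fubini.
Context d1 d2 (T1 : measurableType d1) (T2 : measurableType d2) (R : realType).
Variables (P1 : probability T1 R) (P2 : probability T2 R).

Lemma prob_fubini (f : T1 * T2 -> R) (M : R) : measurable_fun setT f ->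
  (forall z, `|f z| <= M) ->
  \int[P1]_x \int[P2]_y f (x, y) = \int[P2]_y \int[P1]_x f (x, y).
Proof.
move=> mf fM.
apply: (@rintegral_fubini_dom _ _ _ _ R P1 P2 f (fun=> 1) (fun=> `|M|) mf).
- by move=> x y; rewrite mul1r (le_trans (fM (x, y)))// ler_norm.
- exact: finite_measure_integrable_cst.
- exact: finite_measure_integrable_cst.
- by [].
- by [].
Qed.

Lemma measurable_prob_Rintegral (f : T1 * T2 -> R) (M : R) : measurable_fun setT f ->
  (forall z, `|f z| <= M) -> measurable_fun setT (fun x => \int[P2]_y f (x, y)).
Proof.
(* Adding the bound M makes the integrand nonnegative, where Tonelli gives measurability of the
   partial integral; M is subtracted at the end. *)
move=> mf fM; pose F z := (f z + M)%:E.
have mF : measurable_fun setT F by apply/measurable_EFinP; exact: measurable_funD.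
have F0 z : (0 <= F z)%E.
  by rewrite lee_fin; have := fM z; rewrite ler_norml => /andP[]; lra.
have ifx x : rint P2 (fun y => f (x, y)).
  apply: (@rintegrable_bounded _ _ _ P2 _ M) => [|y]; last exact: fM.
  exact: (measurableT_comp mf (pair1_measurable x)).
have icst : rint P2 (fun=> M) by exact: finite_measure_integrable_cst.
have := @measurable_fun_fubini_tonelli_F _ _ _ _ _ P2 F mF F0.
have -> : fubini_F P2 F = EFin \o (fun x => \int[P2]_y f (x, y) + M).
  apply/funext => x; rewrite /fubini_F /F /= -rintegral_EFin; last exact: rintegrableD.
  by rewrite (RintegralD measurableT (ifx x) icst) rintegral_cst.
move/measurable_EFinP => H.
rewrite (_ : (fun x => _) = fun x => \int[P2]_y f (x, y) + M - M); first exact: measurable_funB.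
by apply/funext => x; rewrite addrK.
Qed.

End prob_fubini.

(** * The standard normal law *)

Section affine_substitution.
Context {R : realType}.
Local Notation leb := (@lebesgue_measure R).

(** Lebesgue measure and |c| times its pushforward under x -> c x + b agree on half-open intervals,
    so uniqueness identifies them. A negative c moves the closed end of the preimage to the left,
    hence the two cases. *)
Lemma ge0_integral_affine (c b : R) (f : R -> \bar R) : c != 0 ->
  measurable_fun [set: R] f -> (forall x, (0 <= f x)%E) ->
  (\int[leb]_x f (c * x + b)%R = (`|c|^-1)%:E * \int[leb]_x f x)%E.
Proof.
move=> c0 mf f0; pose phi (x : R) : R := c * x + b.
have mphi : measurable_fun [set: measurableTypeR R] (phi : _ -> measurableTypeR R).
  by apply: measurable_funD => //; exact: measurable_funM.
pose m1 := measure_function_pushforward__canonical__measure_function_Measure leb mphi.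
pose m2 := mscale (NngNum (normr_ge0 c)) m1.
have E A : measurable A -> leb A = m2 A.
  apply: lebesgue_measure_unique => _ [[x y] _ <-].
  transitivity (`|c|%:E * leb (phi @^-1` `]x, y]))%E; last by [].
  have := c0; rewrite neq_lt => /orP[c_lt0|c_gt0].
    rewrite (_ : phi @^-1` _ = `[(y - b) / c, (x - b) / c[%classic); last first.
      apply/seteqP; split => z /=; rewrite !in_itv/= /phi => /andP[h1 h2]; apply/andP; split.
      - by rewrite ler_ndivrMr// mulrC; lra.
      - by rewrite ltr_ndivlMr// mulrC; lra.
      - by move: h2; rewrite ltr_ndivlMr// mulrC; lra.
      - by move: h1; rewrite ler_ndivrMr// mulrC; lra.
    rewrite !lebesgue_measure_itv/= !lte_fin ltr_nM2r ?invr_lt0// ltrD2r.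
    case: ifPn => xy; last by rewrite mule0.
    by rewrite -!EFinB -EFinM ltr0_norm//; congr EFin; field.
  rewrite (_ : phi @^-1` _ = `](x - b) / c, (y - b) / c]%classic); last first.
    apply/seteqP; split => z /=; rewrite !in_itv/= /phi.
      by rewrite ltr_pdivrMr// ler_pdivlMr// ltrBlDr lerBrDr mulrC.
    by rewrite ltr_pdivrMr// ler_pdivlMr// ltrBlDr lerBrDr mulrC.
  rewrite !lebesgue_measure_itv/= !lte_fin ltr_pM2r ?invr_gt0// ltrD2r.
  case: ifPn => xy; last by rewrite mule0.
  by rewrite -!EFinB -EFinM gtr0_norm//; congr EFin; field.
have -> : (\int[leb]_x f x = \int[m2]_x f x)%E.
  by apply: eq_measure_integral => A mA _; exact: E.
rewrite ge0_integral_mscale//= ge0_integral_pushforward//.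
by rewrite preimage_setT muleA -EFinM mulVf ?normr_eq0// mul1e.
Qed.

End affine_substitution.

Section density.
Context d (T : measurableType d) (R : realType).
Variables (mu nu : {measure set T -> \bar R}) (p : T -> R).
Hypotheses (mp : measurable_fun [set: T] p) (p0 : forall x, 0 <= p x).
Hypothesis nuE : forall A, measurable A -> (nu A = \int[mu]_(x in A) (p x)%:E)%E.

Import HBNNSimple.

Let integral_density_nnsfun (f : {nnsfun T >-> R}) :
  (\int[nu]_x (f x)%:E = \int[mu]_x ((f x)%:E * (p x)%:E))%E.
Proof.
under [LHS]eq_integral do rewrite fimfunE -fsumEFin//.
rewrite [LHS]ge0_integral_fsum//; last 2 first.
  - by move=> r; exact/measurable_EFinP/measurableT_comp.
  - by move=> n x _; rewrite EFinM nnfun_muleindic_ge0.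
under [RHS]eq_integral.
  move=> x xD; rewrite fimfunE -fsumEFin// muleC ge0_mule_fsumr; last first.
    by move=> r; rewrite EFinM nnfun_muleindic_ge0.
  over.
rewrite [RHS]ge0_integral_fsum//; last 2 first.
  - move=> r; apply/emeasurable_funM; first exact/measurable_EFinP.
    by apply/measurable_EFinP/measurableT_comp.
  - by move=> n x _; apply: mule_ge0; rewrite ?lee_fin//; apply: nnfun_muleindic_ge0.
apply: eq_fsbigr => r _.
rewrite integralZl_indic_nnsfun// integral_indic// setIT nuE; last exact: measurable_funPTI.
under [RHS]eq_integral do rewrite muleC EFinM -muleA.
have [r0|r0] := ltP r 0%R.
  rewrite (_ : f @^-1` [set r] = set0); last by rewrite preimage_nnfun0.
  rewrite integral_set0 mule0 integral0_eq// => x _.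
  by rewrite indic0 mul0e mule0.
rewrite ge0_integralZl//; last 2 first.
  - apply: emeasurable_funM; last exact/measurable_EFinP.
    apply/measurable_EFinP/measurable_indic; exact: measurable_funPTI.
  - by move=> x _; rewrite mule_ge0 ?lee_fin//.
congr (_ * _)%E; rewrite integral_mkcond; apply: eq_integral => x _.
by rewrite patchE indicE; case: ifPn; rewrite ?mul1e ?mul0e.
Qed.

Lemma ge0_integral_density (f : T -> \bar R) : measurable_fun [set: T] f ->
  (forall x, (0 <= f x)%E) -> (\int[nu]_x f x = \int[mu]_x (f x * (p x)%:E))%E.
Proof.
move=> mf f0; pose f_ := nnsfun_approx measurableT mf.
transitivity (lim (\int[nu]_x (f_ n x)%:E @[n --> \oo])%E).
  rewrite -monotone_convergence//=.
  - apply: eq_integral => ? /[!inE] xD; apply/esym/cvg_lim => //=.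
    exact: cvg_nnsfun_approx.
  - by move=> n; exact/measurable_EFinP/measurable_funTS.
  - by move=> n ? _; rewrite lee_fin.
  - by move=> ? _ ? ? mn; rewrite lee_fin; exact/lefP/nd_nnsfun_approx.
under eq_fun do rewrite integral_density_nnsfun.
rewrite -monotone_convergence//=.
- apply: eq_integral => x _; apply/cvg_lim => //=.
  apply: cvgeZr => //; exact: cvg_nnsfun_approx.
- move=> n; apply: emeasurable_funM; last exact/measurable_EFinP.
  exact/measurable_EFinP/measurable_funTS.
- by move=> n x _; rewrite mule_ge0// lee_fin.
- move=> x _ a b ab; rewrite lee_wpmul2r ?lee_fin//.
  exact/lefP/nd_nnsfun_approx.
Qed.

End density.

Section standard_gaussian.
Context {R : realType}.
Local Notation leb := (@lebesgue_measure R).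

Definition stdnormal : probability (measurableTypeR R) R := normal_prob 0 1.
Local Notation gamma := stdnormal.

Lemma ge0_integral_stdnormal (f : R -> \bar R) : measurable_fun [set: R] f ->
  (forall x, (0 <= f x)%E) ->
  (\int[gamma]_x f x = \int[leb]_x (f x * (normal_pdf 0 1 x)%:E))%E.
Proof.
move=> mf f0.
have mpdf := @measurable_normal_pdf R 0 1.
have pdf0 := @normal_pdf_ge0 R 0 1.
exact: (@ge0_integral_density _ _ _ leb gamma).
Qed.

Local Notation p := (@normal_pdf R 0 1).

Lemma stdnormal_pdfE x : p x = normal_peak 1 * expR (- (x ^+ 2 / 2)).
Proof.
rewrite normal_pdfE ?oner_eq0// /normal_fun subr0 expr1n mulNr.
by congr (_ * expR (- (_ / _))); rewrite mulr2n.
Qed.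

#[local] Opaque normal_pdf.

Lemma integral_stdnormalN (f : R -> \bar R) : measurable_fun [set: R] f ->
  (forall x, (0 <= f x)%E) -> (\int[gamma]_x f (- x)%R = \int[gamma]_x f x)%E.
Proof.
move=> mf f0.
have mfN : measurable_fun [set: R] (fun x : R => f (- x)) by exact: measurableT_comp.
rewrite !ge0_integral_stdnormal//.
transitivity (\int[leb]_x (f (-1 * x + 0)%R * (p (-1 * x + 0))%:E))%E.
  apply: eq_integral => x _; rewrite addr0 mulN1r; congr (_ * _%:E)%E.
  by rewrite !stdnormal_pdfE sqrrN.
rewrite (@ge0_integral_affine R _ 0 (fun x => f x * (p x)%:E)%E).
- by rewrite normrN1 invr1 mul1e.
- by rewrite oppr_eq0 oner_eq0.
- by apply: emeasurable_funM => //; apply/measurable_EFinP; exact: measurable_normal_pdf.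
- by move=> x; rewrite mule_ge0// lee_fin normal_pdf_ge0.
Qed.

(** The density times exp(s x^2) is the density at q x with q = sqrt(1 - 2s), so a linear
    substitution leaves the mass 1/q. This moment dominates the powers used below and, near s = 0,
    yields the variance. *)
Lemma stdnormal_expR_sq (s : R) : s < 2^-1 ->
  rint gamma (fun x => expR (s * x ^+ 2)) /\
  \int[gamma]_x expR (s * x ^+ 2) = (Num.sqrt (1 - 2 * s))^-1.
Proof.
move=> s2.
have t0 : 0 < 1 - 2 * s by lra.
have q0 : 0 < Num.sqrt (1 - 2 * s) by rewrite sqrtr_gt0.
pose q := Num.sqrt (1 - 2 * s).
have mf : measurable_fun [set: R] (fun x : R => expR (s * x ^+ 2)).
  by apply: measurableT_comp => //; apply: measurable_funM => //; exact: measurable_funX.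
have E : (\int[gamma]_x (expR (s * x ^+ 2))%:E = (q^-1)%:E)%E.
  rewrite ge0_integral_stdnormal//; last by apply/measurable_EFinP.
  transitivity (\int[leb]_x (p (q * x + 0))%:E)%E.
    apply: eq_integral => x _; rewrite -EFinM !stdnormal_pdfE addr0 mulrCA -expRD.
    congr (_ * expR _)%:E; by rewrite exprMn sqr_sqrtr ?ltW//; field.
  rewrite (@ge0_integral_affine R q 0 (fun x => (p x)%:E)) ?gt_eqF//.
  - by rewrite integral_normal_pdf mule1 gtr0_norm.
  - by apply/measurable_EFinP; exact: measurable_normal_pdf.
  - by move=> x; rewrite lee_fin normal_pdf_ge0.
split; last by rewrite /Rintegral E.
by apply: ge0_rintegral_EFin => //; rewrite E ltry.
Qed.

(** Rotation invariance by hand. Put a x + b y = c s, that is y = (c s - a x)/b; then p(x) p(y) =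
    p(s) p((c x - a s)/b). The substitution costs c/b and integrating x out returns b/c. *)
Lemma stdnormal_convolution (a b c : R) (f : R -> \bar R) : 0 < a -> 0 < b -> 0 < c ->
  c ^+ 2 = a ^+ 2 + b ^+ 2 -> measurable_fun [set: R] f ->
  (forall x, (0 <= f x)%E) ->
  (\int[gamma]_x \int[gamma]_y f (a * x + b * y)%R = \int[gamma]_x f (c * x)%R)%E.
Proof.
move=> a0 b0 c0 abc mf f0.
have mp : measurable_fun [set: R] p by exact: measurable_normal_pdf.
have p0 := @normal_pdf_ge0 R 0 1.
have mlin (u v : R) : measurable_fun [set: R] (fun y : R => u * y + v).
  by apply: measurable_funD => //; exact: measurable_funM.
have mlin2 (u v : R) : measurable_fun [set: R * R] (fun y : R * R => u * y.1 + v * y.2).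
  by apply: measurable_funD => //; exact: measurable_funM.
have cb : 0 < c / b by rewrite divr_gt0.
have inner x : (\int[gamma]_y f (a * x + b * y)%R =
    (c / b)%:E * \int[leb]_s (f (c * s)%R * (p (c / b * s + - (a / b * x)))%:E))%E.
  under eq_integral do rewrite addrC.
  rewrite ge0_integral_stdnormal//; last exact: (measurableT_comp mf (mlin b (a * x))).
  have := @ge0_integral_affine R (c / b) (- (a / b * x))
    (fun y => f (b * y + a * x)%R * (p y)%:E)%E.
  rewrite gt_eqF// gtr0_norm// => /(_ isT) => H.
  rewrite [X in ((c / b)%:E * X)%E](_ : _ = ((c / b)^-1%:E *
    \int[leb]_x0 (f (b * x0 + a * x)%R * (p x0)%:E))%E); last first.
    rewrite -H.
    - by apply: eq_integral => s _; congr (f _ * _)%E; field; rewrite gt_eqF.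
    - apply: emeasurable_funM; last exact/measurable_EFinP.
      exact: (measurableT_comp mf (mlin b (a * x))).
    - by move=> y; rewrite mule_ge0// lee_fin.
  by rewrite muleA -EFinM divff ?gt_eqF// mul1e.
pose H (z : R * R) := (f (c * z.2)%R * (p (c / b * z.2 + - (a / b * z.1)))%:E)%E.
have mH : measurable_fun [set: R * R] H.
  apply: emeasurable_funM.
    by apply: (measurableT_comp mf); exact: measurable_funM.
  apply/measurable_EFinP; apply: (measurableT_comp mp).
  rewrite (_ : (fun _ => _) = (fun z : R * R => - (a / b) * z.1 + (c / b) * z.2)) //.
  by apply/funext => z; rewrite addrC mulNr.
have H0 z : (0 <= H z)%E by rewrite mule_ge0// lee_fin.
have mG : measurable_fun [set: R * R] (fun z : R * R => H z * (p z.1)%:E)%E.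
  by apply: emeasurable_funM => //; apply/measurable_EFinP; exact: measurableT_comp.
have G0 z : (0 <= f (c * z.2)%R * (p (c / b * z.2 + - (a / b * z.1)))%:E * (p z.1)%:E)%E.
  by rewrite !mule_ge0// lee_fin.
under eq_integral do rewrite inner.
have mHx x : measurable_fun [set: R] (fun s => H (x, s)) :=
  measurableT_comp mH (pair1_measurable x).
have mJ := @measurable_fun_fubini_tonelli_F _ _ _ _ _ leb H mH H0.
have J0 x : (0 <= \int[leb]_s H (x, s))%E by exact: integral_ge0.
rewrite [LHS]ge0_integral_stdnormal; first last.
- by move=> x; apply: mule_ge0; [rewrite lee_fin ltW|exact: (J0 x)].
- by apply: emeasurable_funM => //; exact: mJ.
under eq_integral do rewrite -muleA.
rewrite ge0_integralZl//; last 3 first.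
- by apply: emeasurable_funM; [exact: mJ|exact/measurable_EFinP].
- by move=> x _; apply: mule_ge0; [exact: (J0 x)|rewrite lee_fin].
- by rewrite lee_fin ltW.
transitivity ((c / b)%:E * \int[leb]_x \int[leb]_s (fun z : R * R => f (c * z.2)%R *
    (p (c / b * z.2 + - (a / b * z.1)))%:E * (p z.1)%:E) (x, s))%E.
  congr (_ * _)%E; apply: eq_integral => x _ /=.
  rewrite ge0_integralZr ?lee_fin//; first exact: mHx.
  by move=> s _; exact: (H0 (x, s)).
have -> := @fubini_tonelli _ _ _ _ _ leb leb _ mG G0.
rewrite /=.
rewrite [RHS]ge0_integral_stdnormal; last 2 first.
- by apply: (measurableT_comp mf); exact: measurable_funM.
- by [].
transitivity (\int[leb]_s ((c / b)%:E * \int[leb]_x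
    (f (c * s)%R * (p (c / b * s - a / b * x))%:E * (p x)%:E)))%E.
  have mK := @measurable_fun_fubini_tonelli_G _ _ _ _ _ leb _ mG G0.
  have K0 s : setT s -> (0 <= \int[leb]_x
    (f (c * s)%R * (p (c / b * s - a / b * x))%:E * (p x)%:E))%E.
    by move=> _; apply: integral_ge0 => x _; exact: (G0 (x, s)).
  have cb0 : (0 <= (c / b)%:E)%E by rewrite lee_fin ltW.
  exact: (esym (ge0_integralZl leb measurableT mK K0 cb0)).
apply: eq_integral => s _.
transitivity ((c / b)%:E * \int[leb]_x ((f (c * s)%R * (p s)%:E) *
    (p (c / b * x + - (a / b * s)))%:E))%E.
  apply: (congr1 (mule (c / b)%:E)); apply: eq_integral => x _.
  rewrite -!muleA -!EFinM; apply: (congr1 (fun y => (f (c * s)%R * y%:E)%E)).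
  rewrite !stdnormal_pdfE mulrACA [RHS]mulrACA -!expRD; congr (_ * expR _).
  have b0' : b != 0 by rewrite gt_eqF.
  have h (u v : R) : (c / b * u + - (a / b * v)) ^+ 2 = (c ^+ 2 * u ^+ 2 - 2 * a * c * u * v + a ^+ 2 *
    v ^+ 2) / b ^+ 2.
    by field.
  by rewrite !h abc; field.
rewrite ge0_integralZl//; last 3 first.
- apply/measurable_EFinP; exact: (measurableT_comp mp (mlin _ _)).
- by move=> x _; rewrite lee_fin.
- by rewrite mule_ge0// lee_fin.
rewrite (@ge0_integral_affine R (c / b) _ (fun x => (p x)%:E)) ?gt_eqF//.
rewrite integral_normal_pdf mule1 gtr0_norm// muleCA -EFinM divff ?gt_eqF//.
rewrite mule1//.
exact/measurable_EFinP.
Qed.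

End standard_gaussian.

Section taylor2.
Context {R : realType}.
Implicit Types (f df : R -> R) (x y h C K : R).

Lemma lipschitz_increment f df x h C : 0 <= C ->
  (forall y, is_derive y 1 f (df y)) ->
  (forall y, `|y - x| <= `|h| -> `|df y| <= C) -> `|f (x + h) - f x| <= C * `|h|.
Proof.
move=> C0 fdf dfC.
have cf (y : R) : {for y, continuous f}.
  by apply/differentiable_continuous/derivable1_diffP; apply: ex_derive.
have cfw (a b : R) : {within `[a, b], continuous f}.
  by apply: continuous_subspaceT => y; exact: cf.
have [h0|h0] := leP 0 h.
  have xh : x <= x + h by rewrite lerDl.
  have [c] := MVT_segment xh (fun y _ => fdf y) (cfw _ _).
  rewrite in_itv/= => /andP[xc cxh] ->.
  rewrite addrAC subrr add0r normrM ler_wpM2r//; apply: dfC.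
  by rewrite !ger0_norm// ?subr_ge0//; lra.
have xh : x + h <= x by rewrite gerDl ltW.
have [c] := MVT_segment xh (fun y _ => fdf y) (cfw _ _).
rewrite in_itv/= => /andP[xc cxh] E.
rewrite distrC E opprD addNKr normrM normrN ler_wpM2r//; apply: dfC.
by rewrite ler0_norm ?subr_le0// ltr0_norm//; lra.
Qed.

(** The mean value bound is applied three times: to f2, to f1 minus its tangent, to f minus its
    quadratic. Each pass needs a derivative bound only on the ball of radius |h|, which the previous
    pass supplies; the constant K in place of K/6 is good enough. *)
Lemma taylor2_remainder f f1 f2 f3 K :
  (forall x, is_derive x 1 f (f1 x)) -> (forall x, is_derive x 1 f1 (f2 x)) ->
  (forall x, is_derive x 1 f2 (f3 x)) -> (forall x, `|f3 x| <= K) ->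
  forall x h, `|f (x + h) - f x - f1 x * h - f2 x * h ^+ 2 / 2| <= K * `|h| ^+ 3.
Proof.
move=> d0 d1 d2 f3K x h.
have K0 : 0 <= K by exact: le_trans (f3K x).
have h2 y : `|y - x| <= `|h| -> `|f2 y - f2 x| <= K * `|h|.
  move=> yh; rewrite -{1}(subrKC x y).
  apply: le_trans (@lipschitz_increment f2 f3 x (y - x) K K0 d2 _) _ => //.
  by rewrite ler_wpM2l.
have h1 y : `|y - x| <= `|h| -> `|f1 y - f1 x - f2 x * (y - x)| <= K * `|h| ^+ 2.
  move=> yh; pose g y := f1 y - f2 x * (y - x).
  have dg (z : R) : is_derive z 1 g (f2 z - f2 x).
    by apply: is_derive_eq; rewrite /GRing.scale/=; ring.
  have := @lipschitz_increment g _ x (y - x) (K * `|h|) _ dg.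
  rewrite subrKC /g subrr mulr0 subr0 addrAC => W; apply: le_trans (W _ _) _.
  - by rewrite mulr_ge0.
  - by move=> z zy; apply: h2; exact: le_trans yh.
  - by rewrite expr2 mulrA ler_wpM2l// mulr_ge0.
pose g y := f y - f1 x * (y - x) - f2 x * (y - x) ^+ 2 / 2.
have dg (z : R) : is_derive z 1 g (f1 z - f1 x - f2 x * (z - x)).
  by apply: is_derive_eq; rewrite /GRing.scale/=; field.
have := @lipschitz_increment g _ x h (K * `|h| ^+ 2) _ dg.
rewrite /g.
have -> : f (x + h) - f1 x * (x + h - x) - f2 x * (x + h - x) ^+ 2 / 2 -
  (f x - f1 x * (x - x) - f2 x * (x - x) ^+ 2 / 2) =
  f (x + h) - f x - f1 x * h - f2 x * h ^+ 2 / 2 by field.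
move=> W; apply: le_trans (W _ _) _ => //.
- by rewrite mulr_ge0// exprn_ge0.
- by rewrite -mulrA -exprSr.
Qed.

End taylor2.

(** * Moments and characteristic function of the standard normal law *)

Section stdnormal_moments.
Context {R : realType}.
Local Notation gamma := (@stdnormal R).
Implicit Types (f : R -> R) (x C : R).

(** Degree six is the highest one that occurs: Lindeberg's remainder contains the third absolute
    power of z^2 - 1. *)
Lemma stdnormal_rintegrable f C : measurable_fun [set: R] f ->
  (forall x, `|f x| <= C * (1 + x ^+ 6)) -> rint gamma f.
Proof.
move=> mf fC.
have C0 : 0 <= C.
  by have := le_trans (normr_ge0 _) (fC 0); rewrite expr0n/= addr0 mulr1.
(* At y = x^2/4 the term y^3/3! of the exponential series is x^6/384, so 385 exp(x^2/4) dominates 1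
   + x^6. *)
apply: (@rintegrable_le _ (measurableTypeR R) R gamma f (fun x => C * 385 * expR (4^-1 * x ^+ 2))) => //.
  move=> x; apply: le_trans (fC x) _; rewrite -mulrA ler_wpM2l//.
  have x2 : 0 <= 4^-1 * x ^+ 2 by rewrite mulr_ge0// sqr_ge0.
  have := expR_ge1Dxn 2 x2; have -> : 3`!%:R = 6 :> R by [].
  have -> : (4^-1 * x ^+ 2) ^+ 3 / 6 = x ^+ 6 / 384 by field.
  have : 0 <= x ^+ 6 by rewrite exprn_even_ge0.
  lra.
apply: rintegrableZ.
have [|+ _] := @stdnormal_expR_sq R 4^-1; last exact.
by rewrite ltf_pV2 ?posrE//; lra.
Qed.

Lemma stdnormal_odd f C : measurable_fun [set: R] f ->
  (forall x, `|f x| <= C * (1 + x ^+ 6)) -> (forall x, f (- x) = - f x) ->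
  \int[gamma]_x f x = 0.
Proof.
move=> mf fC fN; have fi := stdnormal_rintegrable mf fC.
have ai : rint gamma (fun x => `|f x|) by exact: integrable_abse fi.
(* Reflection invariance is stated for nonnegative integrands, so |f| is added; being even, it
   cancels. *)
have mg : measurable_fun [set: R] (fun x => f x + `|f x|).
  by apply: measurable_funD => //; exact: measurableT_comp.
have mg' : measurable_fun [set: R] (fun x => (f x + `|f x|)%:E).
  exact/measurable_EFinP.
have g0 x : (0 <= (f x + `|f x|)%:E)%E.
  by rewrite lee_fin; have := ler_norm (- f x); rewrite normrN; lra.
have nfi : rint gamma (fun x => - f x).
  by under eq_fun do rewrite -mulN1r; exact: rintegrableZ.
have : \int[gamma]_x (- f x + `|f x|) = \int[gamma]_x (f x + `|f x|).
  rewrite /Rintegral -(integral_stdnormalN mg' g0).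
  by under [in RHS]eq_integral do rewrite fN normrN.
rewrite !RintegralD//.
have -> : \int[gamma]_x (- f x) = - \int[gamma]_x f x.
  by under eq_Rintegral do rewrite -mulN1r; rewrite RintegralZl// mulN1r.
lra.
Qed.

Lemma normrX_le6 k x : (k <= 6)%N -> `|x| ^+ k <= 1 + x ^+ 6.
Proof.
move=> k6; have [x1|x1] := leP `|x| 1.
  by rewrite (le_trans (exprn_ile1 k _ x1))// lerDl exprn_even_ge0.
rewrite -[x ^+ 6]ger0_norm ?exprn_even_ge0// normrX.
by rewrite (le_trans (ler_weXn2l (ltW x1) k6))// lerDr.
Qed.

Lemma stdnormal_rintegrableX k : (k <= 6)%N -> rint gamma (fun x => x ^+ k).
Proof.
move=> k6; apply: (@stdnormal_rintegrable _ 1); first exact: measurable_funX.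
by move=> x; rewrite mul1r normrX normrX_le6.
Qed.

Lemma stdnormal_mean : \int[gamma]_x x = 0.
Proof. by apply: (@stdnormal_odd _ 1) => // x; rewrite mul1r (@normrX_le6 1). Qed.

Lemma stdnormal_moment3 : \int[gamma]_x (x ^+ 3) = 0.
Proof.
apply: (@stdnormal_odd _ 1) => [|x|x]; first exact: measurable_funX.
  by rewrite mul1r normrX normrX_le6.
by rewrite exprNn -signr_odd/= mulN1r.
Qed.

(** Integrating exp(s x^2) >= 1 + s x^2 gives s m <= q - 1 with q = (1 - 2s)^(-1/2), for both signs
    of s, and q - 1 <= (q^2 - 1)/2 = s/(1 - 2s). Dividing by s and letting s tend to 0 from either
    side pins m to 1. *)
Lemma stdnormal_variance : \int[gamma]_x (x ^+ 2) = 1.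
Proof.
have i2 := @stdnormal_rintegrableX 2 isT.
set m := Rintegral _ _ _.
have H (s : R) : `|s| < 2^-1 -> s * m <= (Num.sqrt (1 - 2 * s))^-1 - 1.
  move=> s2; have [ei <-] := @stdnormal_expR_sq R s (le_lt_trans (ler_norm _) s2).
  rewrite -RintegralZl// lerBrDl -[X in X + _](@rintegral_cst _ _ _ gamma) -RintegralD//.
  - apply: le_Rintegral => //; last by move=> x _; exact: expR_ge1Dx.
    apply: rintegrableD; last exact: rintegrableZ.
    exact: finite_measure_integrable_cst.
  - exact: finite_measure_integrable_cst.
  - exact: rintegrableZ.
have K (s : R) : `|s| < 2^-1 -> (Num.sqrt (1 - 2 * s))^-1 - 1 <= s / (1 - 2 * s).
  move=> s2; have := s2; rewrite ltr_norml => /andP[s2a s2b].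
  have t0 : 0 < 1 - 2 * s by lra.
  set q := (Num.sqrt _)^-1.
  have q0 : 0 < q by rewrite invr_gt0 sqrtr_gt0.
  have q2 : q ^+ 2 = (1 - 2 * s)^-1 by rewrite exprVn sqr_sqrtr// ltW.
  have -> : s / (1 - 2 * s) = (q ^+ 2 - 1) / 2.
    by rewrite q2; field; rewrite gt_eqF.
  have := sqr_ge0 (q - 1); nra.
have U (e : R) : 0 < e -> e < 2^-1 -> m <= 1 + 2 * e / (1 - 2 * e).
  move=> e0 e2; have e2' : `|e| < 2^-1 by rewrite gtr0_norm.
  have := le_trans (H e e2') (K e e2'); rewrite -ler_pdivlMl//.
  move/le_trans; apply; rewrite le_eqVlt; apply/orP; left; apply/eqP; field.
  by rewrite !gt_eqF//; lra.
have L (e : R) : 0 < e -> e < 2^-1 -> m >= 1 - 2 * e / (1 + 2 * e).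
  move=> e0 e2; have e2' : `|- e| < 2^-1 by rewrite normrN gtr0_norm.
  have := le_trans (H _ e2') (K _ e2'); rewrite mulrN opprK !mulNr lerN2 => h.
  rewrite -(ler_pM2l e0) (le_trans _ h)// le_eqVlt; apply/orP; left; apply/eqP; field.
  by rewrite gt_eqF//; lra.
apply/eqP; rewrite eq_le; apply/andP; split.
  apply/ler_addgt0Pr => e e0.
  pose a := Num.min (8^-1) (e / 8).
  have a0 : 0 < a by rewrite lt_min; apply/andP; split; [rewrite invr_gt0|rewrite divr_gt0].
  have a8 : a <= 8^-1 by rewrite ge_min lexx.
  have ae : a <= e / 8 by rewrite ge_min lexx orbT.
  have a2 : a < 2^-1 by rewrite (le_lt_trans a8)// ltf_pV2 ?posrE//; lra.
  apply: le_trans (U a a0 a2) _; rewrite lerD2l ler_pdivrMr; nra.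
apply/ler_addgt0Pr => e e0; rewrite -lerBlDr.
pose a := Num.min (8^-1) (e / 8).
have a0 : 0 < a by rewrite lt_min; apply/andP; split; [rewrite invr_gt0|rewrite divr_gt0].
have a8 : a <= 8^-1 by rewrite ge_min lexx.
have ae : a <= e / 8 by rewrite ge_min lexx orbT.
have a2 : a < 2^-1 by rewrite (le_lt_trans a8)// ltf_pV2 ?posrE//; lra.
apply: le_trans _ (L a a0 a2); rewrite lerD2l lerN2 ler_pdivrMr; nra.
Qed.

(** For independent X and Y the sum X + Y has the law of sqrt 2 X; comparing fourth moments gives 2
    m + 6 = 4 m. *)
Lemma stdnormal_moment4 : \int[gamma]_x (x ^+ 4) = 3.
Proof.
have m4 : measurable_fun [set: R] (fun x => (x ^+ 4)%:E).
  by apply/measurable_EFinP; exact: measurable_funX.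
have p4 x : (0 <= (x ^+ 4)%:E)%E by rewrite lee_fin exprn_even_ge0.
have s2 : 0 < Num.sqrt (2 : R) by rewrite sqrtr_gt0.
have := @stdnormal_convolution R 1 1 (Num.sqrt 2) (fun x => (x ^+ 4)%:E) ltr01 ltr01 s2 _ m4 p4.
rewrite sqr_sqrtr// expr1n => /(_ erefl).
have i k := @stdnormal_rintegrableX k.
have E x : \int[gamma]_y ((1 * x + 1 * y) ^+ 4) = x ^+ 4 + 6 * x ^+ 2 + \int[gamma]_x (x ^+ 4).
  have -> : (fun y => (1 * x + 1 * y) ^+ 4) = (fun y => x ^+ 4 + (6 * x ^+ 2) * y ^+ 2 + ((4 * x ^+ 3) *
    y ^+ 1 + ((4 * x) * y ^+ 3 + y ^+ 4))).
    by apply/funext => y; ring.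
  have c0 : rint gamma (fun _ => x ^+ 4) by exact: finite_measure_integrable_cst.
  have c1 : rint gamma (fun y => (6 * x ^+ 2) * y ^+ 2) by exact/rintegrableZ/i.
  have c2 : rint gamma (fun y => (4 * x ^+ 3) * y ^+ 1) by exact/rintegrableZ/i.
  have c3 : rint gamma (fun y => (4 * x) * y ^+ 3) by exact/rintegrableZ/i.
  have c4 : rint gamma (fun y => y ^+ 4) by exact/i.
  rewrite (RintegralD measurableT (rintegrableD c0 c1) (rintegrableD c2 (rintegrableD c3 c4))).
  rewrite (RintegralD measurableT c0 c1) (RintegralD measurableT c2 (rintegrableD c3 c4)).
  rewrite (RintegralD measurableT c3 c4) rintegral_cst.
  rewrite (RintegralZl _ measurableT (i 2 isT)) (RintegralZl _ measurableT (i 1 isT)).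
  rewrite (RintegralZl _ measurableT (i 3 isT)).
  by rewrite stdnormal_variance stdnormal_moment3 stdnormal_mean; ring.
have J (x : R) : (\int[gamma]_y ((1 * x + 1 * y) ^+ 4)%:E =
    (x ^+ 4 + 6 * x ^+ 2 + \int[gamma]_x (x ^+ 4))%:E)%E.
  rewrite -E rintegral_EFin//; apply: (@stdnormal_rintegrable _ (8 * (1 + x ^+ 4))).
    by apply: measurable_funX; apply: measurable_funD.
  move=> y; rewrite !mul1r ger0_norm ?exprn_even_ge0//.
  have y6 : y ^+ 4 <= 1 + y ^+ 6.
    by rewrite -[y ^+ 4]ger0_norm ?exprn_even_ge0// normrX normrX_le6.
  have h1 : (x + y) ^+ 2 <= 2 * (x ^+ 2 + y ^+ 2) by have := sqr_ge0 (x - y); nra.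
  have h2 : (x + y) ^+ 4 <= 8 * (x ^+ 4 + y ^+ 4).
    have := sqr_ge0 (x + y); have := sqr_ge0 (x ^+ 2 - y ^+ 2); nra.
  have x4 : 0 <= x ^+ 4 by rewrite exprn_even_ge0.
  have : 0 <= y ^+ 6 by rewrite exprn_even_ge0.
  nra.
under eq_integral do rewrite J.
under [in RHS]eq_integral do rewrite exprMn.
move/(congr1 fine); rewrite -!/(Rintegral _ _ _).
have -> : Num.sqrt (2 : R) ^+ 4 = 4 by rewrite (exprM _ 2 2) sqr_sqrtr//; ring.
rewrite RintegralD//; last 2 first.
  by apply: rintegrableD; [exact: i|apply/rintegrableZ/i].
  exact: finite_measure_integrable_cst.
rewrite RintegralD//; [|exact: i|exact/rintegrableZ/i].
rewrite RintegralZl//; last exact: i.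
rewrite RintegralZl//; last exact: i.
rewrite rintegral_cst stdnormal_variance; lra.
Qed.

(** Signed bounded functions are reduced to nonnegative ones by adding M. Zero coefficients are
    included because the variances to which this is applied may vanish. *)
Lemma stdnormal_convolution_bounded f (M a b c : R) : 0 <= a -> 0 <= b -> 0 <= c ->
  c ^+ 2 = a ^+ 2 + b ^+ 2 -> measurable_fun [set: R] f -> (forall x, `|f x| <= M) ->
  \int[gamma]_x \int[gamma]_y f (a * x + b * y) = \int[gamma]_x f (c * x).
Proof.
move=> a0 b0 c0 abc mf fM.
have sq_inj (u v : R) : 0 <= u -> 0 <= v -> u ^+ 2 = v ^+ 2 -> u = v.
  by move=> u0 v0 /eqP; rewrite eqrXn2// => /eqP.
have [a1|a1] := eqVneq a 0.
  rewrite (sq_inj c b) ?abc ?a1 ?expr0n ?add0r//.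
  under eq_Rintegral do under eq_Rintegral do rewrite mul0r add0r.
  by rewrite rintegral_cst.
have [b1|b1] := eqVneq b 0.
  rewrite (sq_inj c a) ?abc ?b1 ?expr0n ?addr0//.
  by under eq_Rintegral do under eq_Rintegral do rewrite mul0r addr0;
    under eq_Rintegral do rewrite rintegral_cst.
have ap : 0 < a by rewrite lt_neqAle eq_sym a1.
have bp : 0 < b by rewrite lt_neqAle eq_sym b1.
have cp : 0 < c.
  by rewrite lt_neqAle c0 andbT; apply/eqP => c00; move: abc; rewrite -c00 expr0n/=; nra.
have mg : measurable_fun [set: R] (fun x => (f x + M)%:E).
  by apply/measurable_EFinP; exact: measurable_funD.
have g0 x : (0 <= (f x + M)%:E)%E.
  by rewrite lee_fin; have := fM x; rewrite ler_norml => /andP[]; lra.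
have mlin (u v : R) : measurable_fun [set: R] (fun y : R => f (u + v * y)).
  by apply: (measurableT_comp mf); apply: measurable_funD => //; exact: measurable_funM.
have ilin (u v : R) : rint gamma (fun y : R => f (u + v * y)).
  apply: (@rintegrable_bounded _ _ _ gamma _ M); first exact: mlin.
  by move=> y; exact: fM.
have icst (u : R) : rint gamma (fun _ => u) by exact: finite_measure_integrable_cst.
have := @stdnormal_convolution R a b c _ ap bp cp abc mg g0.
under eq_integral => x _.
  rewrite -rintegral_EFin ?RintegralD ?rintegral_cst//; last exact: rintegrableD.
  over.
move/(congr1 fine); rewrite -!/(Rintegral _ _ _).
have mF : measurable_fun [set: R] (fun x => \int[gamma]_y f (a * x + b * y)).
  apply: (@measurable_prob_Rintegral _ _ _ _ _ gamma (fun z => f (a * z.1 + b * z.2)) M) => //.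
  by apply: (measurableT_comp mf); apply: measurable_funD; exact: measurable_funM.
have iF : rint gamma (fun x => \int[gamma]_y f (a * x + b * y)).
  apply: (@rintegrable_bounded _ _ _ gamma _ M) => // x.
  by apply: rintegral_normr_le => [|y]; [exact: mlin|exact: fM].
have iG : rint gamma (fun x => f (c * x)).
  by have := ilin 0 c; under eq_fun do rewrite add0r.
rewrite RintegralD// RintegralD// rintegral_cst; exact: addIr.
Qed.

Let f_ a := \int[gamma]_x cos (a * x).

Let mcos a : measurable_fun [set: R] (fun x => cos (a * x)).
Proof.
apply: measurableT_comp; first by apply: continuous_measurable_fun; exact: continuous_cos.
exact: measurable_funM.
Qed.

Let msin a : measurable_fun [set: R] (fun x => sin (a * x)).
Proof.
apply: measurableT_comp; first by apply: continuous_measurable_fun; exact: continuous_sin.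
exact: measurable_funM.
Qed.

Let icos a : rint gamma (fun x => cos (a * x)).
Proof.
by apply: (@rintegrable_bounded _ _ _ gamma _ 1) => [|x]; [exact: mcos|exact: cos_max].
Qed.

Let isin a : rint gamma (fun x => sin (a * x)).
Proof.
by apply: (@rintegrable_bounded _ _ _ gamma _ 1) => [|x]; [exact: msin|exact: sin_max].
Qed.

Let sin_int0 a : \int[gamma]_x sin (a * x) = 0.
Proof.
apply: (@stdnormal_odd _ 1) => // x; last by rewrite mulrN sinN.
by rewrite mul1r (le_trans (sin_max _))// lerDl exprn_even_ge0.
Qed.

Let cos_mul (a b c : R) : 0 <= a -> 0 <= b -> 0 <= c -> c ^+ 2 = a ^+ 2 + b ^+ 2 ->
  f_ c = f_ a * f_ b.
Proof.
move=> a0 b0 c0 abc; rewrite /f_ -(@stdnormal_convolution_bounded cos 1 a b c)//.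
- under eq_Rintegral => x _.
    under eq_Rintegral do rewrite cosD.
    rewrite RintegralB//; [|exact/rintegrableZ/icos|exact/rintegrableZ/isin].
    rewrite (RintegralZl _ measurableT (icos b)) (RintegralZl _ measurableT (isin b)).
    by rewrite sin_int0 mulr0 subr0; over.
  by rewrite RintegralZr//; exact: icos.
- by apply: continuous_measurable_fun; exact: continuous_cos.
- exact: cos_max.
Qed.

Let cos_iter (a : R) n : 0 <= a -> f_ (Num.sqrt n%:R * a) = f_ a ^+ n.
Proof.
move=> a0; elim: n => [|n IH].
  rewrite sqrtr0 mul0r expr0 /f_.
  by under eq_Rintegral do rewrite mul0r cos0; rewrite rintegral_cst.
rewrite exprS -IH; apply: cos_mul => //; rewrite ?mulr_ge0//.
by rewrite !exprMn !sqr_sqrtr// -natr1; ring.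
Qed.

Let cos_approx (u : R) : 0 <= u -> u <= 1 ->
  `|f_ u - expR (- (u ^+ 2 / 2))| <= (\int[gamma]_x (`|x| ^+ 3) + 1) * u ^+ 3.
Proof.
move=> u0 u1.
have T x : `|cos (u * x) - (1 - (u ^+ 2 / 2) * x ^+ 2)| <= u ^+ 3 * `|x| ^+ 3.
  have dN (y : R) : is_derive y 1 (fun x : R => - sin x) (- cos y).
    by apply: is_derive_eq.
  have dN' (y : R) : is_derive y 1 (fun x : R => - cos x) (sin y).
    by apply: is_derive_eq; rewrite opprK.
  have := @taylor2_remainder R cos (fun x => - sin x) (fun x => - cos x) sin 1
    (@is_derive_cos R) dN dN' (@sin_max R) 0 (u * x).
  rewrite add0r cos0 sin0 mul1r normrM (ger0_norm u0) exprMn.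
  by congr (`|_| <= _); field.
have i3 : rint gamma (fun x => `|x| ^+ 3).
  apply: (@stdnormal_rintegrable _ 1).
    by apply: measurable_funX; exact: normr_measurable.
  by move=> x; rewrite mul1r normrX normr_id normrX_le6.
have i2 := @stdnormal_rintegrableX 2 isT.
have ic : rint gamma (fun _ => 1 : R) by exact: finite_measure_integrable_cst.
have iq : rint gamma (fun x => 1 - (u ^+ 2 / 2) * x ^+ 2).
  by apply: rintegrableB => //; exact: rintegrableZ.
have H1 : `|f_ u - (1 - u ^+ 2 / 2)| <= u ^+ 3 * \int[gamma]_x (`|x| ^+ 3).
  have -> : 1 - u ^+ 2 / 2 = \int[gamma]_x (1 - (u ^+ 2 / 2) * x ^+ 2).
    by rewrite RintegralB// ?rintegral_cst ?RintegralZl// ?stdnormal_variance ?mulr1//; exact: rintegrableZ.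
  rewrite /f_ -RintegralB// -RintegralZl//; apply: rintegral_norm_le => //.
    have /measurable_EFinP mq := measurable_int _ iq.
    by apply: measurable_funB; [exact: mcos|exact: mq].
  exact: rintegrableZ.
have H2 : `|1 - u ^+ 2 / 2 - expR (- (u ^+ 2 / 2))| <= u ^+ 3.
  set v := u ^+ 2 / 2.
  have v0 : 0 <= v by rewrite divr_ge0// sqr_ge0.
  have h1 := expR_ge1Dx (- v).
  have h2 : expR (- v) <= 1 - v + v ^+ 2.
    rewrite expRN; apply: (@le_trans _ _ (1 + v)^-1).
      by rewrite lef_pV2 ?posrE ?expR_gt0//; [exact: expR_ge1Dx|lra].
    rewrite -div1r ler_pdivrMr; [|lra].
    have : 0 <= v ^+ 3 by rewrite exprn_ge0.
    nra.
  have h3 : v ^+ 2 <= u ^+ 3.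
    have : u ^+ 4 <= u ^+ 3 by rewrite ler_wiXn2l.
    have : 0 <= u ^+ 4 by rewrite exprn_ge0.
    have -> : v ^+ 2 = u ^+ 4 / 4 by rewrite /v; field.
    by lra.
  by rewrite ler_norml; apply/andP; split; lra.
rewrite mulrDl mul1r [in leRHS]mulrC.
apply: le_trans (lerD H1 H2); apply: le_trans (ler_normD _ _).
by rewrite addrA subrK.
Qed.

Let pow_lipschitz (x y : R) n : `|x| <= 1 -> `|y| <= 1 ->
  `|x ^+ n - y ^+ n| <= n%:R * `|x - y|.
Proof.
move=> x1 y1; elim: n => [|n IH]; first by rewrite !expr0 subrr normr0 mul0r.
have -> : x ^+ n.+1 - y ^+ n.+1 = x * (x ^+ n - y ^+ n) + (x - y) * y ^+ n.
  by rewrite !exprS; ring.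
rewrite (le_trans (ler_normD _ _))// !normrM -natr1 mulrDl mul1r lerD//.
  by apply: le_trans IH; rewrite -[leRHS]mul1r ler_wpM2r.
by rewrite -[leRHS]mulr1 ler_wpM2l// normrX exprn_ile1.
Qed.

(** A central limit argument run backwards. The convolution identity gives f_(sqrt n a) = f_(a)^n,
    an equation that exp(-a^2/2) also satisfies. At u = a/m the two functions differ by O(u^3), so
    their values at a, which are the m^2-th powers, differ by m^2 O(u^3) = O(a^3/m) for every large
    m. *)
Lemma stdnormal_cos a : \int[gamma]_x cos (a * x) = expR (- (a ^+ 2 / 2)).
Proof.
wlog a0 : a / 0 <= a.
  move=> H; have [/H//|a0] := leP 0 a.
  rewrite -[in RHS]sqrrN -H; last by rewrite oppr_ge0 ltW.
  by apply: eq_Rintegral => x _; rewrite mulNr cosN.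
rewrite -/(f_ a); apply/eqP; rewrite -subr_eq0 -normr_le0.
set C := \int[gamma]_x (`|x| ^+ 3) + 1.
have C0 : 0 <= C by rewrite addr_ge0//; apply: Rintegral_ge0 => x _; rewrite exprn_ge0.
have H m : (0 < m)%N -> a <= m%:R -> `|f_ a - expR (- (a ^+ 2 / 2))| * m%:R <= C * a ^+ 3.
  move=> m0 am; have mp : 0 < m%:R :> R by rewrite ltr0n.
  pose u := a / m%:R.
  have u0 : 0 <= u by rewrite divr_ge0// ltW.
  have u1 : u <= 1 by rewrite ler_pdivrMr// mul1r.
  have -> : f_ a = f_ u ^+ (m ^ 2).
    rewrite -cos_iter// natrX sqrtr_sqr ger0_norm ?ltW// /u.
    by congr f_; field; rewrite gt_eqF.
  have -> : expR (- (a ^+ 2 / 2)) = expR (- (u ^+ 2 / 2)) ^+ (m ^ 2).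
    rewrite -expRM_natl /u; congr expR; rewrite natrX; field; by rewrite gt_eqF.
  have := @pow_lipschitz (f_ u) (expR (- (u ^+ 2 / 2))) (m ^ 2).
  have -> : `|f_ u| <= 1 by apply: rintegral_normr_le => [|x]; [exact: mcos|exact: cos_max].
  have -> : `|expR (- (u ^+ 2 / 2))| <= 1.
    by rewrite gtr0_norm ?expR_gt0// -expR0 ler_expR oppr_le0 divr_ge0// sqr_ge0.
  move=> /(_ isT isT) h.
  apply: (@le_trans _ _ ((m ^ 2)%:R * (C * u ^+ 3) * m%:R)).
    apply: ler_wpM2r; first exact: ltW.
    by apply: le_trans h _; apply: ler_wpM2l => //; exact: cos_approx.
  rewrite natrX /u le_eqVlt; apply/orP; left; apply/eqP; field; by rewrite gt_eqF.
apply/ler_addgt0Pr => e e0; rewrite add0r.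
pose m := (Num.truncn (C * a ^+ 3 / e + a)).+1.
have r0 : 0 <= C * a ^+ 3 / e by apply: divr_ge0; [rewrite mulr_ge0// exprn_ge0|exact: ltW].
have mC : C * a ^+ 3 / e + a < m%:R by rewrite truncnS_gt.
have := H m isT; have -> : a <= m%:R by lra.
move=> /(_ isT) h.
have mp : 0 < m%:R :> R by rewrite ltr0n.
rewrite -(ler_pM2r mp); apply: le_trans h _.
by rewrite [leRHS]mulrC -ler_pdivrMr//; lra.
Qed.

End stdnormal_moments.

(** * Lindeberg replacement for weighted sums of squared normals *)

Section averages.
Context {R : realType}.
Local Notation gamma := (@stdnormal R).
Implicit Types (f g : R -> R) (x a c K M : R) (s : seq R).

Definition bmeas f := measurable_fun [set: R] f /\ exists M, forall x, `|f x| <= M.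

Definition average g f x := \int[gamma]_z f (x + g z).

Lemma bmeas_rint g f x : measurable_fun [set: R] g -> bmeas f ->
  rint gamma (fun z => f (x + g z)).
Proof.
move=> mg [mf [M fM]]; apply: (@rintegrable_bounded _ _ _ gamma _ M) => [|z]; last exact: fM.
by apply: (measurableT_comp mf); exact: measurable_funD.
Qed.

Lemma bmeas_average g f : measurable_fun [set: R] g -> bmeas f -> bmeas (average g f).
Proof.
move=> mg [mf [M fM]]; split; last first.
  exists M => x; apply: rintegral_normr_le => [|z]; last exact: fM.
  by apply: (measurableT_comp mf); exact: measurable_funD.
have mF : measurable_fun [set: R * R] (fun z => f (z.1 + g z.2)).
  by apply: (measurableT_comp mf); apply: measurable_funD => //; exact: measurableT_comp.
exact: (measurable_prob_Rintegral gamma mF (fun z => fM _)).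
Qed.

Let msq a : measurable_fun [set: R] (fun z => a * z ^+ 2).
Proof. by apply: measurable_funM => //; exact: measurable_funX. Qed.

Let mlin a : measurable_fun [set: R] (fun z => a * z).
Proof. exact: measurable_funM. Qed.

(** The expectation of f(x + sum_j a_j Z_j^2) for independent standard normals Z_j, as nested
    one-dimensional averages so that no product space is needed. *)
Fixpoint chisq_law s f : R -> R :=
  if s is a :: s' then average (fun z => a * z ^+ 2) (chisq_law s' f) else f.

Definition gauss_law c f := average (fun z => c * z) f.

Lemma bmeas_chisq s f : bmeas f -> bmeas (chisq_law s f).
Proof. by move=> bf; elim: s => //= a s IH; apply: bmeas_average => //; exact: msq. Qed.

Lemma bmeas_gauss c f : bmeas f -> bmeas (gauss_law c f).
Proof. by apply: bmeas_average; exact: mlin. Qed.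

Lemma bmeasD f g : bmeas f -> bmeas g -> bmeas (fun x => f x + g x).
Proof.
move=> [mf [M fM]] [mg [N gN]]; split; first exact: measurable_funD.
by exists (M + N) => x; rewrite (le_trans (ler_normD _ _))// lerD.
Qed.

Lemma bmeasZ c f : bmeas f -> bmeas (fun x => c * f x).
Proof.
move=> [mf [M fM]]; split; first exact: measurable_funM.
by exists (`|c| * M) => x; rewrite normrM ler_wpM2l.
Qed.

Lemma bmeas_sum (I : Type) (r : seq I) (F : I -> R -> R) :
  (forall i, bmeas (F i)) -> bmeas (fun x => \sum_(i <- r) F i x).
Proof.
move=> bF; elim: r => [|i r IH].
  under eq_fun do rewrite big_nil.
  by split; [exact: measurable_cst|exists 0 => x; rewrite normr0].
under eq_fun do rewrite big_cons.
exact: bmeasD.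
Qed.

Lemma chisq_lawZ s c f x : bmeas f ->
  chisq_law s (fun x => c * f x) x = c * chisq_law s f x.
Proof.
move=> bf; elim: s x => //= a s IH x; rewrite /average.
under eq_Rintegral do rewrite IH.
by rewrite RintegralZl//; apply: (bmeas_rint x (msq a)); exact: bmeas_chisq.
Qed.

Lemma chisq_lawD s f g x : bmeas f -> bmeas g ->
  chisq_law s (fun x => f x + g x) x = chisq_law s f x + chisq_law s g x.
Proof.
move=> bf bg; elim: s x => //= a s IH x; rewrite /average.
under eq_Rintegral do rewrite IH.
by rewrite RintegralD//; apply: (bmeas_rint x (msq a)); exact: bmeas_chisq.
Qed.

Lemma chisq_law_sum (I : Type) (r : seq I) s (F : I -> R -> R) x :
  (forall i, bmeas (F i)) ->
  chisq_law s (fun x => \sum_(i <- r) F i x) x = \sum_(i <- r) chisq_law s (F i) x.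
Proof.
move=> bF; elim: r => [|i r IH].
  rewrite big_nil; transitivity (chisq_law s (fun y => 0 * cst 0 y) x).
    by congr (chisq_law s _ x); apply/funext => y; rewrite big_nil mul0r.
  rewrite chisq_lawZ ?mul0r//.
  by split; [exact: measurable_cst|exists 0 => y; rewrite normr0].
rewrite big_cons -IH -chisq_lawD//; last exact: bmeas_sum.
by congr (chisq_law s _ x); apply/funext => y; rewrite big_cons.
Qed.

(** Weights and starting point are nonnegative, so only values at y >= 0 are met; the polynomial
    approximation of logistic functions holds on that half-line. *)
Lemma chisq_law_dist s f g x K : (forall a, a \in s -> 0 <= a) -> 0 <= x ->
  bmeas f -> bmeas g -> (forall y, 0 <= y -> `|f y - g y| <= K) ->
  `|chisq_law s f x - chisq_law s g x| <= K.
Proof.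
move=> + + bf bg fgK; elim: s x => [x _|a s IH x s0] x0 /=; first exact: fgK.
have a0 : 0 <= a by apply: s0; rewrite mem_head.
apply: rintegral_dist2.
- by apply: (bmeas_rint x (msq a)); exact: bmeas_chisq.
- by apply: (bmeas_rint x (msq a)); exact: bmeas_chisq.
- move=> z; apply: IH => [b bs|]; first by apply: s0; rewrite in_cons bs orbT.
  by rewrite addr_ge0// mulr_ge0// sqr_ge0.
Qed.

(** Cutting off at max y 0 makes the exponential a bounded test function on the whole line; the cut
    is never felt, since x and the weights are nonnegative. *)
Lemma chisq_law_expR s t x : 0 <= t -> (forall a, a \in s -> 0 <= a) -> 0 <= x ->
  chisq_law s (fun y => expR (- (t * Num.max y 0))) x =
  expR (- (t * x)) * \prod_(a <- s) \int[gamma]_z expR (- (t * (a * z ^+ 2))).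
Proof.
move=> t0; elim: s x => [x _|a s IH x s0] x0 /=; first by rewrite big_nil mulr1 max_l.
have a0 : 0 <= a by apply: s0; rewrite mem_head.
rewrite /average big_cons.
under eq_Rintegral => z _.
  rewrite IH; last 2 first.
  - by move=> b bs; apply: s0; rewrite in_cons bs orbT.
  - by rewrite addr_ge0// mulr_ge0// sqr_ge0.
  rewrite mulrDr opprD expRD mulrAC; over.
rewrite RintegralZl//; first by rewrite mulrAC mulrA.
apply: (@rintegrable_bounded _ _ _ gamma _ 1) => [|z].
  apply: measurableT_comp => //; apply: measurableT_comp => //.
  by apply: measurable_funM => //; exact: msq.
rewrite gtr0_norm ?expR_gt0// -expR0 ler_expR oppr_le0.
by apply: mulr_ge0 => //; apply: mulr_ge0 => //; exact: sqr_ge0.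
Qed.

(** The remainder bound is recorded instead of a third derivative: it survives averaging with the
    same K, so nothing is differentiated under an integral. *)
Record taylor_class K f f1 f2 : Prop := TaylorClass {
  taylor_bmeas : bmeas f;
  taylor_bmeas1 : bmeas f1;
  taylor_bmeas2 : bmeas f2;
  taylor_bound : forall x h,
    `|f (x + h) - f x - f1 x * h - f2 x * h ^+ 2 / 2| <= K * `|h| ^+ 3 }.

Lemma taylor_average g K f f1 f2 : measurable_fun [set: R] g ->
  taylor_class K f f1 f2 -> taylor_class K (average g f) (average g f1) (average g f2).
Proof.
move=> mg [b b1 b2 bd]; split; try exact: bmeas_average.
move=> x h; rewrite /average.
have i0 := bmeas_rint x mg b; have i0h := bmeas_rint (x + h) mg b.
have i1 := bmeas_rint x mg b1; have i2 := bmeas_rint x mg b2.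
have -> : \int[gamma]_z f (x + h + g z) - \int[gamma]_z f (x + g z) -
    \int[gamma]_z f1 (x + g z) * h - \int[gamma]_z f2 (x + g z) * h ^+ 2 / 2 =
  \int[gamma]_z (f (x + h + g z) - f (x + g z) - h * f1 (x + g z) -
    (h ^+ 2 / 2) * f2 (x + g z)).
  rewrite (RintegralB measurableT (rintegrableB (rintegrableB i0h i0) (rintegrableZ h i1))
    (rintegrableZ (h ^+ 2 / 2) i2)).
  rewrite (RintegralB measurableT (rintegrableB i0h i0) (rintegrableZ h i1)).
  rewrite (RintegralB measurableT i0h i0).
  rewrite (RintegralZl _ measurableT i1) (RintegralZl _ measurableT i2).
  by congr (_ - _ - _); [rewrite mulrC|rewrite -mulrA mulrC].
apply: rintegral_normr_le => [|z].
  have /measurable_EFinP := measurable_int _ (rintegrableB (rintegrableB (rintegrableB i0h i0)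
    (rintegrableZ h i1))
    (rintegrableZ (h ^+ 2 / 2) i2)).
  exact.
have := bd (x + g z) h; rewrite (addrAC x h (g z)).
by congr (`|_| <= _); field.
Qed.

Definition lindeberg_moment : R :=
  \int[gamma]_z (`|z ^+ 2 - 1| ^+ 3 + `|Num.sqrt 2 * z| ^+ 3).

Let int3 : rint gamma (fun z => `|z ^+ 2 - 1| ^+ 3 + `|Num.sqrt 2 * z| ^+ 3).
Proof.
apply: (@stdnormal_rintegrable _ _ (8 + Num.sqrt 2 ^+ 3)).
  apply: measurable_funD; apply: measurable_funX; apply: measurableT_comp => //.
  by apply: measurable_funB => //; exact: measurable_funX.
move=> x; rewrite normrM (ger0_norm (sqrtr_ge0 _)) exprMn.
have x6 : 0 <= x ^+ 6 by rewrite exprn_even_ge0.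
have s0 : 0 <= Num.sqrt 2 ^+ 3 :> R by rewrite exprn_ge0// sqrtr_ge0.
rewrite [leLHS]ger0_norm; last first.
  by apply: addr_ge0; [exact: exprn_ge0|apply: mulr_ge0 => //; exact: exprn_ge0].
rewrite mulrDl lerD//; last by rewrite ler_wpM2l// normrX_le6.
have [x1|x1] := leP (x ^+ 2) 1.
  have h : `|x ^+ 2 - 1| <= 1.
    by rewrite ler0_norm ?subr_le0//; have := sqr_ge0 x; lra.
  have : `|x ^+ 2 - 1| ^+ 3 <= 1 by rewrite exprn_ile1.
  lra.
have h : `|x ^+ 2 - 1| <= x ^+ 2 by rewrite gtr0_norm ?subr_gt0//; lra.
have : `|x ^+ 2 - 1| ^+ 3 <= (x ^+ 2) ^+ 3 by rewrite lerXn2r// ?nnegrE// ltW// (lt_trans ltr01).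
rewrite -exprM/=; lra.
Qed.

(** The variables a (Z^2 - 1) and sqrt 2 a Z share the mean 0 and the variance 2 a^2, so the Taylor
    terms of order at most two cancel and only third absolute moments remain. *)
Lemma lindeberg_step K f f1 f2 a x : 0 <= K -> 0 <= a -> taylor_class K f f1 f2 ->
  `|average (fun z => a * (z ^+ 2 - 1)) f x - gauss_law (Num.sqrt 2 * a) f x| <=
  K * lindeberg_moment * a ^+ 3.
Proof.
move=> K0 a0 [b b1 b2 bd].
have m1 : measurable_fun [set: R] (fun z : R => a * (z ^+ 2 - 1)).
  by apply: measurable_funM => //; apply: measurable_funB => //; exact: measurable_funX.
have m2 := mlin (Num.sqrt 2 * a).
have j1 : rint gamma (fun z : R => z ^+ 2 - 1).
  apply: rintegrableB; first exact: stdnormal_rintegrableX.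
  exact: finite_measure_integrable_cst.
have j2 : rint gamma (fun z : R => (z ^+ 2 - 1) ^+ 2).
  have -> : (fun z : R => (z ^+ 2 - 1) ^+ 2) = (fun z => z ^+ 4 - 2 * z ^+ 2 + 1).
    by apply/funext => z; ring.
  apply: rintegrableD; last exact: finite_measure_integrable_cst.
  by apply: rintegrableB; [exact: stdnormal_rintegrableX|apply: rintegrableZ; exact: stdnormal_rintegrableX].
have jc : rint gamma (fun _ : R => f x) by exact: finite_measure_integrable_cst.
have E1 : \int[gamma]_z (z ^+ 2 - 1) = 0.
  rewrite RintegralB//; [|exact: stdnormal_rintegrableX|exact: finite_measure_integrable_cst].
  by rewrite stdnormal_variance rintegral_cst subrr.
have E2 : \int[gamma]_z ((z ^+ 2 - 1) ^+ 2) = 2.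
  have i4 := @stdnormal_rintegrableX R 4 isT; have i2 := @stdnormal_rintegrableX R 2 isT.
  have i1 : rint gamma (fun _ : R => 1) by exact: finite_measure_integrable_cst.
  under eq_Rintegral => z _.
    have -> : (z ^+ 2 - 1) ^+ 2 = z ^+ 4 - 2 * z ^+ 2 + 1 by ring.
    over.
  rewrite (RintegralD measurableT (rintegrableB i4 (rintegrableZ 2 i2)) i1).
  rewrite (RintegralB measurableT i4 (rintegrableZ 2 i2)) (RintegralZl _ measurableT i2).
  by rewrite stdnormal_moment4 stdnormal_variance rintegral_cst; ring.
(* both averages agree with [f x + a ^+ 2 * f2 x] up to third order *)
pose T := f x + a ^+ 2 * f2 x.
have T1 : T = \int[gamma]_z (f x + (f1 x * a) * (z ^+ 2 - 1) + (f2 x * a ^+ 2 / 2) * (z ^+ 2 - 1) ^+ 2).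
  rewrite (RintegralD measurableT (rintegrableD jc (rintegrableZ _ j1)) (rintegrableZ _ j2)).
  rewrite (RintegralD measurableT jc (rintegrableZ _ j1)).
  rewrite (RintegralZl _ measurableT j1) (RintegralZl _ measurableT j2) E1 E2 rintegral_cst /T.
  by field.
have k1 : rint gamma (fun z : R => z) by exact: (@stdnormal_rintegrableX R 1 isT).
have k2 := @stdnormal_rintegrableX R 2 isT.
have T2 : T = \int[gamma]_z (f x + (f1 x * (Num.sqrt 2 * a)) * z + (f2 x * a ^+ 2) * z ^+ 2).
  rewrite (RintegralD measurableT (rintegrableD jc (rintegrableZ _ k1)) (rintegrableZ _ k2)).
  rewrite (RintegralD measurableT jc (rintegrableZ _ k1)).
  rewrite (RintegralZl _ measurableT k1) (RintegralZl _ measurableT k2).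
  by rewrite stdnormal_mean stdnormal_variance rintegral_cst /T; ring.
have l1 : rint gamma (fun z : R => `|z ^+ 2 - 1| ^+ 3).
  apply: (@rintegrable_le _ _ _ gamma _ _ _ _ int3).
    apply: measurable_funX; apply: measurableT_comp => //.
    by apply: measurable_funB => //; exact: measurable_funX.
  by move=> z; rewrite ger0_norm ?exprn_ge0// lerDl exprn_ge0.
have l2 : rint gamma (fun z : R => `|Num.sqrt 2 * z| ^+ 3).
  apply: (@rintegrable_le _ _ _ gamma _ _ _ _ int3).
    by apply: measurable_funX; apply: measurableT_comp.
  by move=> z; rewrite ger0_norm ?exprn_ge0// lerDr exprn_ge0.
have D1 : `|average (fun z => a * (z ^+ 2 - 1)) f x - T| <=
    K * a ^+ 3 * \int[gamma]_z (`|z ^+ 2 - 1| ^+ 3).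
  have i0 := bmeas_rint x m1 b.
  have it := rintegrableD (rintegrableD jc (rintegrableZ (f1 x * a) j1)) (rintegrableZ (f2 x * a ^+ 2 /
    2) j2).
  rewrite T1 /average -(RintegralB measurableT i0 it) -(RintegralZl _ measurableT l1).
  apply: rintegral_norm_le; last exact: rintegrableZ.
    by have /measurable_EFinP := measurable_int _ (rintegrableB i0 it).
  move=> z; have := bd x (a * (z ^+ 2 - 1)).
  rewrite normrM (ger0_norm a0) exprMn mulrA; by congr (`|_| <= _); field.
have D2 : `|gauss_law (Num.sqrt 2 * a) f x - T| <=
    K * a ^+ 3 * \int[gamma]_z (`|Num.sqrt 2 * z| ^+ 3).
  have i0 := bmeas_rint x m2 b.
  have it := rintegrableD (rintegrableD jc (rintegrableZ (f1 x * (Num.sqrt 2 * a)) k1)) (rintegrableZ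
    (f2 x * a ^+ 2) k2).
  rewrite T2 /gauss_law /average -(RintegralB measurableT i0 it) -(RintegralZl _ measurableT l2).
  apply: rintegral_norm_le; last exact: rintegrableZ.
    by have /measurable_EFinP := measurable_int _ (rintegrableB i0 it).
  move=> z; have := bd x (Num.sqrt 2 * a * z).
  rewrite mulrAC [X in _ -> _ <= X](_ : _ = K * `|Num.sqrt 2 * z * a| ^+ 3); last first.
    by rewrite [in RHS]normrM (ger0_norm a0) exprMn; ring.
  have -> : (Num.sqrt 2 * z * a) ^+ 2 = 2 * (a ^+ 2 * z ^+ 2).
    by rewrite !exprMn sqr_sqrtr//; ring.
  by congr (`|_| <= _); field.
rewrite /lindeberg_moment RintegralD//.
have -> : K * (\int[gamma]_x0 `|x0 ^+ 2 - 1| ^+ 3 + \int[gamma]_x0 `|Num.sqrt 2 * x0| ^+ 3) * a ^+ 3 =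
  K * a ^+ 3 * (\int[gamma]_x0 `|x0 ^+ 2 - 1| ^+ 3) + K * a ^+ 3 * (\int[gamma]_x0 `|Num.sqrt 2 * x0| ^+
    3) by ring.
rewrite distrC in D2.
by apply: le_trans (lerD D1 D2); apply: le_trans (ler_normD _ _); rewrite addrA subrK.
Qed.

Lemma gauss_lawM a b f x : 0 <= a -> 0 <= b -> bmeas f ->
  gauss_law a (gauss_law b f) x = gauss_law (Num.sqrt (a ^+ 2 + b ^+ 2)) f x.
Proof.
move=> a0 b0 [mf [M fM]]; rewrite /gauss_law /average.
have mfx : measurable_fun [set: R] (fun y => f (x + y)).
  by apply: (measurableT_comp mf); exact: measurable_funD.
have ab : Num.sqrt (a ^+ 2 + b ^+ 2) ^+ 2 = a ^+ 2 + b ^+ 2.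
  by rewrite sqr_sqrtr// addr_ge0// sqr_ge0.
have <- := @stdnormal_convolution_bounded R _ M a b _ a0 b0 (sqrtr_ge0 _) ab mfx (fun y => fM _).
by under eq_Rintegral do under eq_Rintegral do rewrite -addrA.
Qed.

(** The induction hypothesis makes the tail Gaussian; the head is then exchanged against the
    smoothed function [gauss_law V f], which is still in the class with the same K. Centring sits in
    the starting point: x - (a + S) + a z^2 = x + a (z^2 - 1) - S. *)
Theorem lindeberg_chisq K f f1 f2 s x : 0 <= K -> (forall a, a \in s -> 0 <= a) ->
  taylor_class K f f1 f2 ->
  `|chisq_law s f (x - \sum_(a <- s) a) -
    gauss_law (Num.sqrt (2 * \sum_(a <- s) a ^+ 2)) f x| <=
  K * lindeberg_moment * \sum_(a <- s) a ^+ 3.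
Proof.
move=> K0 + tf; elim: s x => [x _|a s IH x s0].
  rewrite /= !big_nil mulr0 sqrtr0 subr0 mulr0 /gauss_law /average.
  under eq_Rintegral do rewrite mul0r addr0.
  by rewrite rintegral_cst subrr normr0.
have a0 : 0 <= a by apply: s0; rewrite mem_head.
have s0' b : b \in s -> 0 <= b by move=> bs; apply: s0; rewrite in_cons bs orbT.
have {}IH y := IH y s0'.
set V := Num.sqrt _ in IH.
have V0 : 0 <= V by exact: sqrtr_ge0.
have tG := taylor_average (mlin V) tf.
have m1 : measurable_fun [set: R] (fun z : R => a * (z ^+ 2 - 1)).
  by apply: measurable_funM => //; apply: measurable_funB => //; exact: measurable_funX.
rewrite !big_cons.
have -> : Num.sqrt (2 * (a ^+ 2 + \sum_(j <- s) j ^+ 2)) =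
    Num.sqrt ((Num.sqrt 2 * a) ^+ 2 + V ^+ 2).
  rewrite exprMn !sqr_sqrtr//; first by rewrite mulrDr.
  by rewrite mulr_ge0// sumr_ge0// => b _; exact: sqr_ge0.
rewrite -gauss_lawM//; [|by rewrite mulr_ge0// sqrtr_ge0|exact: taylor_bmeas tf].
have H1 := lindeberg_step x K0 a0 tG.
have H2 : `|chisq_law (a :: s) f (x - (a + \sum_(j <- s) j)) -
    average (fun z => a * (z ^+ 2 - 1)) (gauss_law V f) x| <=
    K * lindeberg_moment * \sum_(j <- s) j ^+ 3.
  rewrite /= /average; apply: rintegral_dist2.
  - by apply: (bmeas_rint _ (msq a)); exact/bmeas_chisq/(taylor_bmeas tf).
  - by apply: (bmeas_rint _ m1); exact/bmeas_gauss/(taylor_bmeas tf).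
  - move=> z; rewrite [X in chisq_law _ _ X](_ : _ = x + a * (z ^+ 2 - 1) - \sum_(j <- s) j).
      exact: IH.
    by ring.
rewrite mulrDr [leRHS]addrC; apply: le_trans (lerD H2 H1).
by apply: le_trans (ler_normD _ _); rewrite addrA subrK.
Qed.

End averages.

(** * Logistic test functions *)

Section logistic.
Context {R : realType}.
Implicit Types (x y m e : R).

Definition logistic m e y : R := (1 + expR ((y - m) / e))^-1.

Lemma logistic_gt0 m e y : 0 < logistic m e y.
Proof. by rewrite invr_gt0 addr_gt0// expR_gt0. Qed.

Lemma logistic_lt1 m e y : logistic m e y < 1.
Proof. by rewrite invf_lt1 ?addr_gt0// ?expR_gt0// ltrDl expR_gt0. Qed.

Lemma is_derive_logistic m e y :
  is_derive y 1 (logistic m e) (e^-1 * (logistic m e y ^+ 2 - logistic m e y)).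
Proof.
have d1 : is_derive y 1 (fun y => (y - m) / e) e^-1.
  by apply: is_derive_eq; rewrite /GRing.scale/=; ring.
have d2 : is_derive y 1 (fun y => 1 + expR ((y - m) / e)) (expR ((y - m) / e) * e^-1).
  have dE : is_derive y 1 (expR \o (fun y => (y - m) / e)) (expR ((y - m) / e) * e^-1).
    exact: is_derive1_comp.
  by have := is_deriveD (is_derive_cst (1 : R) y 1) dE; rewrite add0r.
have n0 : 1 + expR ((y - m) / e) != 0 by rewrite gt_eqF// addr_gt0// expR_gt0.
have := is_deriveV (f := fun y => 1 + expR ((y - m) / e)) n0 d2; rewrite -/(logistic m e) => h.
apply: is_derive_eq h _; rewrite /logistic /GRing.scale/=.
move: n0; move: (expR ((y - m) / e)) => E n0; move: (e^-1) => b; field.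
by [].
Qed.

Lemma measurable_logistic m e : measurable_fun [set: R] (logistic m e).
Proof.
apply: continuous_measurable_fun => y.
apply/differentiable_continuous/derivable1_diffP; apply: ex_derive.
exact: is_derive_logistic.
Qed.

Lemma bmeas_logistic m e : bmeas (logistic m e).
Proof.
split; first exact: measurable_logistic.
exists 1 => y; rewrite gtr0_norm ?logistic_gt0// ltW//; exact: logistic_lt1.
Qed.

(** Since s' = (s^2 - s)/e, every derivative is a polynomial in s, and 0 < s < 1 bounds the third
    one by e^-3. *)
Lemma taylor_logistic m e : 0 < e ->
  taylor_class (e^-1 ^+ 3) (logistic m e)
    (fun y => e^-1 * (logistic m e y ^+ 2 - logistic m e y))
    (fun y => e^-1 ^+ 2 * ((2 * logistic m e y - 1) * (logistic m e y ^+ 2 - logistic m e y))).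
Proof.
move=> e0; set s := logistic m e.
have s0 y : 0 < s y by exact: logistic_gt0.
have s1 y : s y < 1 by exact: logistic_lt1.
have ds y : is_derive y 1 s (e^-1 * (s y ^+ 2 - s y)) := is_derive_logistic m e y.
have ms := measurable_logistic m e; rewrite -/s in ms.
have E0 : 0 < e^-1 by rewrite invr_gt0.
have q1 y : `|s y ^+ 2 - s y| <= 1.
  by rewrite ler_norml; have := s0 y; have := s1 y => h1 h2; apply/andP; split; nra.
have q2 y : `|2 * s y - 1| <= 1.
  by rewrite ler_norml; have := s0 y; have := s1 y => h1 h2; apply/andP; split; lra.
split.
- exact: bmeas_logistic.
- apply: bmeasZ; split; first by apply: measurable_funB => //; exact: measurable_funX.
  by exists 1.
- apply: bmeasZ; split.
    apply: measurable_funM; first by apply: measurable_funB => //; exact: measurable_funM.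
    by apply: measurable_funB => //; exact: measurable_funX.
  by exists 1 => y; rewrite normrM -[leRHS]mulr1 ler_pM.
have d1 (y : R) : is_derive y 1 (fun y => e^-1 * (s y ^+ 2 - s y))
    (e^-1 ^+ 2 * ((2 * s y - 1) * (s y ^+ 2 - s y))).
  by apply: is_derive_eq; rewrite /GRing.scale/=; ring.
have d2 (y : R) : is_derive y 1 (fun y => e^-1 ^+ 2 * ((2 * s y - 1) * (s y ^+ 2 - s y)))
    (e^-1 ^+ 3 * ((6 * s y ^+ 2 - 6 * s y + 1) * (s y ^+ 2 - s y))).
  by apply: is_derive_eq; rewrite /GRing.scale/=; ring.
apply: (taylor2_remainder ds d1 d2) => y.
rewrite normrM ger0_norm; last by rewrite exprn_ge0// ltW.
  rewrite -[leRHS]mulr1 ler_wpM2l//; first by rewrite exprn_ge0// ltW.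
  rewrite normrM -[leRHS]mulr1 ler_pM//.
  rewrite ler_norml; have := s0 y; have := s1 y => h1 h2; apply/andP; split; last by nra.
  by have := sqr_ge0 (2 * s y - 1); nra.
Qed.

Lemma bernoulli_exp (k : R) N : 0 <= k -> 1 + N%:R * k <= (1 + k) ^+ N.
Proof.
move=> k0; elim: N => [|N IH]; first by rewrite mul0r addr0 expr0.
rewrite exprS -natr1; apply: (@le_trans _ _ ((1 + k) * (1 + N%:R * k))).
  have : 0 <= N%:R * (k * k) :> R by rewrite !mulr_ge0.
  lra.
by rewrite ler_wpM2l// addr_ge0.
Qed.

(* With v = exp (- y / e) and k = exp (- m / e), the logistic function is
   v / (v + k), whose geometric expansion in (1 - v) / (1 + k) converges
   uniformly for v in [0, 1]. *)
Lemma logistic_poly_approx m e N : 0 < e -> exists p : {poly R},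
  forall y, 0 <= y -> `|logistic m e y - p.[expR (- (y / e))]| <=
    (1 + N%:R * expR (- (m / e)))^-1.
Proof.
move=> e0; set k := expR (- (m / e)); pose r := (1 + k)^-1.
have k0 : 0 < k by exact: expR_gt0.
exists ('X * \sum_(j < N) (r ^+ j.+1) *: (1 - 'X) ^+ j) => y y0.
set v := expR (- (y / e)).
have v0 : 0 < v by exact: expR_gt0.
have v1 : v <= 1 by rewrite -expR0 ler_expR oppr_le0 divr_ge0// ltW.
have -> : logistic m e y = v / (v + k).
  rewrite /logistic mulrBl expRD /v /k !expRN; have := expR_gt0 (y / e); have := expR_gt0 (m / e).
  set a := expR (m / e); set b := expR (y / e) => a0 b0.
  by field; rewrite !gt_eqF//= ?addr_gt0.
have -> : ('X * \sum_(j < N) r ^+ j.+1 *: (1 - 'X) ^+ j).[v] =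
    v * \sum_(j < N) r * ((1 - v) * r) ^+ j.
  rewrite hornerM hornerX horner_sum; congr (_ * _); apply: eq_bigr => j _.
  by rewrite hornerZ horner_exp hornerD hornerC hornerN hornerX exprMn exprS; ring.
rewrite -mulr_sumr.
set q := (1 - v) * r.
have r0 : 0 < r by rewrite invr_gt0 addr_gt0.
have q1 : 1 - q = (v + k) * r by rewrite /q /r; field; rewrite gt_eqF// addr_gt0.
have S : r * \sum_(j < N) q ^+ j = (1 - q ^+ N) / (v + k).
  have -> : 1 - q ^+ N = (1 - q) * \sum_(j < N) q ^+ j.
    by have := subrX1 q N;
      rewrite -[X in X = _ -> _]opprB -[in X in _ = X -> _](opprB 1 q) mulNr => /oppr_inj.
  by rewrite q1; field; rewrite gt_eqF// addr_gt0.
rewrite S (_ : v / (v + k) - v * ((1 - q ^+ N) / (v + k)) = (v / (v + k)) * q ^+ N); last ring.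
have q0 : 0 <= q by rewrite mulr_ge0 ?subr_ge0// ltW.
have vk : 0 < v + k by rewrite addr_gt0.
rewrite ger0_norm; last by rewrite mulr_ge0 ?exprn_ge0// divr_ge0// ltW.
(* The remainder is q^N v/(v + k), and q <= r for every v in (0, 1]. Bernoulli's inequality for (1 +
   k)^N then gives a bound free of v that vanishes as N grows. *)
apply: (@le_trans _ _ (r ^+ N)).
  rewrite -[leRHS]mul1r ler_pM ?exprn_ge0//; first by rewrite divr_ge0// ltW.
  - by rewrite ler_pdivrMr// mul1r lerDl ltW.
  - by rewrite lerXn2r// ?nnegrE ?(ltW r0)// /q ler_piMl ?(ltW r0)// gerBl ltW.
rewrite /r exprVn lef_pV2 ?posrE; first exact/bernoulli_exp/ltW.
- by rewrite exprn_gt0// addr_gt0.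
- by rewrite ltr_wpDr// mulr_ge0// ltW.
Qed.

End logistic.

(** * Laplace transforms and logistic expectations *)

Section laplace_transform.
Context d (T : measurableType d) (R : realType) (P : probability T R).
Local Notation gamma := (@stdnormal R).
Implicit Types (s : seq R) (m e : R).

(** Both sides are within [err] of one and the same linear combination of Laplace transforms at the
    points i/e, obtained by integrating the approximating polynomial term by term. *)
Lemma laplace_logistic (Q : T -> R) s m e : 0 < e ->
  measurable_fun [set: T] Q -> (forall w, 0 <= Q w) ->
  (forall a, a \in s -> 0 <= a) ->
  (forall t, 0 <= t -> \int[P]_w expR (- (t * Q w)) =
     \prod_(a <- s) \int[gamma]_z expR (- (t * (a * z ^+ 2)))) ->
  \int[P]_w logistic m e (Q w) = chisq_law s (logistic m e) 0.
Proof.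
move=> e0 mQ Q0 s0 QE; apply/eqP; rewrite -subr_eq0 -normr_le0.
apply/ler_addgt0Pr => eps eps0; rewrite add0r.
set k := expR (- (m / e)).
have k0 : 0 < k by exact: expR_gt0.
(* Now N k > 2/eps, so twice the approximation error 1/(1 + N k) is below eps. *)
pose N := (Num.truncn (2 / eps / k)).+1.
have NE : 2 / eps / k < N%:R by rewrite truncnS_gt.
have [p pE] := @logistic_poly_approx R m e N e0.
rewrite -/k in pE.
set err := (1 + N%:R * k)^-1 in pE.
have err0 : 2 * err <= eps.
  have h : 2 < N%:R * k * eps by move: NE; rewrite !ltr_pdivrMr//; rewrite mulrAC.
  have Nk : 0 < 1 + N%:R * k by rewrite ltr_wpDr// mulr_ge0// ltW.
  by rewrite /err ler_pdivrMr//; lra.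
pose mono (i : nat) (y : R) := expR (- (i%:R / e * Num.max y 0)).
have tp (i : nat) : 0 <= i%:R / e by apply: divr_ge0 => //; exact: ltW.
have mmono i : measurable_fun [set: R] (mono i).
  apply: measurableT_comp => //; apply: measurableT_comp => //; apply: measurable_funM => //.
  exact: measurable_maxr.
have mono1 i y : `|mono i y| <= 1.
  rewrite gtr0_norm ?expR_gt0// -expR0 ler_expR oppr_le0 mulr_ge0// le_max lexx orbT //.
have bmono i : bmeas (mono i) by split => //; exists 1.
pose g y := \sum_(i < size p) p`_i * mono i y.
have bg : bmeas g by apply: bmeas_sum => i; exact: bmeasZ.
have gE y : 0 <= y -> g y = p.[expR (- (y / e))].
  move=> y0; rewrite horner_coef; apply: eq_bigr => i _; congr (_ * _).
  by rewrite /mono max_l// -expRM_natl; congr expR; rewrite mulrN; congr (- _); ring.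
have A1 : `|chisq_law s (logistic m e) 0 - chisq_law s g 0| <= err.
  apply: chisq_law_dist => //; first exact: bmeas_logistic.
  by move=> y y0; rewrite gE//; exact: pE.
have mcomp f : bmeas f -> rint P (fun w => f (Q w)).
  move=> [mf [M fM]]; apply: (@rintegrable_bounded _ _ _ P _ M) => [|w]; last exact: fM.
  exact: (measurableT_comp mf).
have A2 : `|\int[P]_w logistic m e (Q w) - \int[P]_w g (Q w)| <= err.
  apply: rintegral_dist2; [apply: mcomp; exact: bmeas_logistic|exact: mcomp|].
  by move=> w; rewrite gE//; exact: pE.
have A3 : chisq_law s g 0 = \int[P]_w g (Q w).
  rewrite /g chisq_law_sum; last by move=> i; exact: bmeasZ.
  rewrite rintegral_sum; last by move=> i; exact/rintegrableZ/mcomp.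
  apply: eq_bigr => i _; rewrite chisq_lawZ// RintegralZl//; last exact: mcomp.
  congr (_ * _).
  rewrite (chisq_law_expR (tp i) s0 (lexx 0)) mulr0 oppr0 expR0 mul1r -(QE _ (tp i)).
  by apply: eq_Rintegral => w _; rewrite /mono max_l.
rewrite distrC A3 in A1.
apply: le_trans err0; rewrite mulr_natl mulr2n.
by apply: le_trans (lerD A2 A1); apply: le_trans (ler_normD _ _); rewrite addrA subrK.
Qed.

Lemma stdnormal_cos_shift (u a : R) :
  \int[gamma]_z cos (u + a * z) = cos u * expR (- (a ^+ 2 / 2)).
Proof.
have mc : measurable_fun [set: R] (fun z => cos (a * z)).
  apply: measurableT_comp; first by apply: continuous_measurable_fun; exact: continuous_cos.
  exact: measurable_funM.
have ms : measurable_fun [set: R] (fun z => sin (a * z)).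
  apply: measurableT_comp; first by apply: continuous_measurable_fun; exact: continuous_sin.
  exact: measurable_funM.
have ic : rint gamma (fun z => cos (a * z)).
  by apply: (@rintegrable_bounded _ _ _ gamma _ 1) => [|z]; [exact: mc|exact: cos_max].
have is_ : rint gamma (fun z => sin (a * z)).
  by apply: (@rintegrable_bounded _ _ _ gamma _ 1) => [|z]; [exact: ms|exact: sin_max].
under eq_Rintegral do rewrite cosD.
rewrite (RintegralB measurableT (rintegrableZ _ ic) (rintegrableZ _ is_)).
rewrite (RintegralZl _ measurableT ic) (RintegralZl _ measurableT is_).
rewrite stdnormal_cos (@stdnormal_odd _ _ 1) ?mulr0 ?subr0// => z.
  by rewrite mul1r (le_trans (sin_max _))// lerDl exprn_even_ge0.
by rewrite mulrN sinN.
Qed.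

(* [exp (- t W ^+ 2)] is the average over a Gaussian z of
   [cos (sqrt (2 t) z W)], so only the law of linear combinations matters. *)
Lemma laplace_sum_sq n (W : nat -> T -> R) (mu : nat -> R) t : 0 <= t ->
  (forall j, 0 <= mu j) -> (forall j, measurable_fun [set: T] (W j)) ->
  (forall b : nat -> R, \int[P]_w cos (\sum_(0 <= j < n) b j * W j w) =
    expR (- ((\sum_(0 <= j < n) b j ^+ 2 * mu j) / 2))) ->
  \int[P]_w expR (- (t * \sum_(0 <= j < n) W j w ^+ 2)) =
  \prod_(0 <= j < n) \int[gamma]_z expR (- (t * (mu j * z ^+ 2))).
Proof.
move=> t0 mu0 mW HW.
pose c := Num.sqrt (2 * t).
have c2 : c ^+ 2 = 2 * t by rewrite sqr_sqrtr// mulr_ge0.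
have mS (b : nat -> R) i j : measurable_fun [set: T] (fun w => \sum_(i <= l < j) b l * W l w).
  by apply: measurable_sum => l; exact: measurable_funM.
have mS2 i j : measurable_fun [set: T] (fun w => \sum_(i <= l < j) W l w ^+ 2).
  by apply: measurable_sum => l; exact: measurable_funX.
have mcos : measurable_fun [set: R] (@cos R).
  by apply: continuous_measurable_fun; exact: continuous_cos.
have E1 (x : R) : 0 <= x -> expR (- (t * x)) <= 1.
  by move=> x0; rewrite -expR0 ler_expR oppr_le0 mulr_ge0.
(* A hybrid statement: the first k variables already stand squared in the exponent, the others are
   still inside the cosine. To pass from k to k + 1, set b_k = c z and average over a Gaussian z. *)
suff H k : (k <= n)%N -> forall b : nat -> R,
    \int[P]_w (expR (- (t * \sum_(0 <= j < k) W j w ^+ 2)) * cos (\sum_(k <= j < n) b j * W j w)) =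
    \prod_(0 <= j < k) (\int[gamma]_z expR (- (t * (mu j * z ^+ 2)))) *
    expR (- ((\sum_(k <= j < n) b j ^+ 2 * mu j) / 2)).
  have := H n (leqnn n) (fun _ => 0); rewrite (big_geq (leqnn n)) mul0r oppr0 expR0 mulr1 => <-.
  by apply: eq_Rintegral => w _; rewrite (big_geq (leqnn n)) cos0 mulr1.
elim: k => [_ b|k IH kn b].
  rewrite (big_geq (leqnn 0)) mul1r -HW; apply: eq_Rintegral => w _.
  by rewrite (big_geq (leqnn 0)) mulr0 oppr0 expR0 mul1r.
pose bz z j := if j == k then c * z else b j.
have bzE z w : \sum_(k <= j < n) bz z j * W j w =
    \sum_(k.+1 <= j < n) b j * W j w + c * W k w * z.
  rewrite big_ltn// /bz eqxx addrC; congr (_ + _); last by ring.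
  by apply: eq_big_nat => j /andP[kj _]; rewrite gtn_eqF.
have bzM z : \sum_(k <= j < n) bz z j ^+ 2 * mu j =
    \sum_(k.+1 <= j < n) b j ^+ 2 * mu j + 2 * (t * (mu k * z ^+ 2)).
  rewrite big_ltn// /bz eqxx addrC; congr (_ + _); last by rewrite exprMn c2; ring.
  by apply: eq_big_nat => j /andP[kj _]; rewrite gtn_eqF.
pose F (p : T * R) := expR (- (t * \sum_(0 <= j < k) W j p.1 ^+ 2)) *
  cos (\sum_(k.+1 <= j < n) b j * W j p.1 + c * W k p.1 * p.2).
have mF : measurable_fun [set: T * R] F.
  apply: measurable_funM.
    apply: measurableT_comp => //; apply: measurableT_comp => //; apply: measurable_funM => //.
    exact: (measurableT_comp (mS2 0%N k)).
  apply: (measurableT_comp mcos); apply: measurable_funD.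
    exact: (measurableT_comp (mS b k.+1 n)).
  apply: measurable_funM => //; apply: measurable_funM => //.
  exact: (measurableT_comp (mW k)).
have F1 p : `|F p| <= 1.
  rewrite normrM -[leRHS]mulr1 ler_pM//; last exact: cos_max.
  by rewrite gtr0_norm ?expR_gt0// E1// sumr_ge0// => j _; exact: sqr_ge0.
transitivity (\int[P]_w \int[gamma]_z F (w, z)).
  apply: eq_Rintegral => w _; rewrite /F /=.
  rewrite RintegralZl//; last first.
    apply: (@rintegrable_bounded _ _ _ gamma _ 1) => [|z]; last exact: cos_max.
    by apply: (measurableT_comp mcos); apply: measurable_funD => //; exact: measurable_funM.
  rewrite stdnormal_cos_shift big_nat_recr//= mulrDr opprD expRD exprMn c2.
  rewrite -!mulrA; congr (_ * _); rewrite mulrC; congr (_ * expR (- _)); by field.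
rewrite (@prob_fubini _ _ _ _ _ P gamma F 1 mF F1).
transitivity (\int[gamma]_z (\prod_(0 <= j < k) (\int[gamma]_z0 expR (- (t * (mu j * z0 ^+ 2)))) *
    expR (- ((\sum_(k.+1 <= j < n) b j ^+ 2 * mu j) / 2)) * expR (- (t * (mu k * z ^+ 2))))).
  apply: eq_Rintegral => z _; rewrite /F /=.
  under eq_Rintegral do rewrite -bzE.
  rewrite IH; last exact: ltnW.
  by rewrite -mulrA; congr (_ * _); rewrite -expRD bzM; congr expR; field.
rewrite RintegralZl//; last first.
  apply: (@rintegrable_bounded _ _ _ gamma _ 1) => [|z].
    apply: measurableT_comp => //; apply: measurableT_comp => //; apply: measurable_funM => //.
    by apply: measurable_funM => //; exact: measurable_funX.
  by rewrite gtr0_norm ?expR_gt0// E1// mulr_ge0// sqr_ge0.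
by rewrite big_nat_recr//= mulrAC.
Qed.

End laplace_transform.

(** * Spectral theorem for real symmetric matrices *)

Section real_spectral.
Context {R : rcfType}.

(** The complex Hermitian spectral theorem supplies an eigenvalue that is real; as a root of the
    characteristic polynomial of A it also has an eigenvector over R. *)
Lemma symmetric_eigenvector n (A : 'M[R]_n.+1) : A^T = A ->
  exists (a : R) (v : 'rV[R]_n.+1), v != 0 /\ v *m A = a *: v.
Proof.
move=> symA; pose B : 'M[R[i]]_n.+1 := map_mx (real_complex R) A.
have Breal : B \is a realmx.
  by apply/mxOverP => i j; rewrite mxE complex_real.
have Bsym : B \is symmetricmx.
  apply/is_hermitianmxP; rewrite expr0 scale1r map_mx_id//.
  apply/matrixP => i j; rewrite !mxE.
  by have := congr1 (fun M : 'M[R]_n.+1 => M i j) symA; rewrite mxE => ->.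
have Bherm := realsym_hermsym Bsym Breal.
have Dreal := hermitian_spectral_diag_real Bherm.
have /orthomx_spectralP Beq := hermitian_normalmx Bherm.
pose U := spectralmx B; pose c := spectral_diag B 0 0.
have Uu : U \in unitmx := spectral_unit B.
have eigB : eigenvalue B c.
  apply/eigenvalueP; exists (row 0 U).
    rewrite -row_mul -/U in Beq *.
    have -> : U *m B = diag_mx (spectral_diag B) *m U by rewrite {1}Beq -!mulmxA mulKVmx.
    by apply/rowP => j; rewrite mul_diag_mx !mxE.
  by apply/eqP => r0; move: Uu; rewrite -row_free_unit => /row_freeP[V UV];
    have := congr1 (mulmx^~ V) r0; rewrite /= -row_mul UV mul0mx => /rowP/(_ 0);
    rewrite !mxE eqxx => /eqP; rewrite oner_eq0.
have [a ca] : exists a : R, c = real_complex R a.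
  have /mxOverP/(_ 0 0) := Dreal; rewrite -/c => cR.
  by exists (complex.Re c); rewrite RRe_real.
have : eigenvalue A a.
  rewrite eigenvalue_root_char -(fmorph_root (real_complex R)) -/(map_poly _ _).
  by rewrite map_char_poly -/B; move: eigB; rewrite eigenvalue_root_char ca.
by move=> /eigenvalueP[v vA v0]; exists a, v.
Qed.

Lemma rV_normsq_eq0 n (v : 'rV[R]_n) : (v *m v^T == 0) = (v == 0).
Proof.
apply/eqP/eqP => [|->]; last by rewrite mul0mx.
move/matrixP/(_ 0 0); rewrite !mxE => /eqP; rewrite psumr_eq0; last first.
  by move=> i _; rewrite mxE -expr2 sqr_ge0.
move=> /allP v0; apply/rowP => i; rewrite mxE.
by have := v0 i (mem_index_enum _); rewrite mxE mulf_eq0 orbb => /eqP.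
Qed.

(* Householder reflection *)
Lemma orthogonal_first_row n (v : 'rV[R]_n.+1) : v *m v^T = 1%:M ->
  exists H : 'M[R]_n.+1, H *m H^T = 1%:M /\ row 0 H = v.
Proof.
move=> v1; pose e : 'rV[R]_n.+1 := delta_mx 0 0; pose w := e - v.
pose s := (w *m w^T) 0 0.
have sE : w *m w^T = s%:M by rewrite [LHS]mx11_scalar.
(* If v is already the basis vector e, then s = 0, hence c = 0 because the inverse of 0 is 0, and H
   is the identity. *)
pose c := 2 / s.
pose H : 'M[R]_n.+1 := 1%:M - c *: (w^T *m w).
have HT : H^T = H.
  by rewrite /H linearB/= trmx1 linearZ/= trmx_mul trmxK.
have ww : (w^T *m w) *m (w^T *m w) = s *: (w^T *m w).
  by rewrite mulmxA -(mulmxA w^T) sE mul_mx_scalar -scalemxAl.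
have cs : c * (c * s) = 2 * c.
  by rewrite /c; have [->|s0] := eqVneq s 0; [rewrite invr0 !(mulr0, mul0r)|field].
exists H; split.
  rewrite HT /H; move: ww; move: (w^T *m w) => X XX.
  rewrite mulmxBl mul1mx mulmxBr mulmx1 -scalemxAl -scalemxAr XX !scalerA -mulrA cs.
  by rewrite mulr_natl mulr2n scalerDl opprB addrK subrK.
have vv : (v *m v^T) 0 0 = 1 by rewrite v1 mxE.
have ee : (e *m e^T) 0 0 = 1.
  by rewrite trmx_delta mul_delta_mx mxE !eqxx.
have ev : (e *m v^T) 0 0 = v 0 0 by rewrite -rowE !mxE.
have ve : (v *m e^T) 0 0 = v 0 0.
  have -> : v *m e^T = (e *m v^T)^T by rewrite trmx_mul trmxK.
  by rewrite mxE.
have sv : s = 2 * (1 - v 0 0).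
  rewrite /s /w linearB/= mulmxBl !mulmxBr !mxE.
  have h M : (M : 'M[R]_1) 0 0 = M 0 0 by [].
  move: vv ee ev ve; rewrite !mxE => -> -> -> ->; ring.
have ew : e *m w^T = (1 - v 0 0)%:M.
  by rewrite [LHS]mx11_scalar /w linearB/= mulmxBr !mxE; move: ee ev; rewrite !mxE => -> ->.
rewrite rowE -/e /H mulmxBr mulmx1 -scalemxAr mulmxA ew mul_scalar_mx scalerA.
have [w0|w0] := eqVneq w 0.
  by rewrite w0 scaler0 subr0; apply/eqP; rewrite -subr_eq0 -/w w0.
have s0 : s != 0.
  apply: contra w0 => /eqP s0; rewrite -rV_normsq_eq0 sE s0; apply/eqP/matrixP => i j.
  by rewrite !mxE mul0rn.
have -> : c * (1 - v 0 0) = 1.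
  by rewrite /c sv; field; move: s0; rewrite sv mulf_eq0 negb_or => /andP[].
by rewrite scale1r /w opprB addrC subrK.
Qed.

(** Deflation: a reflection makes a unit eigenvector the first row; by symmetry the conjugated
    matrix is then zero off the diagonal in its first row and column, and a smaller symmetric block
    remains. *)
Theorem real_spectral n (A : 'M[R]_n) : A^T = A ->
  exists (O : 'M[R]_n) (D : 'rV[R]_n), O *m O^T = 1%:M /\ O *m A *m O^T = diag_mx D.
Proof.
elim: n A => [|n IH] A symA.
  by exists 1%:M, 0; split; apply/matrixP => -[].
have [a [v [v0 vA]]] := symmetric_eigenvector symA.
pose s := (v *m v^T) 0 0.
have sE : v *m v^T = s%:M by rewrite [LHS]mx11_scalar.
have s_neq0 : s != 0.
  apply: contra v0 => /eqP s0; rewrite -rV_normsq_eq0 sE s0; apply/eqP/matrixP => i j.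
  by rewrite !mxE mul0rn.
have s0 : 0 <= s.
  by rewrite /s mxE; apply: sumr_ge0 => i _; rewrite mxE -expr2 sqr_ge0.
pose u := (Num.sqrt s)^-1 *: v.
have u1 : u *m u^T = 1%:M.
  rewrite /u linearZ/= -scalemxAl -scalemxAr sE scalerA -invfM -expr2 sqr_sqrtr//.
  by rewrite scale_scalar_mx mulVf.
have uA : u *m A = a *: u by rewrite /u -scalemxAl vA !scalerA mulrC.
have [H [HH Hu]] := orthogonal_first_row u1.
have HTH : H^T *m H = 1%:M by exact: mulmx1C.
pose A' : 'M[R]_(1 + n) := H *m A *m H^T.
have A'sym : A'^T = A' by rewrite /A' !trmx_mul trmxK symA mulmxA.
have A'row : row 0 (A' : 'M[R]_n.+1) = a *: delta_mx 0 0.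
  rewrite /A' !row_mul Hu uA -scalemxAl -Hu -row_mul HH.
  by congr (_ *: _); apply/rowP => j; rewrite !mxE eq_sym.
have A'0 j : A' 0 j = a * (j == 0)%:R.
  by have := congr1 (fun M : 'rV[R]_n.+1 => M 0 j) A'row; rewrite !mxE eqxx.
have A'eq : H *m A *m H^T = A' by [].
clear A'row; clearbody A'; pose A1 := drsubmx A'.
have A1sym : A1^T = A1 by rewrite /A1 trmx_drsub A'sym.
have A'E : A' = block_mx a%:M 0 0 A1.
  rewrite -[LHS]submxK; congr block_mx.
  - apply/matrixP => i j; rewrite !ord1 !mxE lshift0 A'0 eqxx.
    by rewrite mulr1.
  - apply/matrixP => i j; rewrite !ord1 !mxE lshift0 A'0.
    by rewrite (_ : rshift 1 j == 0 = false) ?mulr0.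
  - apply/matrixP => i j; rewrite !ord1 !mxE lshift0.
    rewrite -A'sym mxE A'0.
    by rewrite (_ : rshift 1 i == 0 = false) ?mulr0.
have [V1 [D1 [VV1 D1E]]] := IH A1 A1sym.
pose Q : 'M[R]_(1 + n) := block_mx 1%:M 0 0 V1.
have QQ : Q *m Q^T = 1%:M.
  rewrite /Q tr_block_mx !trmx0 trmx1 mulmx_block !(mul0mx, mulmx0, mul1mx, addr0, add0r) VV1.
  by rewrite -scalar_mx_block.
have key : Q *m (block_mx a%:M 0 0 A1 : 'M[R]_(1 + n)) *m Q^T =
    block_mx a%:M 0 0 (diag_mx D1).
  rewrite /Q tr_block_mx !trmx0 trmx1 !mulmx_block.
  by rewrite !(mul0mx, mulmx0, mul1mx, mulmx1, addr0, add0r) D1E.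
exists (Q *m H), (row_mx a%:M D1 : 'rV[R]_(1 + n)); split.
  by rewrite trmx_mul mulmxA -(mulmxA Q) HH mulmx1.
rewrite trmx_mul mulmxA -(mulmxA Q H A) -(mulmxA Q (H *m A)) A'eq A'E.
have key2 : diag_mx (row_mx a%:M D1 : 'rV[R]_(1 + n)) = block_mx a%:M 0 0 (diag_mx D1).
  by rewrite diag_mx_row; congr block_mx; apply/matrixP => i j; rewrite !ord1 !mxE eqxx.
exact: (etrans key (esym key2)).
Qed.

End real_spectral.

(** * Integration over R^d *)

Section lebesgue_rV_integrals.
Context {R : realType}.
Local Notation leb := (@lebesgue_measure R).

Lemma ge0_integral_rV_cons n (f : 'rV[R]_n.+1 -> \bar R) :
  measurable_fun [set: 'rV[R]_n.+1] f -> (forall x, (0 <= f x)%E) ->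
  (\int[lebesgue_rV R n.+1]_x f x =
   \int[leb]_a \int[lebesgue_rV R n]_x f (rV_cons (a, x)))%E.
Proof.
move=> mf f0.
have mfc : measurable_fun [set: measurableTypeR R * 'rV[R]_n] (f \o @rV_cons R n).
  exact: (measurableT_comp mf (@measurable_rV_cons R n)).
rewrite /= /lebesgue_rV_step ge0_integral_pushforward//; last exact: measurable_rV_cons.
rewrite preimage_setT.
exact: (@fubini_tonelli1 _ _ _ _ R leb (lebesgue_rV R n) _ mfc (fun z => f0 _)).
Qed.

Lemma ge0_integral_rV_affine n (c : R) (b : 'rV[R]_n) (f : 'rV[R]_n -> \bar R) :
  c != 0 -> measurable_fun [set: 'rV[R]_n] f -> (forall x, (0 <= f x)%E) ->
  (\int[lebesgue_rV R n]_x f (c *: x + b)%R =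
   (`|c| ^- n)%:E * \int[lebesgue_rV R n]_x f x)%E.
Proof.
move=> c0; elim: n b f => [|n IH] b f mf f0.
  rewrite expr0 invr1 mul1e /=; apply: eq_integral => x _; congr f.
  by apply/rowP => -[].
have maff : measurable_fun [set: 'rV[R]_n.+1] (fun x : 'rV[R]_n.+1 => c *: x + b).
  apply: measurable_fun_rV => i.
  rewrite (_ : (fun x => _) = (fun x : 'rV[R]_n.+1 => c * x ord0 i + b ord0 i)); last first.
    by apply/funext => x; rewrite !mxE.
  by apply: measurable_funD => //; apply: measurable_funM => //; exact: measurable_coord.
rewrite ge0_integral_rV_cons//; last exact: (measurableT_comp mf maff).
have mfc : measurable_fun [set: measurableTypeR R * 'rV[R]_n] (f \o @rV_cons R n).
  exact: (measurableT_comp mf (@measurable_rV_cons R n)).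
pose b' : 'rV[R]_n := \row_j b ord0 (lift ord0 j).
have E a (x : 'rV[R]_n) : c *: rV_cons (a, x) + b = rV_cons (c * a + b ord0 ord0, c *: x + b').
  apply/rowP => i; rewrite !mxE; by case: unliftP => [j|] ->; rewrite ?mxE.
under eq_integral => a _.
  under eq_integral do rewrite E.
  rewrite (IH b' (fun x => f (rV_cons (c * a + b ord0 ord0, x)))); last 2 first.
  - exact: (measurableT_comp mfc (pair1_measurable _)).
  - by [].
  over.
pose G (a : R) := (\int[lebesgue_rV R n]_x f (rV_cons (a, x)))%E.
have mG : measurable_fun [set: R] G.
  exact: (@measurable_fun_fubini_tonelli_F _ _ _ _ R (lebesgue_rV R n) _ mfc (fun z => f0 _)).
have G0 a : (0 <= G a)%E by exact: integral_ge0.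
rewrite ge0_integralZl//; last 2 first.
- exact: (measurableT_comp mG (measurable_funD (measurable_funM (measurable_cst c) (@measurable_id _ _
  _)) (measurable_cst (b ord0 ord0)))).
- by move=> a _; exact: G0.
rewrite (@ge0_integral_affine R c (b ord0 ord0) G c0 mG G0).
by rewrite muleA -EFinM exprSr invfM ge0_integral_rV_cons.
Qed.

Lemma measurable_rV_box n (B : 'I_n -> set R) : (forall i, measurable (B i)) ->
  measurable [set x : 'rV[R]_n | forall i, B i (x ord0 i)].
Proof.
move=> mB; rewrite (_ : mkset _ = \bigcap_(i in [set: 'I_n])
    [set x : 'rV[R]_n | B i (x ord0 i)]).
  apply: fin_bigcap_measurable => [|i _]; first exact: finite_finset.
  rewrite -[X in measurable X]setTI.
  exact: (measurable_coord i measurableT (mB i)).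
by apply/seteqP; split => x /= Ax i; [move=> _; exact: Ax|exact: (Ax i)].
Qed.

(** Half-widths depend on the coordinate because a cube will be enlarged in a single direction. *)
Definition box n (r : 'I_n -> R) : set 'rV[R]_n := [set x | forall i, `|x ord0 i| <= r i].

Lemma boxE n (r : 'I_n -> R) :
  box r = [set x : 'rV[R]_n | forall i, `[- r i, r i]%classic (x ord0 i)].
Proof.
by apply/seteqP; split => x /= + i => /(_ i); rewrite in_itv/= ler_norml.
Qed.

Lemma measurable_box n (r : 'I_n -> R) : measurable (box r).
Proof. by rewrite boxE; apply: (@measurable_rV_box n (fun i => `[- r i, r i]%classic)) => i;
  exact: measurable_itv. Qed.

Lemma lebesgue_box n (r : 'I_n -> R) : (forall i, 0 <= r i) ->
  lebesgue_rV R n (box r) = (\prod_(i < n) (2 * r i))%:E.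
Proof.
move=> r0; rewrite boxE (@lebesgue_rV_box R n (fun i => `[- r i, r i]%classic)); last by move=> i;
  exact: measurable_itv.
rewrite -prodEFin; apply: eq_bigr => i _.
rewrite lebesgue_measure_itv/= lte_fin; case: ifPn => h.
  by rewrite -EFinB; congr EFin; ring.
have -> : r i = 0 by move: h; rewrite -leNgt; have := r0 i; lra.
by rewrite mulr0.
Qed.

Lemma nneseries_le (u : nat -> \bar R) (M : \bar R) : (forall k, (0 <= u k)%E) ->
  (forall n, (\sum_(0 <= k < n) u k <= M)%E) -> (\sum_(0 <= k <oo) u k <= M)%E.
Proof.
move=> u0 uM; apply: lime_le; first exact: is_cvg_nneseries.
by apply: nearW => n; exact: uM.
Qed.

Lemma nneseries_ge_term (u : nat -> \bar R) k : (forall k, (0 <= u k)%E) ->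
  (u k <= \sum_(0 <= j <oo) u j)%E.
Proof.
move=> u0; apply: (@le_trans _ _ (\sum_(0 <= j < k.+1) u j)%E).
  by rewrite big_nat_recr//= leeDr// sume_ge0.
exact: nneseries_lim_ge.
Qed.

(** Where f is nonzero a single term of the series of c k times box indicators already dominates it,
    so the boxes may overlap freely. The weight A is left open: it will be 1 for volumes and a
    squared trigonometric sum for the eigenvalue bound. *)
Lemma integral_boxes_le n (f A : 'rV[R]_n -> R) (c phi : nat -> R)
    (r : nat -> 'I_n -> R) M :
  measurable_fun [set: 'rV[R]_n] f -> measurable_fun [set: 'rV[R]_n] A ->
  (forall x, 0 <= f x) -> (forall x, 0 <= A x) -> (forall k, 0 <= c k) ->
  (forall x, f x != 0 -> exists k, box (r k) x /\ f x <= c k) ->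
  (forall k, (\int[lebesgue_rV R n]_x (\1_(box (r k)) x * A x)%:E <= (phi k)%:E)%E) ->
  (forall m, \sum_(0 <= k < m) c k * phi k <= M) ->
  (\int[lebesgue_rV R n]_x (f x * A x)%:E <= M%:E)%E.
Proof.
move=> mf mA f0 A0 c0 fbox Abox cM.
pose F k x := (c k * (\1_(box (r k)) x * A x))%:E.
have mB k : measurable_fun [set: 'rV[R]_n] (fun x : 'rV[R]_n => (\1_(box (r k)) x * A x)%:E).
  apply/measurable_EFinP; apply: measurable_funM => //.
  by apply: measurable_indic; exact: measurable_box.
have B0 k x : (0 <= (\1_(box (r k)) x * A x)%:E)%E by rewrite lee_fin mulr_ge0.
have mF k : measurable_fun [set: 'rV[R]_n] (F k).
  apply/measurable_EFinP; apply: measurable_funM => //.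
  by apply/measurable_EFinP; exact: mB.
have F0 k x : (0 <= F k x)%E by rewrite /F EFinM mule_ge0// lee_fin.
apply: (@le_trans _ _ (\int[lebesgue_rV R n]_x \sum_(0 <= k <oo) F k x)%E).
  apply: ge0_le_integral => //.
  - by move=> x _; rewrite lee_fin mulr_ge0.
  - by apply/measurable_EFinP; exact: measurable_funM.
  - by apply: ge0_emeasurable_sum => //.
  - move=> x _; have [->|fx0] := eqVneq (f x) 0.
      by rewrite mul0r; exact: nneseries_ge0.
    have [k [bx fc]] := fbox x fx0.
    apply: le_trans _ (nneseries_ge_term k (fun k => F0 k x)).
    by rewrite /F lee_fin indicE mem_set// mul1r ler_wpM2r.
rewrite integral_nneseries//; apply: nneseries_le.
  by move=> k; apply: integral_ge0 => x _; exact: F0.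
move=> m; apply: (@le_trans _ _ (\sum_(0 <= k < m) (c k * phi k)%:E)%E).
  apply: lee_sum => k _; rewrite /F; under eq_integral do rewrite EFinM.
  rewrite ge0_integralZl//; last by rewrite lee_fin.
  by rewrite EFinM lee_wpmul2l// lee_fin.
by rewrite sumEFin lee_fin.
Qed.

End lebesgue_rV_integrals.

(** * Euclidean norm, sup norm and dyadic scales *)

Section euclidean.
Context {R : realType} {d : nat}.
Implicit Types (x y z : 'rV[R]_d) (a : R).

Lemma measurable_dot x : measurable_fun [set: 'rV[R]_d] (dot x).
Proof.
apply: measurable_sum => i; apply: measurable_funM => //; exact: measurable_coord.
Qed.

Lemma measurable_enorm : measurable_fun [set: 'rV[R]_d] (@enorm R d).
Proof.
apply: (measurableT_comp (continuous_measurable_fun (@sqrt_continuous R))).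
by apply: measurable_sum => i; apply: measurable_funM; exact: measurable_coord.
Qed.

Lemma dotZl a x y : dot (a *: x) y = a * dot x y.
Proof. by rewrite /dot mulr_sumr; apply: eq_bigr => i _; rewrite mxE mulrA. Qed.

Lemma dotZr a x y : dot x (a *: y) = a * dot x y.
Proof. by rewrite /dot mulr_sumr; apply: eq_bigr => i _; rewrite mxE mulrCA. Qed.

Lemma dotDr x y z : dot x (y + z) = dot x y + dot x z.
Proof. by rewrite /dot -big_split; apply: eq_bigr => i _ /=; rewrite mxE mulrDr. Qed.

Lemma dot_ge0 x : 0 <= dot x x.
Proof. by apply: sumr_ge0 => i _; rewrite -expr2 sqr_ge0. Qed.

Lemma enorm_ge0 x : 0 <= enorm x. Proof. exact: sqrtr_ge0. Qed.

Lemma sqr_enorm x : enorm x ^+ 2 = dot x x.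
Proof. by rewrite sqr_sqrtr// dot_ge0. Qed.

Lemma enormZ a x : 0 <= a -> enorm (a *: x) = a * enorm x.
Proof.
by move=> a0; rewrite /enorm dotZl dotZr mulrA -expr2 sqrtrM ?sqr_ge0// sqrtr_sqr ger0_norm.
Qed.

(** Cauchy-Schwarz, from the nonnegative squared norm of y - (x.y) x. *)
Lemma dot_unit_le x y : enorm x = 1 -> `|dot x y| <= enorm y.
Proof.
move=> x1; have xx : dot x x = 1 by rewrite -sqr_enorm x1 expr1n.
rewrite -(ger0_norm (enorm_ge0 y)) -ler_sqr ?nnegrE// !real_normK ?num_real// sqr_enorm -subr_ge0.
have := dot_ge0 (y + (- dot x y) *: x).
have dC (u v : 'rV[R]_d) : dot u v = dot v u by apply: eq_bigr => i _; rewrite mulrC.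
rewrite dotDr dotZr dC dotDr dotZr [dot (_ + _) x]dC dotDr dotZr xx.
suff -> : dot y y - dot x y ^+ 2 = dot y y + - dot x y * dot y x + - dot x y * (dot x y + - dot x y * 1)
  by [].
by rewrite (dC y x); ring.
Qed.

(** Shells are measured in the sup norm because cubes have product volume; the comparison with
    [enorm] costs at most a factor sqrt d. *)
Definition supn x : R := \big[Num.max/0]_i `|x ord0 i|.

Lemma supn_ge0 x : 0 <= supn x.
Proof. by rewrite /supn; elim/big_ind: _ => // a b a0 b0; rewrite le_max a0. Qed.

Lemma coord_le_supn x i : `|x ord0 i| <= supn x.
Proof. by rewrite /supn (bigD1 i)//= le_max lexx. Qed.

Lemma supn_le x a : 0 <= a -> (forall i, `|x ord0 i| <= a) -> supn x <= a.
Proof.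
move=> a0 xa; rewrite /supn; elim/big_ind: _ => // u v ua va.
by rewrite ge_max ua.
Qed.

Lemma supn_le_enorm x : supn x <= enorm x.
Proof.
apply: supn_le => [|i]; first exact: enorm_ge0.
rewrite -(ger0_norm (enorm_ge0 x)) -ler_sqr ?nnegrE// !real_normK ?num_real// sqr_enorm.
rewrite /dot (bigD1 i)//= -expr2 lerDl; apply: sumr_ge0 => j _.
by rewrite -expr2 sqr_ge0.
Qed.

Lemma sqr_enorm_le x : enorm x ^+ 2 <= d%:R * supn x ^+ 2.
Proof.
rewrite sqr_enorm /dot; apply: (@le_trans _ _ (\sum_(i < d) supn x ^+ 2)).
  apply: ler_sum => i _; rewrite -expr2 -real_normK ?num_real//.
  by rewrite lerXn2r ?nnegrE ?supn_ge0// coord_le_supn.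
by rewrite sumr_const card_ord mulr_natl.
Qed.

Lemma supn0_enorm x : supn x = 0 -> enorm x = 0.
Proof.
move=> x0; have := sqr_enorm_le x; rewrite x0 expr0n mulr0 => h.
by apply/eqP; rewrite -sqrf_eq0 eq_le h sqr_ge0.
Qed.

Lemma measurable_supn : measurable_fun [set: 'rV[R]_d] supn.
Proof.
rewrite /supn; elim: (index_enum _) => [|i s IH].
  by under eq_fun do rewrite big_nil; exact: measurable_cst.
under eq_fun do rewrite big_cons.
apply: measurable_maxr => //; apply: measurableT_comp => //; exact: measurable_coord.
Qed.

End euclidean.

Section dyadic.
Context {R : realType}.
Implicit Types x : R.

Lemma dyadic_small x : 0 < x -> x <= 1 ->
  exists k, 2^-1 ^+ k.+1 < x /\ x <= 2^-1 ^+ k.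
Proof.
move=> x0 x1.
have [k kx] : exists k, 2^-1 ^+ k.+1 < x.
  exists (Num.truncn x^-1); rewrite exprVn invf_plt ?posrE//.
  apply: lt_trans (truncnS_gt _) _; rewrite -natrX ltr_nat; exact: ltn_expl.
have ex : exists k, 2^-1 ^+ k.+1 < x by exists k.
case: (ex_minnP ex) => m mx mmin; exists m; split => //.
case: m mx mmin => [|m] mx mmin; first by rewrite expr0.
by rewrite leNgt; apply/negP => /mmin; rewrite ltnn.
Qed.

Lemma dyadic_large x : 1 < x -> exists k, 2 ^+ k < x /\ x <= 2 ^+ k.+1.
Proof.
move=> x1.
have [k kx] : exists k, x <= 2 ^+ k.+1.
  exists (Num.truncn x); apply/ltW/(lt_trans (truncnS_gt _)).
  by rewrite -natrX ltr_nat; exact: ltn_expl.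
have ex : exists k, x <= 2 ^+ k.+1 by exists k.
case: (ex_minnP ex) => m mx mmin; exists m; split => //.
case: m mx mmin => [|m] mx mmin; first by rewrite expr0.
by rewrite ltNge; apply/negP => /mmin; rewrite ltnn.
Qed.

Lemma geometric_le x n : 0 <= x -> x < 1 -> \sum_(0 <= k < n) x ^+ k <= (1 - x)^-1.
Proof.
move=> x0 x1; rewrite -[leRHS]mul1r ler_pdivlMr ?subr_gt0// big_mkord.
have := subrX1 x n => h; have : 0 <= x ^+ n by rewrite exprn_ge0.
nra.
Qed.

End dyadic.

(** * Integrals over dyadic shells *)

Section shells.
Context {R : realType} {d : nat}.
Local Notation vol := (lebesgue_rV R d).

(** On each shell f is replaced by its geometric bound, while A is integrated over the whole cube
    containing the shell. The resulting geometric series have ratios a1 g1 near the origin and a2 g2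
    far out. The origin lies in no shell, whence the condition at [supn x = 0]. *)
Lemma integral_shells_le (f A : 'rV[R]_d -> R) (C1 a1 C2 a2 D1 g1 D2 g2 : R) :
  measurable_fun [set: 'rV[R]_d] f -> measurable_fun [set: 'rV[R]_d] A ->
  (forall x, 0 <= f x) -> (forall x, 0 <= A x) ->
  0 <= C1 -> 0 <= a1 -> 0 <= C2 -> 0 <= a2 -> 0 <= D1 -> 0 <= g1 -> 0 <= D2 -> 0 <= g2 ->
  a1 * g1 < 1 -> a2 * g2 < 1 ->
  (forall x, supn x = 0 -> f x = 0) ->
  (forall k x, 2^-1 ^+ k.+1 < supn x -> supn x <= 2^-1 ^+ k -> f x <= C1 * a1 ^+ k) ->
  (forall k x, 2 ^+ k < supn x -> supn x <= 2 ^+ k.+1 -> f x <= C2 * a2 ^+ k) ->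
  (forall k, (\int[vol]_x (\1_(box (fun _ => 2^-1 ^+ k)) x * A x)%:E <= (D1 * g1 ^+ k)%:E)%E) ->
  (forall k, (\int[vol]_x (\1_(box (fun _ => 2 ^+ k.+1)) x * A x)%:E <= (D2 * g2 ^+ k)%:E)%E) ->
  (\int[vol]_x (f x * A x)%:E <= (C1 * D1 / (1 - a1 * g1) + C2 * D2 / (1 - a2 * g2))%:E)%E.
Proof.
move=> mf mA f0 A0 C10 a10 C20 a20 D10 g10 D20 g20 ag1 ag2 fz fs fl As Al.
pose f1 x := f x * \1_[set x : 'rV[R]_d | supn x <= 1] x.
pose f2 x := f x * \1_[set x : 'rV[R]_d | ~ supn x <= 1] x.
have mset : measurable [set x : 'rV[R]_d | supn x <= 1].
  rewrite -[X in measurable X]setTI.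
  have := @measurable_supn R d measurableT `]-oo, 1%R]%classic (measurable_itv _).
  by congr (measurable (_ `&` _)); apply/seteqP; split => x /=; rewrite in_itv.
have mf1 : measurable_fun [set: 'rV[R]_d] f1.
  by apply: measurable_funM => //; exact: measurable_indic.
have mf2 : measurable_fun [set: 'rV[R]_d] f2.
  apply: measurable_funM => //; apply: measurable_indic; exact: measurableC.
have f10 x : 0 <= f1 x by rewrite mulr_ge0.
have f20 x : 0 <= f2 x by rewrite mulr_ge0.
have fE x : f x = f1 x + f2 x.
  rewrite /f1 /f2 -mulrDr !indicE; have [h|h] := leP (supn x) 1.
    by rewrite mem_set// memNset ?addr0 ?mulr1//= => /(_ h).
  rewrite memNset/=; last by apply/negP; rewrite -ltNge.
  by rewrite mem_set ?add0r ?mulr1//=; apply/negP; rewrite -ltNge.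
have sumb (C a D g : R) m : 0 <= C -> 0 <= a -> 0 <= D -> 0 <= g -> a * g < 1 ->
    \sum_(0 <= k < m) (C * a ^+ k) * (D * g ^+ k) <= C * D / (1 - a * g).
  move=> *; have -> : \sum_(0 <= k < m) (C * a ^+ k) * (D * g ^+ k) = C * D * \sum_(0 <= k < m) (a * g) ^+ k.
    by rewrite mulr_sumr; apply: eq_bigr => k _; rewrite exprMn; ring.
  by rewrite ler_wpM2l ?mulr_ge0// geometric_le// mulr_ge0.
under eq_integral do rewrite fE mulrDl EFinD.
rewrite ge0_integralD//=; first last.
- by apply/measurable_EFinP; exact: measurable_funM.
- by move=> x _; rewrite lee_fin mulr_ge0.
- by apply/measurable_EFinP; exact: measurable_funM.
- by move=> x _; rewrite lee_fin mulr_ge0.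
rewrite EFinD; apply: leeD.
- apply: (@integral_boxes_le _ _ f1 A (fun k => C1 * a1 ^+ k) (fun k => D1 * g1 ^+ k)
    (fun k _ => 2^-1 ^+ k)) => //.
  + by move=> k; rewrite mulr_ge0// exprn_ge0.
  + move=> x; rewrite /f1 indicE; have [h|h] := leP (supn x) 1; last first.
      by rewrite memNset ?mulr0 ?eqxx//=; apply/negP; rewrite -ltNge.
    rewrite mem_set// mulr1 => fx0.
    have x0 : 0 < supn x.
      by rewrite lt_neqAle supn_ge0 andbT eq_sym; apply: contra fx0 => /eqP/fz ->.
    have [k [k1 k2]] := dyadic_small x0 h.
    exists k; split; last exact: fs.
    by move=> i; apply: le_trans k2; exact: coord_le_supn.
  + by move=> m; exact: sumb.
- apply: (@integral_boxes_le _ _ f2 A (fun k => C2 * a2 ^+ k) (fun k => D2 * g2 ^+ k)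
    (fun k _ => 2 ^+ k.+1)) => //.
  + by move=> k; rewrite mulr_ge0// exprn_ge0.
  + move=> x; rewrite /f2 indicE; have [h|h] := leP (supn x) 1.
      by rewrite memNset ?mulr0 ?eqxx//= => /(_ h).
    rewrite mem_set/=; last by apply/negP; rewrite -ltNge.
    move=> _; rewrite mulr1; have [k [k1 k2]] := dyadic_large h.
    exists k; split; last exact: fl.
    by move=> i; apply: le_trans k2; exact: coord_le_supn.
  + by move=> m; exact: sumb.
Qed.

Lemma integral_cube (r : R) : 0 <= r ->
  (\int[vol]_x (\1_(box (fun _ => r)) x * 1)%:E = ((2 * r) ^+ d)%:E)%E.
Proof.
move=> r0; under eq_integral do rewrite mulr1.
rewrite integral_indic//; last exact: measurable_box.
rewrite setIT; apply: etrans (lebesgue_box (fun _ => r0)) _.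
by rewrite prodr_const card_ord.
Qed.

Lemma integrable_shells (f : 'rV[R]_d -> R) (C1 a1 C2 a2 : R) :
  measurable_fun [set: 'rV[R]_d] f -> (forall x, 0 <= f x) ->
  0 <= C1 -> 0 <= a1 -> 0 <= C2 -> 0 <= a2 ->
  a1 * 2^-1 ^+ d < 1 -> a2 * 2 ^+ d < 1 ->
  (forall x, supn x = 0 -> f x = 0) ->
  (forall k x, 2^-1 ^+ k.+1 < supn x -> supn x <= 2^-1 ^+ k -> f x <= C1 * a1 ^+ k) ->
  (forall k x, 2 ^+ k < supn x -> supn x <= 2 ^+ k.+1 -> f x <= C2 * a2 ^+ k) ->
  rint vol f.
Proof.
move=> mf f0 C10 a10 C20 a20 ag1 ag2 fz fs fl.
apply: ge0_rintegral_EFin => //.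
have h0 : 0 <= (2^-1 : R) ^+ d by rewrite exprn_ge0// invr_ge0.
have h1 : 0 <= (2 : R) ^+ d by rewrite exprn_ge0.
have h2 : 0 <= (4 : R) ^+ d by rewrite exprn_ge0.
have := @integral_shells_le f (fun=> 1) C1 a1 C2 a2 (2 ^+ d) (2^-1 ^+ d) (4 ^+ d) (2 ^+ d)
  mf (measurable_cst _) f0 (fun=> ler01) C10 a10 C20 a20 h1 h0 h2 h1 ag1 ag2 fz fs fl.
move=> H; apply: (@le_lt_trans _ _ (\int[vol]_x (f x * 1)%:E)%E).
  by under [leRHS]eq_integral do rewrite mulr1.
apply: le_lt_trans (H _ _) (ltry _) => k.
- by rewrite integral_cube ?exprn_ge0 ?invr_ge0// exprMn -!exprM mulnC.
- rewrite integral_cube ?exprn_ge0// exprMn exprS exprMn mulrA -exprMn -!exprM mulnC.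
  by rewrite -natrM.
Qed.

End shells.

(** * Squared trigonometric polynomials *)

Section trigonometric_sums.
Context {R : realType}.
Local Notation leb := (@lebesgue_measure R).

(** The squared modulus of sum_k a_k exp(i k s), in real terms. *)
Definition trig_sq n (a : 'I_n -> R) (s : R) : R :=
  (\sum_(k < n) a k * cos (k%:R * s)) ^+ 2 + (\sum_(k < n) a k * sin (k%:R * s)) ^+ 2.

Lemma trig_sq_ge0 n (a : 'I_n -> R) s : 0 <= trig_sq a s.
Proof. by rewrite addr_ge0// sqr_ge0. Qed.

Lemma trig_sqE n (a : 'I_n -> R) s :
  trig_sq a s = \sum_(k < n) \sum_(l < n) a k * a l * cos ((k%:R - l%:R) * s).
Proof.
rewrite /trig_sq !expr2 !big_distrl -big_split; apply: eq_bigr => k _ /=.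
rewrite !big_distrr -big_split; apply: eq_bigr => l _ /=.
by rewrite mulrBl cosB; ring.
Qed.

Lemma measurable_trig_sq n (a : 'I_n -> R) : measurable_fun [set: R] (trig_sq a).
Proof.
apply: measurable_funD; apply: measurable_funX; apply: measurable_sum => k;
  apply: measurable_funM => //; apply: measurableT_comp => //.
- by apply: continuous_measurable_fun; exact: continuous_cos.
- by apply: continuous_measurable_fun; exact: continuous_sin.
Qed.

Lemma continuous_cos_affine (m s : R) : continuous (fun x : R => cos (m * (s + x))).
Proof.
move=> x; apply/differentiable_continuous/derivable1_diffP; apply: ex_derive.
Qed.

Lemma Rintegral_cos_period (m : nat) (s : R) : (0 < m)%N ->
  \int[leb]_(x in `[0, 2 * pi]) cos (m%:R * (s + x)) = 0.
Proof.
move=> m0; have m0' : m%:R != 0 :> R by rewrite pnatr_eq0 -lt0n.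
have pi2 : 0 < 2 * pi :> R by rewrite mulr_gt0// pi_gt0.
have dF (x : R) : is_derive x 1 (fun x => m%:R^-1 * sin (m%:R * (s + x))) (cos (m%:R * (s + x))).
  by apply: is_derive_eq; rewrite /GRing.scale/=; field.
have cF : continuous (fun x : R => m%:R^-1 * sin (m%:R * (s + x))).
  by move=> x; apply/differentiable_continuous/derivable1_diffP; apply: ex_derive.
rewrite /Rintegral (@continuous_FTC2 R _ (fun x => m%:R^-1 * sin (m%:R * (s + x))) 0 (2 * pi))//.
- rewrite -EFinB /= -mulrBr (_ : m%:R * (s + 2 * pi) = m%:R * (s + 0) + (pi *+ 2) *+ m).
    by rewrite (periodicn (@sinD2pi R)) subrr mulr0.
  by rewrite -mulr_natr -(mulr_natr pi); ring.
- apply: continuous_subspaceT; exact: continuous_cos_affine.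
- split.
  + by move=> x _; apply: ex_derive.
  + by apply: cvg_at_right_filter; exact: cF.
  + by apply: cvg_at_left_filter; exact: cF.
- by move=> x _; rewrite derive1E; exact: derive_val.
Qed.

End trigonometric_sums.

(** * The weight g_sp *)

Section trig_sq_period.
Context {R : realType}.
Local Notation leb := (@lebesgue_measure R).

Lemma lebesgue_period : leb `[0, 2 * pi]%classic = (2 * pi)%:E.
Proof.
have pi2 : 0 < 2 * pi :> R by rewrite mulr_gt0// pi_gt0.
by rewrite lebesgue_measure_itv/= lte_fin pi2 -EFinB subr0.
Qed.

Lemma Rintegral_sum_in d (T : measurableType d) (mu : {measure set T -> \bar R})
    (D : set T) (I : Type) (s : seq I) (F : I -> T -> R) : measurable D ->
  (forall i, mu.-integrable D (EFin \o F i)) ->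
  mu.-integrable D (EFin \o (fun x => \sum_(i <- s) F i x)) /\
  \int[mu]_(x in D) (\sum_(i <- s) F i x) = \sum_(i <- s) \int[mu]_(x in D) F i x.
Proof.
move=> mD iF; elim: s => [|i s [IH1 IH2]].
  split; first by under eq_fun do rewrite big_nil; exact: integrable0.
  by under eq_Rintegral do rewrite big_nil; rewrite /Rintegral integral0 big_nil.
split.
  under eq_fun do rewrite big_cons.
  by have := integrableD mD (iF i) IH1.
by under eq_Rintegral do rewrite big_cons; rewrite big_cons -IH2 RintegralD.
Qed.

(** Parseval's identity; the period starts at an arbitrary s, which will be the phase rho.x of a
    fixed point x. *)
Lemma Rintegral_trig_sq n (a : 'I_n -> R) (s : R) :
  leb.-integrable `[0, 2 * pi] (EFin \o (fun x => trig_sq a (s + x))) /\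
  \int[leb]_(x in `[0, 2 * pi]) trig_sq a (s + x) = 2 * pi * \sum_(k < n) a k ^+ 2.
Proof.
have pi2 : 0 < 2 * pi :> R by rewrite mulr_gt0// pi_gt0.
have icZ (c m : R) : leb.-integrable `[0, 2 * pi] (EFin \o (fun x => c * cos (m * (s + x)))).
  apply: continuous_compact_integrable; first exact: segment_compact.
  apply: continuous_subspaceT => x; apply: continuousM; first exact: cst_continuous.
  exact: continuous_cos_affine.
have ic (m : R) : leb.-integrable `[0, 2 * pi] (EFin \o (fun x => cos (m * (s + x)))).
  rewrite (_ : (fun x => _) = (fun x => 1 * cos (m * (s + x)))); first exact: icZ.
  by apply/funext => x; rewrite mul1r.
have E (k l : 'I_n) : \int[leb]_(x in `[0, 2 * pi]) cos ((k%:R - l%:R) * (s + x)) =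
    if k == l then 2 * pi else 0.
  have [->|kl] := eqVneq k l.
    under eq_Rintegral do rewrite subrr mul0r cos0.
    rewrite (@Rintegral_cst _ _ R leb _ (measurable_itv _)) mul1r.
    by have := congr1 fine lebesgue_period.
  have [lk|lk] := leqP l k.
    rewrite -natrB//; apply: Rintegral_cos_period.
    by rewrite subn_gt0 ltn_neqAle lk andbT eq_sym.
  under eq_Rintegral do rewrite -cosN -mulNr opprB -(natrB _ (ltnW lk)).
  by apply: Rintegral_cos_period; rewrite subn_gt0.
rewrite (_ : (fun x => trig_sq a (s + x)) =
  (fun x => \sum_(k < n) \sum_(l < n) a k * a l * cos ((k%:R - l%:R) * (s + x)))).
  2: by apply/funext => x; exact: trig_sqE.
have [iS ->] := @Rintegral_sum_in _ _ leb `[0, 2 * pi]%classic _ (index_enum 'I_n)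
  (fun k x => \sum_(l < n) a k * a l * cos ((k%:R - l%:R) * (s + x))) (measurable_itv _)
  (fun k => proj1 (@Rintegral_sum_in _ _ leb `[0, 2 * pi]%classic _ (index_enum 'I_n)
  (fun l x => a k * a l * cos ((k%:R - l%:R) * (s + x))) (measurable_itv _) (fun l => icZ _ _))).
split; first exact: iS.
rewrite mulr_sumr; apply: eq_bigr => k _.
have [_ ->] := @Rintegral_sum_in _ _ leb `[0, 2 * pi]%classic _ (index_enum 'I_n)
  (fun l x => a k * a l * cos ((k%:R - l%:R) * (s + x))) (measurable_itv _) (fun l => icZ _ _).
rewrite (bigD1 k)//= big1 => [|l lk]; last by rewrite RintegralZl// E eq_sym (negbTE lk) mulr0.
by rewrite RintegralZl// E eqxx addr0; ring.
Qed.

Lemma integral_trig_sq n (a : 'I_n -> R) (s : R) :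
  (\int[leb]_x (\1_`[0%R, (2 * pi)%R] x * trig_sq a (s + x))%:E =
  (2 * pi * \sum_(k < n) a k ^+ 2)%:E)%E.
Proof.
have [it <-] := Rintegral_trig_sq a s.
rewrite /Rintegral fineK; last exact: integrable_fin_num it.
rewrite [RHS]integral_mkcond; apply: eq_integral => x _.
by rewrite patchE indicE; case: ifP => _; rewrite ?mul1r ?mul0r.
Qed.

End trig_sq_period.

(** * Averaging along one coordinate *)

Section directional_average.
Context {R : realType} {d : nat}.
Local Notation vol := (lebesgue_rV R d).
Local Notation leb := (@lebesgue_measure R).
Variables (rho : 'rV[R]_d) (i : 'I_d).
Hypothesis rhoi : rho ord0 i != 0.

(** Moving x by t [eta] adds t to the phase rho.x, and over a full period coordinate i travels the
    distance L. *)
Let L : R := 2 * pi / `|rho ord0 i|.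
Let eta : 'rV[R]_d := (rho ord0 i)^-1 *: delta_mx 0 i.

Let dot_eta : dot rho eta = 1.
Proof.
rewrite /dot (bigD1 i)//= big1 => [|j ji].
  by rewrite !mxE !eqxx mulr1 divff// addr0.
by rewrite !mxE eqxx (negbTE ji) !mulr0.
Qed.

(* Averaging over a shift along coordinate i, where the phase runs through a
   full period, removes the off-diagonal terms. *)
Lemma integral_cube_trig n (a : 'I_n -> R) (r : R) : 0 <= r ->
  (\int[vol]_x (\1_(box (fun _ => r)) x * trig_sq a (dot rho x))%:E <=
   ((\sum_(k < n) a k ^+ 2) * (2 * (r + L) * (2 * r) ^+ d.-1))%:E)%E.
Proof.
move=> r0; have pi2 : 0 < 2 * pi :> R by rewrite mulr_gt0// pi_gt0.
have L0 : 0 <= L by rewrite divr_ge0// ltW.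
(* The cube is enlarged by L in coordinate i only, so that x - t [eta] stays inside for every x in
   the cube and every t in [0, 2 pi]. *)
pose r' (j : 'I_d) := r + L * (j == i)%:R.
have r'0 j : 0 <= r' j by rewrite addr_ge0// mulr_ge0.
have mt (s : R) : measurable_fun [set: 'rV[R]_d] (fun x => trig_sq a (dot rho x + s)).
  apply: (measurableT_comp (measurable_trig_sq a)); apply: measurable_funD => //.
  exact: measurable_dot.
have t0 s : 0 <= trig_sq a s by exact: trig_sq_ge0.
have mshift (t : R) : measurable_fun [set: 'rV[R]_d] (fun x : 'rV[R]_d => x - t *: eta).
  apply: measurable_fun_rV => j.
  rewrite (_ : (fun x => _) = (fun x : 'rV[R]_d => x ord0 j - t * eta ord0 j)); last first.
    by apply/funext => x; rewrite !mxE.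
  by apply: measurable_funB => //; exact: measurable_coord.
pose X := (\int[vol]_x (\1_(box (fun _ => r)) x * trig_sq a (dot rho x))%:E)%E.
pose Y (t : R) := (\int[vol]_x (\1_(box r') x * trig_sq a (dot rho x + t))%:E)%E.
have XY t : 0 <= t -> t <= 2 * pi -> (X <= Y t)%E.
  move=> t0' t2.
  pose f (x : 'rV[R]_d) := (\1_(box r') (x - t *: eta) * trig_sq a (dot rho x))%:E.
  have mf : measurable_fun [set: 'rV[R]_d] f.
    apply/measurable_EFinP; apply: measurable_funM; last first.
      by have := mt 0; under eq_fun do rewrite addr0.
    by apply: (measurableT_comp _ (mshift t)); apply: measurable_indic; exact: measurable_box.
  have f0 x : (0 <= f x)%E by rewrite lee_fin mulr_ge0.
  have := @ge0_integral_rV_affine R d 1 (t *: eta) f (oner_neq0 _) mf f0.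
  rewrite normr1 expr1n invr1 mul1e => H.
  apply: (@le_trans _ _ (\int[vol]_x f x)%E).
    apply: ge0_le_integral => //.
    - by move=> x _; rewrite lee_fin mulr_ge0.
    - apply/measurable_EFinP; apply: measurable_funM.
        by apply: measurable_indic; exact: measurable_box.
      by have := mt 0; under eq_fun do rewrite addr0.
    - move=> x _; rewrite lee_fin ler_wpM2r// !indicE.
      have [xr|_] := boolP (x \in box (fun _ => r)); last by [].
      rewrite mem_set// => j; rewrite !mxE /r'; move: xr; rewrite inE => xr.
      have [->|ji] := eqVneq j i; last by rewrite !mulr0 subr0 addr0; exact: xr.
      rewrite !mulr1; apply: le_trans (ler_normB _ _) _; apply: lerD; first exact: xr.
      rewrite normrM normfV (ger0_norm t0') ler_wpM2r// invr_ge0//.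
  rewrite -H /Y le_eqVlt; apply/orP; left; apply/eqP; apply: eq_integral => x _.
  by rewrite /f scale1r addrK dotDr dotZr dot_eta mulr1.
pose I (t : R) : R := \1_`[0%R, (2 * pi)%R] t.
have mI : measurable_fun [set: R] I by apply: measurable_indic; exact: measurable_itv.
have I0 t : 0 <= I t by rewrite /I indicE.
(* [X] is below every [Y t], hence below their mean over a period; Tonelli then moves the t-integral
   inside, where Parseval leaves the volume of the enlarged box. *)
have XI : ((2 * pi)%:E * X <= \int[leb]_t ((I t)%:E * Y t))%E.
  have -> : ((2 * pi)%:E = \int[leb]_t (I t)%:E)%E.
    rewrite /I (@integral_indic _ _ R leb _ measurableT _ (measurable_itv _)).
    by rewrite setIT; exact/esym/lebesgue_period.
  have mI' : measurable_fun [set: R] (fun t => (I t)%:E) by exact/measurable_EFinP.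
  have X0 : (0 <= X)%E by apply: integral_ge0 => x _; rewrite lee_fin mulr_ge0.
  have <- := @ge0_integralZr _ _ R leb _ measurableT _ mI' X (fun t _ => I0 t) X0.
  have mY : measurable_fun [set: R] Y.
    apply: (@measurable_fun_fubini_tonelli_F _ _ _ _ R vol
      (fun z : R * 'rV[R]_d => (\1_(box r') z.2 * trig_sq a (dot rho z.2 + z.1))%:E)).
      apply/measurable_EFinP; apply: measurable_funM.
        by apply: (measurableT_comp _ measurable_snd); apply: measurable_indic; exact: measurable_box.
      apply: (measurableT_comp (measurable_trig_sq a)); apply: measurable_funD => //.
      by apply: (measurableT_comp _ measurable_snd); exact: measurable_dot.
    by move=> z; rewrite lee_fin mulr_ge0.
  have Y0 t : (0 <= Y t)%E by apply: integral_ge0 => x _; rewrite lee_fin mulr_ge0.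
  apply: ge0_le_integral => //.
  - by move=> t _; rewrite mule_ge0 ?lee_fin.
  - by apply: emeasurable_funM.
  - by apply: emeasurable_funM.
  - move=> t _; rewrite /I indicE; have [h|_] := boolP (t \in _); last by rewrite !mul0e.
    rewrite !mul1e; apply: XY; by move: h; rewrite inE/= in_itv/= => /andP[].
pose G (z : R * 'rV[R]_d) := (I z.1 * (\1_(box r') z.2 * trig_sq a (dot rho z.2 + z.1)))%:E.
have mG : measurable_fun [set: R * 'rV[R]_d] G.
  apply/measurable_EFinP; apply: measurable_funM; first exact: (measurableT_comp mI).
  apply: measurable_funM.
    by apply: (measurableT_comp _ measurable_snd); apply: measurable_indic; exact: measurable_box.
  apply: (measurableT_comp (measurable_trig_sq a)); apply: measurable_funD => //.
  by apply: (measurableT_comp _ measurable_snd); exact: measurable_dot.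
have G0 z : (0 <= G z)%E by rewrite lee_fin !mulr_ge0.
have E1 : (\int[leb]_t ((I t)%:E * Y t) = \int[leb]_t \int[vol]_x G (t, x))%E.
  apply: eq_integral => t _; rewrite /Y -ge0_integralZl//; last 3 first.
  - apply/measurable_EFinP; apply: measurable_funM; last exact: mt.
    by apply: measurable_indic; exact: measurable_box.
  - by move=> x _; rewrite lee_fin mulr_ge0.
  - by rewrite lee_fin.
have E2 : (\int[leb]_t \int[vol]_x G (t, x) =
    \int[vol]_x ((\1_(box r') x)%:E * (2 * pi * \sum_(k < n) a k ^+ 2)%:E))%E.
  rewrite (@fubini_tonelli _ _ _ _ R leb vol G mG G0); apply: eq_integral => x _.
  have mP : measurable_fun [set: R] (fun t => (\1_`[0%R, (2 * pi)%R] t * trig_sq a (dot rho x + t))%:E).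
    apply/measurable_EFinP; apply: measurable_funM => //.
    by apply: (measurableT_comp (measurable_trig_sq a)); exact: measurable_funD.
  have P0 t : [set: R] t -> (0 <= (\1_`[0%R, (2 * pi)%R] t * trig_sq a (dot rho x + t))%:E)%E.
    by move=> _; rewrite lee_fin mulr_ge0.
  have b0 : (0 <= (\1_(box r') x)%:E :> \bar R)%E by rewrite lee_fin.
  rewrite -(integral_trig_sq a (dot rho x)) -(@ge0_integralZl _ _ R leb _ measurableT _ mP _ P0 b0).
  by apply: eq_integral => t _; rewrite /G /= -EFinM; congr EFin; rewrite mulrCA.
have E3 : (\int[vol]_x ((\1_(box r') x)%:E * (2 * pi * \sum_(k < n) a k ^+ 2)%:E) =
    (2 * pi)%:E * ((\sum_(k < n) a k ^+ 2) * (2 * (r + L) * (2 * r) ^+ d.-1))%:E)%E.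
  have s0 : 0 <= \sum_(k < n) a k ^+ 2 by apply: sumr_ge0 => k _; exact: sqr_ge0.
  rewrite ge0_integralZr//; last 2 first.
  - by apply/measurable_EFinP; apply: measurable_indic; exact: measurable_box.
  - by rewrite lee_fin mulr_ge0// ltW.
  rewrite integral_indic//; last exact: measurable_box.
  transitivity ((2 * (r + L) * (2 * r) ^+ d.-1)%:E * (2 * pi * \sum_(k < n) a k ^+ 2)%:E)%E.
    congr (_ * _)%E; rewrite setIT; apply: etrans (lebesgue_box r'0) _; congr EFin.
    rewrite (bigD1 i)//= /r' eqxx mulr1; congr (_ * _).
    rewrite (eq_bigr (fun _ => 2 * r)); last by move=> j /negbTE ->; rewrite mulr0 addr0.
    by rewrite prodr_const cardC1 card_ord.
  by rewrite -!EFinM; congr EFin; ring.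
move: XI; rewrite E1 E2 E3 lee_pmul2l//; exact.
Qed.

(** The enlarged box counts as r^(d-1) for small r, because L does not shrink with r, and as r^d for
    large r. So the near condition carries the exponent [d.-1], one less than for plain
    integrability, and the far condition is unchanged. *)
Lemma integral_shells_trig (f : 'rV[R]_d -> R) (C1 a1 C2 a2 : R) :
  measurable_fun [set: 'rV[R]_d] f -> (forall x, 0 <= f x) ->
  0 <= C1 -> 0 <= a1 -> 0 <= C2 -> 0 <= a2 ->
  a1 * 2^-1 ^+ d.-1 < 1 -> a2 * 2 ^+ d < 1 ->
  (forall x, supn x = 0 -> f x = 0) ->
  (forall k x, 2^-1 ^+ k.+1 < supn x -> supn x <= 2^-1 ^+ k -> f x <= C1 * a1 ^+ k) ->
  (forall k x, 2 ^+ k < supn x -> supn x <= 2 ^+ k.+1 -> f x <= C2 * a2 ^+ k) ->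
  exists2 B, 0 <= B & forall n (a : 'I_n -> R),
    (\int[vol]_x (f x * trig_sq a (dot rho x))%:E <= (B * \sum_(k < n) a k ^+ 2)%:E)%E.
Proof.
move=> mf f0 C10 a10 C20 a20 ag1 ag2 fz fs fl.
have pi2 : 0 < 2 * pi :> R by rewrite mulr_gt0// pi_gt0.
have L0 : 0 <= L by rewrite divr_ge0// ltW.
pose d1 := 2 * (1 + L) * 2 ^+ d.-1; pose d2 := (1 + L) * 4 ^+ d.
have d10 : 0 <= d1 by rewrite !mulr_ge0 ?addr_ge0// exprn_ge0.
have d20 : 0 <= d2 by rewrite !mulr_ge0 ?addr_ge0// exprn_ge0.
exists (C1 * d1 / (1 - a1 * 2^-1 ^+ d.-1) + C2 * d2 / (1 - a2 * 2 ^+ d)).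
  by apply: addr_ge0; apply: divr_ge0; rewrite ?subr_ge0;
    [exact: mulr_ge0|exact: ltW|exact: mulr_ge0|exact: ltW].
move=> n a; set S := \sum_(k < n) _.
have S0 : 0 <= S by apply: sumr_ge0 => k _; exact: sqr_ge0.
have h0 : 0 <= (2^-1 : R) ^+ d.-1 by rewrite exprn_ge0// invr_ge0.
have h1 : 0 <= (2 : R) ^+ d by rewrite exprn_ge0.
have mt : measurable_fun [set: 'rV[R]_d] (fun x => trig_sq a (dot rho x)).
  by apply: (measurableT_comp (measurable_trig_sq a)); exact: measurable_dot.
have := @integral_shells_le R d f (fun x => trig_sq a (dot rho x)) C1 a1 C2 a2 (d1 * S) (2^-1 ^+ d.-1)
  (d2 * S) (2 ^+ d) mf mt f0 (fun x => trig_sq_ge0 a _) C10 a10 C20 a20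
  (mulr_ge0 d10 S0) h0 (mulr_ge0 d20 S0) h1 ag1 ag2 fz fs fl.
have -> : (C1 * d1 / (1 - a1 * 2^-1 ^+ d.-1) + C2 * d2 / (1 - a2 * 2 ^+ d)) * S =
  C1 * (d1 * S) / (1 - a1 * 2^-1 ^+ d.-1) + C2 * (d2 * S) / (1 - a2 * 2 ^+ d) by ring.
apply => k.
- have k0 : 0 <= (2^-1 : R) ^+ k by rewrite exprn_ge0// invr_ge0.
  have k1 : (2^-1 : R) ^+ k <= 1 by rewrite exprn_ile1// ?invr_ge0// invf_le1//; lra.
  apply: le_trans (integral_cube_trig a k0) _; rewrite lee_fin.
  rewrite [leRHS](_ : _ = S * (2 * (1 + L) * (2 * 2^-1 ^+ k) ^+ d.-1)); last first.
    by rewrite exprMn -!exprM /d1 (mulnC k); ring.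
  apply: ler_wpM2l => //; apply: ler_wpM2r; first by rewrite exprn_ge0// mulr_ge0.
  by apply: ler_wpM2l => //; apply: lerD.
- have k0 : 0 <= (2 : R) ^+ k.+1 by rewrite exprn_ge0.
  have k1 : 1 <= (2 : R) ^+ k.+1 by rewrite exprn_ege1//; lra.
  apply: le_trans (integral_cube_trig a k0) _; rewrite lee_fin.
  have dE : d = d.-1.+1 by case: (d) i => [[]//|].
  rewrite [leRHS](_ : _ = S * ((1 + L) * ((2 * 2 ^+ k.+1) * (2 * 2 ^+ k.+1) ^+ d.-1))); last first.
    rewrite -exprS -dE (_ : 2 * 2 ^+ k.+1 = 4 * 2 ^+ k :> R); last by rewrite exprS; ring.
    by rewrite exprMn -!exprM /d2 (mulnC k); ring.
  apply: ler_wpM2l => //; rewrite [leRHS]mulrA; apply: ler_wpM2r.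
    by rewrite exprn_ge0// mulr_ge0.
  nra.
Qed.

End directional_average.

Section riesz_weights.
Context {R : realType} {d : nat}.
Local Notation vol := (lebesgue_rV R d).
Implicit Types (x rho : 'rV[R]_d).

Lemma powR_half_exp (p : R) k : (2^-1 ^+ k.+1) `^ (- p) = 2 `^ p * (2 `^ p) ^+ k :> R.
Proof.
have p2 : 0 <= 2 ^+ k.+1 :> R by rewrite exprn_ge0.
rewrite -exprS exprVn -powR_inv1// -powRrM mulrNN mul1r -powR_mulrn// -powRrM mulrC powRrM.
by rewrite powR_mulrn// powR_ge0.
Qed.

Lemma powR_pow (p : R) k : (2 ^+ k) `^ p = (2 `^ p) ^+ k :> R.
Proof. by rewrite -powR_mulrn// -powRrM mulrC powRrM powR_mulrn// powR_ge0. Qed.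

Lemma powRN_antitone (p x y : R) : 0 <= p -> 0 < x -> x <= y -> y `^ (- p) <= x `^ (- p).
Proof.
move=> p0 x0 xy; rewrite !powRN lef_pV2 ?posrE ?powR_gt0// ?(lt_le_trans x0)//.
by apply: ge0_ler_powR => //; rewrite nnegrE ltW// (lt_le_trans x0).
Qed.

Lemma enorm_near p k x : 0 <= p -> 2^-1 ^+ k.+1 < supn x ->
  enorm x `^ (- p) <= 2 `^ p * (2 `^ p) ^+ k.
Proof.
move=> p0 h; rewrite -powR_half_exp; apply: powRN_antitone => //;
  last by apply: le_trans (supn_le_enorm x); exact: ltW.
Qed.

Lemma enorm_far p k x : 0 <= p -> 2 ^+ k < supn x ->
  enorm x `^ (- p) <= (2 `^ (- p)) ^+ k.
Proof.
move=> p0 h; rewrite -powR_pow; apply: powRN_antitone => //; last by apply: le_trans (supn_le_enorm x);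
  exact: ltW.
Qed.

Lemma measurable_enorm_powR (q : R) : measurable_fun [set: 'rV[R]_d] (fun x => enorm x `^ q).
Proof. exact: (measurableT_comp (measurable_powR q) measurable_enorm). Qed.

Variables (beta : R).
Hypotheses (beta0 : 0 < beta) (beta2 : beta < 2) (betad : beta < d%:R).

Lemma measurable_g_sp rho : measurable_fun [set: 'rV[R]_d] (g_sp beta rho).
Proof.
apply: measurable_funM; last exact: measurable_enorm_powR.
apply: measurable_funX; apply: measurableT_comp.
  by apply: continuous_measurable_fun; exact: continuous_sin.
by apply: measurable_funM => //; exact: measurable_dot.
Qed.

Lemma g_sp_ge0 rho x : 0 <= g_sp beta rho x.
Proof. by rewrite /g_sp mulr_ge0 ?powR_ge0// (exprM _ 2 2) sqr_ge0. Qed.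

Lemma normr_sin_le (s : R) : `|sin s| <= `|s|.
Proof.
have := @lipschitz_increment R (@sin R) (@cos R) 0 s 1 ler01 (@is_derive_sin R) (fun y _ => cos_max y).
by rewrite add0r sin0 subr0 mul1r.
Qed.

(** Four factors |sin(rho.x/2)| <= |x| soften the singularity: 16^-k is the fourth power of the
    radius 2^-k, and d^2 comes from |x|^2 <= d (supn x)^2. *)
Lemma g_sp_near rho k x : enorm rho = 1 ->
  2^-1 ^+ k.+1 < supn x -> supn x <= 2^-1 ^+ k ->
  g_sp beta rho x <= (d%:R ^+ 2 * 2 `^ (d%:R + 2 - beta)) * (2 `^ (d%:R + 2 - beta) / 16) ^+ k.
Proof.
move=> rho1 h1 h2; rewrite /g_sp.
have p0 : 0 <= d%:R + 2 - beta by have := betad; lra.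
have -> : beta - d%:R - 2 = - (d%:R + 2 - beta) by ring.
have := enorm_near p0 h1; move: (enorm x `^ _) (powR_ge0 (enorm x) (- (d%:R + 2 - beta))) => e e0 he.
have s4 : sin (dot rho x / 2) ^+ 4 <= d%:R ^+ 2 * (1 / 16) ^+ k.
  have s1 : `|sin (dot rho x / 2)| <= enorm x.
    apply: le_trans (normr_sin_le _) _; rewrite normrM (ger0_norm (x := 2^-1)) ?invr_ge0//.
    have := dot_unit_le x rho1; have := enorm_ge0 x; lra.
  have s2 : sin (dot rho x / 2) ^+ 2 <= d%:R * (1 / 4) ^+ k.
    apply: (@le_trans _ _ (enorm x ^+ 2)).
      by rewrite -real_normK ?num_real// lerXn2r// nnegrE enorm_ge0.
    apply: le_trans (sqr_enorm_le x) _; apply: ler_wpM2l => //.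
    apply: (@le_trans _ _ ((2^-1 ^+ k) ^+ 2)).
      by rewrite lerXn2r// nnegrE ?supn_ge0// exprn_ge0// invr_ge0.
    rewrite -exprM mulnC exprM le_eqVlt; apply/orP; left; apply/eqP; congr (_ ^+ k).
    by rewrite expr2; field.
  rewrite (exprM _ 2 2) (_ : d%:R ^+ 2 * (1 / 16) ^+ k = (d%:R * (1 / 4) ^+ k) ^+ 2).
    by rewrite lerXn2r// nnegrE ?sqr_ge0// mulr_ge0// exprn_ge0// divr_ge0.
  by rewrite [RHS]exprMn exprAC; congr (_ * _ ^+ k); rewrite expr2; field.
apply: le_trans (ler_pM _ e0 s4 he) _.
  by rewrite (exprM _ 2 2) sqr_ge0.
by rewrite !exprMn expr1n; rewrite le_eqVlt; apply/orP; left; apply/eqP; ring.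
Qed.

Lemma g_sp_far rho k x : 2 ^+ k < supn x ->
  g_sp beta rho x <= 1 * (2 `^ (beta - d%:R - 2)) ^+ k.
Proof.
move=> h; rewrite /g_sp; have p0 : 0 <= d%:R + 2 - beta by have := betad; lra.
have -> : beta - d%:R - 2 = - (d%:R + 2 - beta) by ring.
apply: ler_pM; [by rewrite (exprM _ 2 2) sqr_ge0|exact: powR_ge0| |exact: enorm_far].
rewrite (exprM _ 2 2); apply: exprn_ile1; first exact: sqr_ge0.
by have := cos2Dsin2 (dot rho x / 2); have := sqr_ge0 (cos (dot rho x / 2)); lra.
Qed.

Lemma powR2_lt1 (p : R) : p < 0 -> 2 `^ p < 1.
Proof.
move=> p0; rewrite /powR (negbTE (lt0r_neq0 _))// expR_lt1 nmulr_rlt0// ln_gt0//; lra.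
Qed.

(** With these rates the near series has ratio 2^(-1-beta), so the lost dimension is harmless, and
    the far series has ratio 2^(beta-2), which is where beta < 2 enters. *)
Lemma g_sp_bound rho : enorm rho = 1 ->
  exists2 B, 0 <= B & forall n (a : 'I_n -> R),
    (\int[vol]_x (g_sp beta rho x * trig_sq a (dot rho x))%:E <= (B * \sum_(k < n) a k ^+ 2)%:E)%E.
Proof.
move=> rho1.
have [i rhoi] : exists i, rho ord0 i != 0.
  apply/existsP; rewrite -negb_forall; apply/negP => /forallP rho0.
  have : enorm rho ^+ 2 = 0.
    rewrite sqr_enorm; apply: big1 => i _.
    by have /eqP -> := rho0 i; rewrite mul0r.
  by rewrite rho1 expr1n => /eqP; rewrite oner_eq0.
have dE : d = d.-1.+1 by case: (d) i {rhoi} => [[]//|].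
apply: (@integral_shells_trig R d rho i rhoi (g_sp beta rho) (d%:R ^+ 2 * 2 `^ (d%:R + 2 - beta))
  (2 `^ (d%:R + 2 - beta) / 16) 1 (2 `^ (beta - d%:R - 2))).
- exact: measurable_g_sp.
- exact: g_sp_ge0.
- by rewrite mulr_ge0 ?sqr_ge0// powR_ge0.
- by rewrite divr_ge0// powR_ge0.
- exact: ler01.
- exact: powR_ge0.
- rewrite exprVn -(@powR_mulrn R 2)// -powRN.
  rewrite (_ : 16 = 2 `^ 4); last by rewrite powR_mulrn// -natrX.
  have n2 : (2 : R) != 0 by [].
  rewrite -powRN -!powRD; [|by apply/implyP..].
  by apply: powR2_lt1; have := beta0; rewrite [in X in X%:R + 2]dE -natr1; lra.
- rewrite -(@powR_mulrn R 2)// -powRD; last by apply/implyP.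
  by apply: powR2_lt1; have := beta2; lra.
(* A power of 0 with nonzero exponent is 0 by convention, so the weight vanishes at the origin in
   spite of its negative exponent. *)
- move=> x x0; rewrite /g_sp (supn0_enorm x0) powR0 ?mulr0//.
  by apply/eqP => ?; have := betad; lra.
- by move=> k x; exact: g_sp_near.
- by move=> k x h _; exact: g_sp_far.
Qed.

(** This is the preceding bound for a single coefficient 1, whose squared trigonometric sum is 1. *)
Lemma g_sp_rint rho : enorm rho = 1 -> rint vol (g_sp beta rho).
Proof.
move=> rho1; have [B B0 hB] := g_sp_bound rho1.
apply: ge0_rintegral_EFin => //; [exact: measurable_g_sp|exact: g_sp_ge0|].
have := hB 1 (fun=> 1); rewrite big_ord1 expr1n mulr1.
move=> h; apply: le_lt_trans (ltry B); apply: le_trans h.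
rewrite le_eqVlt; apply/orP; left; apply/eqP; apply: eq_integral => x _.
by rewrite /trig_sq !big_ord1 mul0r cos0 sin0 !mulr0 mulr1 expr1n expr0n addr0 mulr1.
Qed.

(** The majorant of the wave kernel before differencing: beta > 0 makes the first weight integrable
    at the origin, beta < 2 the second one at infinity. *)
Lemma riesz_min_rint (c1 c2 : R) : 0 <= c1 -> 0 <= c2 ->
  rint vol (fun x => Num.min (c1 * enorm x `^ (beta - d%:R)) (c2 * enorm x `^ (beta - d%:R - 2))).
Proof.
move=> c10 c20.
apply: (@integrable_shells R d _ (c1 * 2 `^ (d%:R - beta)) (2 `^ (d%:R - beta)) c2 (2 `^ (beta - d%:R - 2))).
- apply: measurable_minr; apply: measurable_funM => //; exact: measurable_enorm_powR.
- by move=> x; rewrite le_min !mulr_ge0 ?powR_ge0.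
- by rewrite mulr_ge0// powR_ge0.
- exact: powR_ge0.
- by [].
- exact: powR_ge0.
- rewrite exprVn -(@powR_mulrn R 2)// -powRN -powRD; last by apply/implyP.
  by apply: powR2_lt1; have := beta0; lra.
- rewrite -(@powR_mulrn R 2)// -powRD; last by apply/implyP.
  by apply: powR2_lt1; have := beta2; lra.
- move=> x x0; rewrite (supn0_enorm x0) !powR0 ?mulr0 ?minxx//; apply/eqP => ?; have := betad; lra.
- move=> k x h _; rewrite ge_min; apply/orP; left; rewrite -mulrA ler_wpM2l//.
  by have := @enorm_near (d%:R - beta) k x; rewrite opprB; apply => //; have := betad; lra.
- move=> k x h _; rewrite ge_min; apply/orP; right; rewrite ler_wpM2l//.
  have := @enorm_far (d%:R + 2 - beta) k x.
  have -> : - (d%:R + 2 - beta) = beta - d%:R - 2 by ring.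
  by apply => //; have := betad; lra.
Qed.

End riesz_weights.

(** * Toeplitz forms *)

Section toeplitz.
Context {d : measure_display} {T : measurableType d} {R : realType}.
Variables (mu : {measure set T -> \bar R}) (theta : T -> R).
Hypothesis mtheta : measurable_fun [set: T] theta.

(** The phase stays abstract because two of them occur: lambda rho.x for the field and rho.x after
    rescaling. For the latter this is [Fc h] at m rho. *)
Definition phase_coef (h : T -> R) (m : R) : R := \int[mu]_x (cos (m * theta x) * h x).

Lemma measurable_phase m : measurable_fun [set: T] (fun x => cos (m * theta x)).
Proof.
apply: measurableT_comp; first by apply: continuous_measurable_fun; exact: continuous_cos.
exact: measurable_funM.
Qed.

Lemma phase_rint h m : rint mu h -> rint mu (fun x => cos (m * theta x) * h x).
Proof.
move=> ih; apply: (@rintegrable_mulb _ _ _ _ h _ 1) => //; first exact: measurable_phase.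
by move=> x; exact: cos_max.
Qed.

Lemma phase_coefN h m : phase_coef h (- m) = phase_coef h m.
Proof. by apply: eq_Rintegral => x _; rewrite mulNr cosN. Qed.

Lemma phase_coefD h1 h2 m : rint mu h1 -> rint mu h2 ->
  phase_coef (fun x => h1 x + h2 x) m = phase_coef h1 m + phase_coef h2 m.
Proof.
move=> i1 i2; rewrite /phase_coef -(RintegralD measurableT (phase_rint m i1) (phase_rint m i2)).
by apply: eq_Rintegral => x _; rewrite mulrDr.
Qed.

Lemma phase_coefZ c h m : rint mu h -> phase_coef (fun x => c * h x) m = c * phase_coef h m.
Proof.
move=> i1; rewrite /phase_coef -(RintegralZl _ measurableT (phase_rint m i1)).
by apply: eq_Rintegral => x _; rewrite mulrCA.
Qed.

Lemma phase_double_sum n (b : 'I_n -> 'I_n -> R) h : rint mu h ->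
  rint mu (fun x => (\sum_(k < n) \sum_(l < n) b k l * cos ((k%:R - l%:R) * theta x)) * h x) /\
  \sum_(k < n) \sum_(l < n) b k l * phase_coef h (k%:R - l%:R) =
  \int[mu]_x ((\sum_(k < n) \sum_(l < n) b k l * cos ((k%:R - l%:R) * theta x)) * h x).
Proof.
move=> ih.
have i1 (k l : 'I_n) : rint mu (fun x => b k l * (cos ((k%:R - l%:R) * theta x) * h x)).
  by apply: rintegrableZ; exact: phase_rint.
have i2 (k : 'I_n) : rint mu (fun x => \sum_(l < n) b k l * (cos ((k%:R - l%:R) * theta x) * h x)).
  exact: rintegrable_sum.
have E : (fun x => (\sum_(k < n) \sum_(l < n) b k l * cos ((k%:R - l%:R) * theta x)) * h x) =
    (fun x => \sum_(k < n) \sum_(l < n) b k l * (cos ((k%:R - l%:R) * theta x) * h x)).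
  apply/funext => x; rewrite mulr_suml; apply: eq_bigr => k _.
  by rewrite mulr_suml; apply: eq_bigr => l _; rewrite mulrA.
rewrite E; split; first exact: rintegrable_sum.
rewrite (rintegral_sum _ i2); apply: eq_bigr => k _.
rewrite (rintegral_sum _ (i1 k)); apply: eq_bigr => l _.
by rewrite (RintegralZl _ measurableT (phase_rint _ ih)).
Qed.

Variables (g : T -> R) (B : R).
Hypothesis ig : rint mu g.
Hypothesis hB : forall n (a : 'I_n -> R),
  \int[mu]_x (trig_sq a (theta x) * g x) <= B * \sum_(k < n) a k ^+ 2.

Lemma phase_dom_rint (h : T -> R) c : measurable_fun [set: T] h -> (forall x, `|h x| <= c * g x) ->
  rint mu h.
Proof. by move=> mh hg; apply: (rintegrable_le mh hg); exact: rintegrableZ. Qed.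

Lemma toeplitz_form n (a : 'I_n -> R) h : rint mu h ->
  rint mu (fun x => trig_sq a (theta x) * h x) /\
  \sum_(k < n) \sum_(l < n) a k * a l * phase_coef h (k%:R - l%:R) =
  \int[mu]_x (trig_sq a (theta x) * h x).
Proof.
move=> ih; have := phase_double_sum (fun k l => a k * a l) ih.
rewrite (_ : (fun x => trig_sq a (theta x) * h x) =
  (fun x => (\sum_(k < n) \sum_(l < n) a k * a l * cos ((k%:R - l%:R) * theta x)) * h x)).
  by [].
by apply/funext => x; rewrite trig_sqE.
Qed.

(** A bound in operator norm: domination of the symbol h by g passes to the quadratic forms because
    squared trigonometric sums are nonnegative. *)
Lemma toeplitz_form_le n (a : 'I_n -> R) (h : T -> R) c : measurable_fun [set: T] h ->
  0 <= c -> (forall x, `|h x| <= c * g x) ->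
  `|\sum_(k < n) \sum_(l < n) a k * a l * phase_coef h (k%:R - l%:R)| <=
  c * B * \sum_(k < n) a k ^+ 2.
Proof.
move=> mh c0 hg; have ih := phase_dom_rint mh hg.
have [i1 ->] := toeplitz_form a ih; have [i2 _] := toeplitz_form a ig.
apply: (@le_trans _ _ (\int[mu]_x (c * (trig_sq a (theta x) * g x)))).
  apply: rintegral_norm_le; last exact: rintegrableZ.
    by have /measurable_EFinP := measurable_int _ i1.
  move=> x; rewrite normrM (ger0_norm (trig_sq_ge0 _ _)) mulrCA.
  by apply: ler_wpM2l => //; exact: trig_sq_ge0.
rewrite (RintegralZl _ measurableT i2) -mulrA; apply: ler_wpM2l => //; exact: hB.
Qed.

(* Expanding one factor under its integral turns the double sum into two
   Toeplitz forms in the other, at the vectors cos(k theta) and sin(k theta). *)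
Lemma toeplitz_hs n (h1 h2 : T -> R) c : rint mu h1 -> measurable_fun [set: T] h2 ->
  0 <= c -> (forall x, `|h2 x| <= c * g x) ->
  `|\sum_(k < n) \sum_(l < n) phase_coef h2 (k%:R - l%:R) * phase_coef h1 (k%:R - l%:R)| <=
  c * B * n%:R * \int[mu]_x `|h1 x|.
Proof.
move=> i1 m2 c0 hg.
have [i2 ->] := phase_double_sum (fun k l : 'I_n => phase_coef h2 (k%:R - l%:R)) i1.
have i1' : rint mu (fun x => `|h1 x|) by exact: integrable_abse i1.
rewrite -(RintegralZl _ measurableT i1'); apply: rintegral_norm_le.
- by have /measurable_EFinP := measurable_int _ i2.
- move=> x; rewrite normrM; apply: ler_wpM2r => //.
  have -> : \sum_(k < n) \sum_(l < n) phase_coef h2 (k%:R - l%:R) * cos ((k%:R - l%:R) * theta x) =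
    \sum_(k < n) \sum_(l < n) cos (k%:R * theta x) * cos (l%:R * theta x) * phase_coef h2 (k%:R - l%:R) +
    \sum_(k < n) \sum_(l < n) sin (k%:R * theta x) * sin (l%:R * theta x) * phase_coef h2 (k%:R - l%:R).
    rewrite -big_split; apply: eq_bigr => k _; rewrite -big_split; apply: eq_bigr => l _ /=.
    by rewrite mulrBl cosB; ring.
  apply: le_trans (ler_normD _ _) _.
  have h (a : 'I_n -> R) := toeplitz_form_le a m2 c0 hg.
  apply: le_trans (lerD (h (fun k : 'I_n => cos (k%:R * theta x))) (h (fun k : 'I_n => sin (k%:R * theta
    x)))) _.
  rewrite -mulrDr -big_split/= (eq_bigr (fun=> 1)); last by move=> k _; rewrite cos2Dsin2.
  by rewrite sumr_const card_ord.
- exact: rintegrableZ.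
Qed.

End toeplitz.

(** * Cesaro means of Toeplitz sums *)

Section cesaro_toeplitz.
Context {R : realType}.
Variable q : R -> R.
Hypotheses (q0 : forall m, 0 <= q m) (qN : forall m, q (- m) = q m).

Let S m := \sum_(0 <= j < m.+1) q j%:R + \sum_(0 <= j < m) q j.+1%:R.

(** The row and column added in passing from size n to n + 1 contain q j once for each |j| <= n,
    which sums to [S n]. Normalised double sums are thus Cesaro means of symmetric partial sums. *)
Lemma toeplitz_sumE n :
  \sum_(k < n) \sum_(l < n) q (k%:R - l%:R) = \sum_(0 <= m < n) S m.
Proof.
elim: n => [|n IH]; first by rewrite big_ord0 big_nil.
rewrite big_ord_recr big_nat_recr//= -IH.
under eq_bigr do rewrite big_ord_recr/=.
rewrite big_split /= -addrA; congr (_ + _).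
have E : \sum_(i < n) q (n%:R - i%:R) = \sum_(0 <= j < n) q j.+1%:R.
  rewrite big_mkord (reindex_inj rev_ord_inj) /=; apply: eq_bigr => i _.
  by rewrite natrB// opprB addrC subrK.
rewrite big_ord_recr/= subrr E addrC /S big_nat_recl// -addrA addrC -!addrA; congr (_ + _).
have -> : \sum_(i < n) q (i%:R - n%:R) = \sum_(0 <= j < n) q j.+1%:R.
  by rewrite -E; apply: eq_bigr => i _; rewrite -qN opprB.
by rewrite addrC.
Qed.

Lemma series_nneseries (f : nat -> R) (K : R) : (forall j, 0 <= f j) ->
  (forall m, \sum_(0 <= j < m) f j <= K) ->
  exists2 l, \sum_(0 <= j < m) f j @[m --> \oo] --> l & (\sum_(j <oo) (f j)%:E = l%:E)%E.
Proof.
move=> f0 fK.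
have c : \sum_(0 <= j < m) f j @[m --> \oo] --> sup (range (fun m => \sum_(0 <= j < m) f j)).
  apply: nondecreasing_cvgn; last by exists K => _ [m _ <-].
  by move=> m n mn; rewrite (big_cat_nat (leq0n _) mn)//= lerDl; exact: sumr_ge0.
eexists; first exact: c.
apply/cvg_lim => //; under eq_fun do rewrite sumEFin.
by apply: cvg_EFin; first exact: nearW.
Qed.

Lemma esum_int (F : int -> \bar R) : (forall k, (0 <= F k)%E) ->
  (\esum_(k in [set: int]) F k = \sum_(j <oo) F (Posz j) + \sum_(j <oo) F (Negz j))%E.
Proof.
move=> F0; rewrite (esumID (range Posz))//; congr (_ + _)%E.
  rewrite setTI (esum_image setT Posz F); last by move=> ? ? _ _ [].
  by rewrite nneseries_esumT.
rewrite setTI (_ : ~` range Posz = range Negz); last first.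
  apply/seteqP; split => [[k|k]|_ [k _ <-]] /=; [by move=> []; exists k|by exists k|by case].
rewrite (esum_image setT Negz F); last by move=> ? ? _ _ [].
by rewrite nneseries_esumT.
Qed.

(** Summability of q over the integers is a consequence: [S] is nondecreasing, and its averages are
    bounded by K. *)
Lemma toeplitz_cesaro (K : R) : (forall n, \sum_(k < n) \sum_(l < n) q (k%:R - l%:R) <= n%:R * K) ->
  n%:R^-1 * \sum_(k < n) \sum_(l < n) q (k%:R - l%:R) @[n --> \oo] -->
  fine (\esum_(k in [set: int]) (q k%:~R)%:E)%E.
Proof.
move=> hK.
have Smono m n : (m <= n)%N -> S m <= S n.
  move=> mn; rewrite /S lerD//.
    by rewrite (@big_cat_nat _ _ _ m.+1 0 n.+1)//= lerDl; exact: sumr_ge0.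
  by rewrite (big_cat_nat (leq0n _) mn)//= lerDl; exact: sumr_ge0.
have S0 m : 0 <= S m by rewrite addr_ge0// sumr_ge0.
(* The m + 1 terms [S i] with m < i <= 2 m + 1 are all at least [S m], and their sum is at most (2 m
   + 2) K. *)
have SK m : S m <= 2 * K.
  have h : m.+1%:R * S m <= (m.+1 + m.+1)%:R * K.
    apply: le_trans (hK _); rewrite toeplitz_sumE (@big_cat_nat _ _ _ m.+1)//=; last exact: leq_addr.
    rewrite ler_wpDl ?sumr_ge0// mulr_natl.
    rewrite (_ : S m *+ m.+1 = \sum_(m.+1 <= i < m.+1 + m.+1) S m); last by rewrite sumr_const_nat addnK.
    rewrite ler_sum_nat// => i /andP[mi _]; apply: Smono; exact: ltnW.
  have m0 : 0 < m.+1%:R :> R by rewrite ltr0n.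
  by rewrite -(ler_pM2l m0); apply: le_trans h _; rewrite natrD le_eqVlt; apply/orP; left; apply/eqP; ring.
have A1 : forall m, \sum_(0 <= j < m) q j%:R <= 2 * K.
  move=> m; apply: le_trans (SK m); rewrite /S big_nat_recr//= -addrA lerDl addr_ge0// sumr_ge0//.
have A2 : forall m, \sum_(0 <= j < m) q j.+1%:R <= 2 * K.
  by move=> m; apply: le_trans (SK m); rewrite /S lerDr sumr_ge0.
have [l1 c1 e1] := series_nneseries (fun j => q0 j%:R) A1.
have [l2 c2 e2] := series_nneseries (fun j => q0 j.+1%:R) A2.
have -> : (\esum_(k in [set: int]) (q k%:~R)%:E = (l1 + l2)%:E)%E.
  rewrite esum_int; last by move=> k; rewrite lee_fin.
  rewrite EFinD -e1 -e2; congr (_ + _)%E; apply: eq_eseriesr => j _; congr EFin.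
  by rewrite NegzE mulrNz qN.
have cS : S m @[m --> \oo] --> l1 + l2.
  by apply: cvgD => //; move: c1; rewrite -(@cvg_shiftS _ _ (nbhs l1)).
(* [arithmetic_mean] at n averages the first n + 1 terms, hence the shift by one. *)
have := cesaro cS; rewrite /arithmetic_mean /series /= => H.
rewrite -(@cvg_shiftS _ _ (nbhs (l1 + l2))) /=.
by under eq_fun do rewrite toeplitz_sumE.
Qed.

End cesaro_toeplitz.

(** * Gaussian random variables *)

Section gaussian_law.
Context {R : realType}.
Local Notation leb := (@lebesgue_measure R).
Local Notation gamma := (@stdnormal R).

Lemma normal_pdf_scale (s z : R) : 0 < s ->
  normal_pdf 0 1 z = s * normal_pdf 0 s (s * z).
Proof.
move=> s0; have s1 : s != 0 by rewrite gt_eqF.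
rewrite !normal_pdfE ?oner_eq0// mulrA; congr (_ * _).
  rewrite /normal_peak expr1n mul1r -[s ^+ 2 * pi *+ 2]mulrnAr sqrtrM ?sqr_ge0//.
  by rewrite sqrtr_sqr gtr0_norm// invfM mulrA divff// mul1r.
rewrite /normal_fun !subr0 exprMn expr1n; congr expR.
by rewrite -[s ^+ 2 *+ 2]mulr_natr; field.
Qed.

(** Reading N(0, v) as the law of sqrt v Z covers the Dirac mass at v = 0 and the density case by
    one formula. *)
Lemma ge0_integral_gaussian (v : R) (f : R -> \bar R) : 0 <= v ->
  measurable_fun [set: R] f -> (forall x, (0 <= f x)%E) ->
  (\int[gaussian_prob 0 v]_x f x = \int[gamma]_z f (Num.sqrt v * z)%R)%E.
Proof.
move=> v0 mf f0; rewrite /gaussian_prob; have [v1|v1] := eqVneq v 0.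
  rewrite integral_dirac// diracE mem_set// mul1e v1 sqrtr0.
  under [RHS]eq_integral do rewrite mul0r.
  by rewrite integral_cst//= probability_setT mule1.
have s0 : 0 < Num.sqrt v by rewrite sqrtr_gt0 lt_neqAle eq_sym v1.
have s1 : Num.sqrt v != 0 by rewrite gt_eqF.
have mfs : measurable_fun [set: R] (fun z : R => f (Num.sqrt v * z)).
  by apply: (measurableT_comp mf); exact: measurable_funM.
rewrite (ge0_integral_stdnormal mfs (fun z => f0 _)).
have mpdf := @measurable_normal_pdf R 0 (Num.sqrt v).
have pdf0 := @normal_pdf_ge0 R 0 (Num.sqrt v).
have -> : (\int[normal_prob 0 (Num.sqrt v)]_x f x =
    \int[leb]_x (f x * (normal_pdf 0 (Num.sqrt v) x)%:E))%E.
  exact: (@ge0_integral_density _ _ _ leb (normal_prob 0 (Num.sqrt v))).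
pose F x := (f x * (normal_pdf 0 (Num.sqrt v) x)%:E)%E.
have mF : measurable_fun [set: R] F by apply: emeasurable_funM => //; exact/measurable_EFinP.
have F0 x : (0 <= F x)%E by rewrite mule_ge0// lee_fin.
have := ge0_integral_affine 0 s1 mF F0; rewrite (gtr0_norm s0) => H.
transitivity ((Num.sqrt v)%:E * (((Num.sqrt v)^-1)%:E * \int[leb]_x F x))%E.
  by rewrite muleA -EFinM divff// mul1e.
rewrite -H -(@ge0_integralZl _ _ R leb _ measurableT).
- apply: eq_integral => z _; rewrite addr0 (normal_pdf_scale z s0) EFinM muleA /F muleC.
  by rewrite muleC -muleA muleCA.
- by apply: (measurableT_comp mF); apply: measurable_funD => //; exact: measurable_funM.
- by move=> x _; exact: F0.
- by rewrite lee_fin ltW.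
Qed.

Context {d : measure_display} {T : measurableType d} (P : probability T R).
Variables (L : T -> R) (v : R).
Hypotheses (v0 : 0 <= v) (mL : measurable_fun [set: T] L).
Hypothesis Lv : forall A : set R, measurable A -> P [set w | A (L w)] = gaussian_prob 0 v A.

Lemma ge0_gaussian_expectation (f : R -> \bar R) :
  measurable_fun [set: R] f -> (forall x, (0 <= f x)%E) ->
  (\int[P]_w f (L w) = \int[gamma]_z f (Num.sqrt v * z)%R)%E.
Proof.
move=> mf f0; rewrite -ge0_integral_gaussian//.
have mL' : measurable_fun [set: T] (L : T -> measurableTypeR R) by [].
pose m := measure_function_pushforward__canonical__measure_function_Measure P mL'.
transitivity (\int[m]_x f x)%E.
  by rewrite (@ge0_integral_pushforward _ _ _ _ R _ mL' P setT f) //= preimage_setT.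
by apply: eq_measure_integral => A mA _; exact: Lv.
Qed.

Lemma gaussian_expectation (f : R -> R) (M : R) : measurable_fun [set: R] f ->
  (forall x, `|f x| <= M) ->
  \int[P]_w f (L w) = \int[gamma]_z f (Num.sqrt v * z).
Proof.
move=> mf fM.
have i1 : rint P (fun w => f (L w)).
  by apply: (@rintegrable_bounded _ _ _ _ _ M) => //; exact: measurableT_comp.
have i2 : rint gamma (fun z : R => f (Num.sqrt v * z)).
  apply: (@rintegrable_bounded _ _ _ _ _ M) => //.
  by apply: (measurableT_comp mf); exact: measurable_funM.
have e1 : \int[P]_w (f (L w) + M) = \int[P]_w f (L w) + M.
  rewrite (RintegralD measurableT i1 (finite_measure_integrable_cst P M measurableT)).
  by rewrite rintegral_cst.
have e2 : \int[gamma]_z (f (Num.sqrt v * z) + M) = \int[gamma]_z f (Num.sqrt v * z) + M.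
  rewrite (RintegralD measurableT i2 (finite_measure_integrable_cst gamma M measurableT)).
  by rewrite rintegral_cst.
apply: (addIr M); rewrite -e1 -e2 /Rintegral.
congr fine; apply: (ge0_gaussian_expectation (f := fun y => (f y + M)%:E)).
  by apply/measurable_EFinP; exact: measurable_funD.
by move=> x; rewrite lee_fin -lerBlDr sub0r; have := fM x; rewrite ler_norml => /andP[].
Qed.

Lemma gaussian_cos : \int[P]_w cos (L w) = expR (- (v / 2)).
Proof.
rewrite (@gaussian_expectation (@cos R) 1) => [|//|x]; last 2 first.
- by apply: continuous_measurable_fun; exact: continuous_cos.
- exact: cos_max.
by rewrite stdnormal_cos sqr_sqrtr.
Qed.

(** [centered_gaussian] asserts only that some variance exists; this recovers it as a second
    moment. *)
Lemma gaussian_variance : rint P (fun w => L w ^+ 2) /\ \int[P]_w L w ^+ 2 = v.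
Proof.
have m2 : measurable_fun [set: R] (fun y => (y ^+ 2)%:E).
  by apply/measurable_EFinP; exact: measurable_funX.
have i2 := @stdnormal_rintegrableX R 2 isT.
have E : (\int[P]_w (L w ^+ 2)%:E = v%:E)%E.
  rewrite (ge0_gaussian_expectation m2); last by move=> x; rewrite lee_fin sqr_ge0.
  under eq_integral do rewrite exprMn sqr_sqrtr//.
  rewrite -(rintegral_EFin (rintegrableZ v i2)) (RintegralZl _ measurableT i2).
  by rewrite stdnormal_variance mulr1.
split; last by rewrite /Rintegral E.
apply: ge0_rintegral_EFin.
- by apply: measurable_funX.
- by move=> w; exact: sqr_ge0.
- by rewrite E ltry.
Qed.

End gaussian_law.

(** * Covariance of the increments *)

Section wave_covariance.
Context {R : realType} {d : nat}.
Local Notation vol := (lebesgue_rV R d).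
Local Notation leb := (@lebesgue_measure R).
Variables (beta theta t : R).
Hypotheses (beta0 : 0 < beta) (beta2 : beta < 2) (betad : beta < d%:R).
Hypotheses (theta0 : 0 < theta) (t0 : 0 < t).

Definition wave_kernel (r : R) (x : 'rV[R]_d) : R :=
  sin ((t - r) * Num.sqrt theta * enorm x) / (Num.sqrt theta * enorm x) *
  (sin ((t - r) * Num.sqrt theta * enorm x) / (Num.sqrt theta * enorm x)) *
  enorm x `^ (beta - d%:R).

(** The spectral density of the spatially stationary field u(t, .). *)
Definition wave_density (x : 'rV[R]_d) : R :=
  (2 * pi) ^- d * \int[leb]_(r in `[0, t]) wave_kernel r x.

Lemma wave_kernel_ge0 r x : 0 <= wave_kernel r x.
Proof. by rewrite /wave_kernel mulr_ge0 ?powR_ge0// -expr2 sqr_ge0. Qed.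

Lemma measurable_wave_kernel :
  measurable_fun [set: R * 'rV[R]_d] (fun z => wave_kernel z.1 z.2).
Proof.
have me (q : R) : measurable_fun [set: R * 'rV[R]_d] (fun z => enorm z.2 `^ q).
  exact: (measurableT_comp (measurable_enorm_powR q) measurable_snd).
have me1 : measurable_fun [set: R * 'rV[R]_d] (fun z => enorm z.2).
  exact: (measurableT_comp measurable_enorm measurable_snd).
have mq : measurable_fun [set: R * 'rV[R]_d]
    (fun z => sin ((t - z.1) * Num.sqrt theta * enorm z.2) / (Num.sqrt theta * enorm z.2)).
  apply: measurable_funM.
    apply: measurableT_comp; first by apply: continuous_measurable_fun; exact: continuous_sin.
    apply: measurable_funM => //; apply: measurable_funM => //.
    by apply: measurable_funB => //; exact: measurable_fst.
  rewrite (_ : (fun z => _) = (fun z => (Num.sqrt theta)^-1 * enorm z.2 `^ (-1))).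
    by apply: measurable_funM.
  by apply/funext => z; rewrite powR_inv1 ?enorm_ge0// invfM.
by apply: measurable_funM => //; exact: measurable_funM.
Qed.

Lemma enorm_powRB (x : 'rV[R]_d) : enorm x != 0 ->
  enorm x `^ (beta - d%:R) = enorm x ^+ 2 * enorm x `^ (beta - d%:R - 2).
Proof.
move=> x0; rewrite -(@powR_mulrn R _ 2) ?enorm_ge0// -powRD; first by congr (_ `^ _); ring.
by rewrite x0 implybT.
Qed.

(** The inequality |sin s| <= |s| gives the bound that is good near the origin, |sin s| <= 1 the one
    that is good at infinity. *)
Lemma wave_kernel_le r x : 0 <= r <= t ->
  wave_kernel r x <= Num.min (t ^+ 2 * enorm x `^ (beta - d%:R)) (theta^-1 * enorm x `^ (beta - d%:R - 2)).
Proof.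
move=> /andP[r0 rt]; rewrite /wave_kernel.
have [x0|x0] := eqVneq (enorm x) 0.
  by rewrite x0 !mulr0 !invr0 !mulr0 mul0r le_min; apply/andP; split;
    rewrite mulr_ge0 ?powR_ge0 ?sqr_ge0 ?invr_ge0// ltW.
have xp : 0 < enorm x by rewrite lt_neqAle eq_sym x0 enorm_ge0.
have q0 : 0 < Num.sqrt theta by rewrite sqrtr_gt0.
rewrite le_min; apply/andP; split.
  rewrite ler_wpM2r ?powR_ge0// -expr2 -real_normK ?num_real//.
  apply: lerXn2r; rewrite ?nnegrE//; first exact: ltW.
  rewrite normrM normfV (gtr0_norm (mulr_gt0 q0 xp)).
  rewrite ler_pdivrMr ?mulr_gt0//; apply: le_trans (normr_sin_le _) _.
  rewrite -mulrA normrM (gtr0_norm (mulr_gt0 q0 xp)).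
  apply: ler_wpM2r; first by apply: mulr_ge0; exact: ltW.
  by rewrite ger0_norm ?subr_ge0//; lra.
rewrite (enorm_powRB x0) mulrA ler_wpM2r ?powR_ge0//.
set s := sin _; have s1 : s ^+ 2 <= 1.
  by rewrite sin2cos2 lerBlDr lerDl sqr_ge0.
have -> : s / (Num.sqrt theta * enorm x) * (s / (Num.sqrt theta * enorm x)) * enorm x ^+ 2 =
    s ^+ 2 / (Num.sqrt theta ^+ 2) by field; rewrite x0 gt_eqF.
by rewrite (sqr_sqrtr (ltW theta0)) ler_pdivrMr// mulVf ?gt_eqF.
Qed.

Lemma Rintegral_sin_sq (k : R) : k != 0 ->
  \int[leb]_(r in `[0, t]) (sin ((t - r) * k) / k * (sin ((t - r) * k) / k)) =
  (t / 2 - sin (2 * t * k) / (4 * k)) / k ^+ 2.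
Proof.
move=> k0.
(* A primitive in r, from sin^2 y = (1 - cos(2 y))/2. *)
pose F (r : R) := (r / 2 + sin (2 * (t - r) * k) / (4 * k)) / k ^+ 2.
have dF (r : R) : is_derive r 1 F (sin ((t - r) * k) / k * (sin ((t - r) * k) / k)).
  apply: is_derive_eq; rewrite /GRing.scale/=.
  rewrite (_ : 2 * (t - r) * k = (t - r) * k + (t - r) * k); last by ring.
  have := cos2Dsin2 ((t - r) * k); rewrite cosD; move: (cos _) (sin _) => c s cs.
  by have -> : c * c = 1 - s * s by [lra|rewrite -cs; ring]; field.
have cF : continuous F.
  by move=> x; apply/differentiable_continuous/derivable1_diffP; apply: ex_derive.
rewrite /Rintegral (@continuous_FTC2 R _ F 0 t)//.
- rewrite -EFinB /= /F subrr mulr0 mul0r sin0 subr0.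
  by field.
- apply: continuous_subspaceT => x; apply/differentiable_continuous/derivable1_diffP.
  by apply: ex_derive.
- split.
  + by move=> x _; apply: ex_derive.
  + by apply: cvg_at_right_filter; exact: cF.
  + by apply: cvg_at_left_filter; exact: cF.
- by move=> x _; rewrite derive1E; exact: derive_val.
Qed.

Lemma wave_kernel_integrable x :
  leb.-integrable `[0, t] (EFin \o (fun r => wave_kernel r x)).
Proof.
apply: continuous_compact_integrable; first exact: segment_compact.
apply: continuous_subspaceT => r; apply/differentiable_continuous/derivable1_diffP.
rewrite /wave_kernel; exact: ex_derive.
Qed.

Lemma lebesgue_interval : leb `[0, t]%classic = t%:E.
Proof. by rewrite lebesgue_measure_itv/= lte_fin t0 -EFinB subr0. Qed.

Lemma wave_density_ge0 x : 0 <= wave_density x.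
Proof.
rewrite mulr_ge0 ?invr_ge0 ?exprn_ge0 ?mulr_ge0 ?pi_ge0//.
by apply: Rintegral_ge0 => r _; exact: wave_kernel_ge0.
Qed.

(** The closed form separates t/2, which survives as the mesh shrinks, from an oscillating term of
    order 1/|x|. At the origin both sides are 0 by the conventions for the inverse and the powers of
    0. *)
Lemma wave_densityE x : wave_density x = (2 * pi) ^- d / theta *
  (t / 2 - sin (2 * t * (Num.sqrt theta * enorm x)) / (4 * (Num.sqrt theta * enorm x))) *
  enorm x `^ (beta - d%:R - 2).
Proof.
rewrite /wave_density /wave_kernel; have [x0|x0] := eqVneq (enorm x) 0.
  under eq_Rintegral do rewrite x0 !mulr0 invr0 !mulr0 mul0r.
  rewrite x0 /Rintegral integral0 powR0 ?mulr0//.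
  by apply/eqP => ?; have := betad; lra.
have xp : 0 < enorm x by rewrite lt_neqAle eq_sym x0 enorm_ge0.
have q0 : 0 < Num.sqrt theta by rewrite sqrtr_gt0.
have k0 : Num.sqrt theta * enorm x != 0 by rewrite mulf_neq0 ?gt_eqF.
under eq_Rintegral do rewrite mulrC -[(t - _) * _ * _]mulrA.
rewrite RintegralZl//; last first.
  apply: continuous_compact_integrable; first exact: segment_compact.
  apply: continuous_subspaceT => r; apply/differentiable_continuous/derivable1_diffP.
  exact: ex_derive.
rewrite (Rintegral_sin_sq k0) (enorm_powRB x0) [(Num.sqrt theta * _) ^+ 2]exprMn (sqr_sqrtr (ltW theta0)).
set p := _ `^ _; set D := t / 2 - _; move: p D => p D; field.
by rewrite x0 gt_eqF// expf_neq0// mulf_neq0 ?pnatr_eq0// gt_eqF// pi_gt0.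
Qed.

Let W (x : 'rV[R]_d) := Num.min (t ^+ 2 * enorm x `^ (beta - d%:R)) (theta^-1 * enorm x `^ (beta - d%:R
  - 2)) : R.

Let W0 x : 0 <= W x.
Proof.
rewrite /W le_min; apply/andP; split; rewrite mulr_ge0 ?powR_ge0 ?sqr_ge0 ?invr_ge0//; exact: ltW.
Qed.

Let iW : rint vol W.
Proof. by apply: riesz_min_rint => //; [exact: sqr_ge0|rewrite invr_ge0 ltW]. Qed.

Let I (r : R) : R := \1_`[0, t]%classic r.

Let I0 r : 0 <= I r.
Proof. by rewrite /I indicE. Qed.

Let iI : rint leb I.
Proof.
apply: ge0_rintegral_EFin.
- by apply: measurable_indic; exact: measurable_itv.
- exact: I0.
- rewrite /I (@integral_indic _ _ R leb _ measurableT _ (measurable_itv _)) setIT.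
  exact: (eq_ind_r (fun y => (y < +oo)%E) (ltry t) lebesgue_interval).
Qed.

Let dom r x : `|I r * wave_kernel r x| <= I r * W x.
Proof.
rewrite ger0_norm; last by rewrite mulr_ge0// wave_kernel_ge0.
rewrite /I indicE; have [h|_] := boolP (r \in _); last by rewrite !mul0r.
by rewrite !mul1r; apply: wave_kernel_le; move: h; rewrite inE/= in_itv.
Qed.

Lemma wave_density_rint : rint vol wave_density.
Proof.
have mden : measurable_fun [set: 'rV[R]_d] wave_density.
  rewrite (funext wave_densityE).
  have mk : measurable_fun [set: 'rV[R]_d] (fun x => Num.sqrt theta * enorm x).
    by apply: measurable_funM => //; exact: measurable_enorm.
  apply: measurable_funM; last exact: measurable_enorm_powR.
  apply: measurable_funM => //; apply: measurable_funB => //.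
  rewrite (_ : (fun x => _) = (fun x => sin (2 * t * (Num.sqrt theta * enorm x)) *
      (4 * (Num.sqrt theta * enorm x)) `^ (-1))).
    apply: measurable_funM.
      apply: measurableT_comp; first by apply: continuous_measurable_fun; exact: continuous_sin.
      exact: measurable_funM.
    by apply: (measurableT_comp (measurable_powR _)); exact: measurable_funM.
  by apply/funext => x; rewrite powR_inv1 ?mulr_ge0 ?enorm_ge0 ?sqrtr_ge0.
apply: (@rintegrable_le _ _ _ _ _ (fun x => (2 * pi) ^- d * t * W x)) => //.
  move=> x; rewrite ger0_norm ?wave_density_ge0// /wave_density -mulrA ler_wpM2l//.
    by rewrite invr_ge0 exprn_ge0// mulr_ge0// pi_ge0.
  have it : leb.-integrable `[0, t] (EFin \o (fun _ : R => W x)).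
    apply: continuous_compact_integrable; first exact: segment_compact.
    by apply: continuous_subspaceT => r; exact: cst_continuous.
  apply: (@le_trans _ _ (\int[leb]_(r in `[0, t]) W x)).
    apply: le_Rintegral; [exact: measurable_itv|exact: wave_kernel_integrable|exact: it|].
    by move=> r; rewrite /= in_itv/= => h; exact: wave_kernel_le.
  rewrite (@Rintegral_cst _ _ R leb _ (measurable_itv _)) mulrC.
  have h : fine (leb `[0, t]%classic) <= t by rewrite lebesgue_interval.
  by apply: ler_wpM2r => //; exact: h.
exact: rintegrableZ.
Qed.

(** The covariance has its frequency integral inside the time integral; exchanging them makes it a
    cosine transform of one density. The time interval enters as an indicator, so that the majorant
    is a product. *)
Lemma wave_fubini (theta1 : 'rV[R]_d -> R) m : measurable_fun [set: 'rV[R]_d] theta1 ->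
  (2 * pi) ^- d * \int[leb]_(r in `[0, t]) \int[vol]_x (cos (m * theta1 x) * wave_kernel r x) =
  phase_coef vol theta1 wave_density m.
Proof.
move=> mt; pose f (z : R * 'rV[R]_d) := cos (m * theta1 z.2) * (I z.1 * wave_kernel z.1 z.2).
have mphase := measurable_phase mt m.
have mf : measurable_fun [set: R * 'rV[R]_d] f.
  apply: measurable_funM; first exact: (measurableT_comp mphase measurable_snd).
  apply: measurable_funM; last exact: measurable_wave_kernel.
  apply: (measurableT_comp _ measurable_fst); apply: measurable_indic; exact: measurable_itv.
have fIW r x : `|f (r, x)| <= I r * W x.
  rewrite normrM -[leRHS]mul1r; apply: ler_pM => //; exact: cos_max.
have := @rintegral_fubini_dom _ _ _ _ R leb vol f I W mf fIW iI iW I0 W0.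
have -> : \int[leb]_r \int[vol]_x f (r, x) =
    \int[leb]_(r in `[0, t]) \int[vol]_x (cos (m * theta1 x) * wave_kernel r x).
  rewrite [RHS]Rintegral_mkcond; apply: eq_Rintegral => r _; rewrite patchE /f /I /=.
  rewrite indicE; case: ifP => h.
    by apply: eq_Rintegral => x _; rewrite mul1r.
  by under eq_Rintegral do rewrite mul0r mulr0; rewrite /Rintegral integral0.
move=> ->.
have iD x : rint leb (fun r => I r * wave_kernel r x).
  apply: (@rintegrable_le _ _ R leb _ (fun r => W x * I r)).
  - apply: measurable_funM; first by apply: measurable_indic; exact: measurable_itv.
    exact: (measurableT_comp measurable_wave_kernel (pair2_measurable x)).
  - by move=> r; rewrite [leRHS]mulrC; exact: dom.
  - exact: rintegrableZ.
have E x : \int[leb]_r f (r, x) = cos (m * theta1 x) * \int[leb]_(r in `[0, t]) wave_kernel r x.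
  rewrite /f /= (RintegralZl _ measurableT (iD x)); congr (_ * _).
  rewrite [RHS]Rintegral_mkcond; apply: eq_Rintegral => r _; rewrite patchE /I indicE.
  by case: ifP => h; rewrite ?mul1r ?mul0r.
under eq_Rintegral do rewrite E.
rewrite /phase_coef -RintegralZl//; last first.
  apply: (@rintegrable_le _ _ _ _ _ (fun x => (2 * pi) ^+ d * wave_density x)); last 2 first.
  - move=> x; rewrite normrM -[leRHS]mul1r; apply: ler_pM => //; first exact: cos_max.
    rewrite /wave_density mulrA divff ?mul1r ?expf_neq0 ?mulf_neq0 ?gt_eqF ?pi_gt0//.
    rewrite ger0_norm//; apply: Rintegral_ge0 => r _; exact: wave_kernel_ge0.
  - by apply: rintegrableZ; exact: wave_density_rint.
  apply: measurable_funM => //.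
  rewrite (_ : (fun x => _) = (fun x => (2 * pi) ^+ d * wave_density x)).
    apply: measurable_funM => //; have := measurable_int _ wave_density_rint.
    by move/measurable_EFinP.
  apply/funext => x; rewrite /wave_density mulrA divff ?mul1r ?expf_neq0 ?mulf_neq0 ?gt_eqF ?pi_gt0//.
by apply: eq_Rintegral => x _; rewrite /wave_density mulrCA.
Qed.

End wave_covariance.

(** * Second differences *)

Section second_difference.
Context {R : realType}.

(** The transposed second difference: it carries weights on n increments to weights on the n + 2
    field values. *)
Definition second_diff n (a : 'I_n -> R) (j : 'I_n.+2) : R :=
  \sum_(k < n) a k * (((j == k.+2 :> nat)%:R + (j == k :> nat)%:R) - 2 * (j == k.+1 :> nat)%:R).

Lemma sum_second_diff n (a : 'I_n -> R) (F : nat -> R) :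
  \sum_(j < n.+2) second_diff a j * F j =
  \sum_(k < n) a k * (F k.+2 + F k - 2 * F k.+1).
Proof.
have pick (m : nat) : (m < n.+2)%N -> \sum_(j < n.+2) (j == m :> nat)%:R * F j = F m.
  move=> mn; rewrite (bigD1 (Ordinal mn))//= eqxx mul1r big1 ?addr0// => j jm.
  by rewrite -(inj_eq val_inj)/= in jm; rewrite (negbTE jm) mul0r.
under eq_bigr do rewrite mulr_suml; rewrite exchange_big; apply: eq_bigr => k _ /=.
have kn := ltn_ord k.
rewrite -(pick k.+2 kn) -(pick k (leqW (leqW kn))) -(pick k.+1 (ltnW kn)).
rewrite mulr_sumr -big_split/= -sumrB mulr_sumr; apply: eq_bigr => j _.
by ring.
Qed.

(** Differencing multiplies the trigonometric polynomial by exp(2is) - 2 exp(is) + 1 = 2 (cos s - 1)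
    exp(is), whose squared modulus is 16 sin^4(s/2). [E1] and [E2] are the real and imaginary parts
    of one summand. *)
Lemma trig_sq_second_diff n (a : 'I_n -> R) s :
  trig_sq (second_diff a) s = 16 * sin (s / 2) ^+ 4 * trig_sq a s.
Proof.
rewrite /trig_sq (sum_second_diff a (fun k => cos (k%:R * s))) (sum_second_diff a (fun k => sin (k%:R * s))).
have E1 (k : 'I_n) : a k * (cos (k.+2%:R * s) + cos (k%:R * s) - 2 * cos (k.+1%:R * s)) =
    2 * (cos s - 1) * (cos s * (a k * cos (k%:R * s)) - sin s * (a k * sin (k%:R * s))).
  rewrite -(natr1 k.+1) -(natr1 k) !mulrDl !mul1r !cosD !sinD.
  have := cos2Dsin2 s; move: (cos (k%:R * s)) (sin (k%:R * s)) (cos s) (sin s) => x y c q cs.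
  apply/eqP; rewrite -subr_eq0; apply/eqP.
  by transitivity (a k * x * (1 - (c ^+ 2 + q ^+ 2))); [ring|rewrite cs subrr mulr0].
have E2 (k : 'I_n) : a k * (sin (k.+2%:R * s) + sin (k%:R * s) - 2 * sin (k.+1%:R * s)) =
    2 * (cos s - 1) * (sin s * (a k * cos (k%:R * s)) + cos s * (a k * sin (k%:R * s))).
  rewrite -(natr1 k.+1) -(natr1 k) !mulrDl !mul1r !sinD !cosD.
  have := cos2Dsin2 s; move: (cos (k%:R * s)) (sin (k%:R * s)) (cos s) (sin s) => x y c q cs.
  apply/eqP; rewrite -subr_eq0; apply/eqP.
  by transitivity (a k * y * (1 - (c ^+ 2 + q ^+ 2))); [ring|rewrite cs subrr mulr0].
rewrite (eq_bigr _ (fun k _ => E1 k)) [in X in _ + X](eq_bigr _ (fun k _ => E2 k)).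
rewrite -!mulr_sumr sumrB big_split /= -!mulr_sumr.
set C := \sum_(i < n) _; set S := \sum_(i < n) _.
have h : 1 - cos s = 2 * sin (s / 2) ^+ 2.
  have -> : s = s / 2 + s / 2 by field.
  rewrite cosD (_ : (s / 2 + s / 2) / 2 = s / 2); last by field.
  have := cos2Dsin2 (s / 2); rewrite !expr2; lra.
have -> : 16 * sin (s / 2) ^+ 4 = 4 * (1 - cos s) ^+ 2 by rewrite h; ring.
have := cos2Dsin2 s; move: (cos s) (sin s) => c q cs.
rewrite -[in RHS](mul1r (_ + _)) -cs; ring.
Qed.

End second_difference.

Lemma rintegral_rV_scale {R : realType} n (c : R) (f : 'rV[R]_n -> R) : 0 < c ->
  rint (lebesgue_rV R n) f -> (forall x, 0 <= f x) ->
  rint (lebesgue_rV R n) (fun x => f (c *: x)) /\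
  \int[lebesgue_rV R n]_x f (c *: x) = c ^- n * \int[lebesgue_rV R n]_x f x.
Proof.
move=> c0 iF f0.
have mF := measurable_int _ iF; have mf : measurable_fun [set: 'rV[R]_n] f by move/measurable_EFinP : mF.
have := @ge0_integral_rV_affine R n c 0 (EFin \o f) (lt0r_neq0 c0) mF f0.
rewrite (gtr0_norm c0) => E.
have E1 : (\int[lebesgue_rV R n]_x (f (c *: x))%:E = (c ^- n * \int[lebesgue_rV R n]_x f x)%:E)%E.
  rewrite EFinM (rintegral_EFin iF) -E; apply: eq_integral => x _ /=.
  by rewrite addr0.
split; last by rewrite /Rintegral E1.
apply: ge0_rintegral_EFin => //; last by rewrite E1 ltry.
apply: (measurableT_comp mf); apply: measurable_fun_rV => i.
rewrite (_ : (fun x => _) = (fun x : 'rV[R]_n => c * x ord0 i)).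
  by apply: measurable_funM => //; exact: measurable_coord.
by apply/funext => x; rewrite mxE.
Qed.

Section wave_increments.
Context {R : realType} {dim : nat}.
Context {disp : measure_display} {Omega : measurableType disp}.
Variables (P : probability Omega R) (u : R -> 'rV[R]_dim -> {RV P >-> R}).
Variables (beta theta t : R) (rho : 'rV[R]_dim) (lam : R).
Hypotheses (beta0 : 0 < beta) (beta2 : beta < 2) (betad : beta < dim%:R).
Hypotheses (theta0 : 0 < theta) (t0 : 0 < t) (lam0 : 0 < lam).
Hypothesis solu : wave_solution beta theta u.
Local Notation vol := (lebesgue_rV R dim).
Local Notation phase := (fun x : 'rV[R]_dim => lam * dot rho x).

Lemma measurable_scaled_phase : measurable_fun [set: 'rV[R]_dim] phase.
Proof. by apply: measurable_funM => //; exact: measurable_dot. Qed.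

(** Observation points differ by (i - j) lambda rho, so at a fixed time the covariance is of
    Toeplitz form, and the real part of the exponential is the cosine in [phase_coef]. *)
Lemma Re_wave_cov (i j : nat) :
  complex.Re (wave_cov beta theta t (obs lam rho i) t (obs lam rho j)) =
  phase_coef vol phase (wave_density beta theta t) (i%:R - j%:R).
Proof.
rewrite -wave_fubini//; last exact: measurable_scaled_phase.
rewrite /wave_cov /Cintegral /= minxx mul0r subr0; congr (_ * _).
apply: eq_Rintegral => r _ /=; apply: eq_Rintegral => x _ /=.
rewrite mulr0 subr0 /wave_kernel; congr (cos _ * _).
by rewrite /obs -scalerBl dotZl; ring.
Qed.

Lemma rv_gaussian_sq (x : 'rV[R]_dim) : rint P (fun w => u t x w ^+ 2).
Proof.
have [v v0 hv] := solu.1 1 (fun=> (t, x)) (fun=> 1) (fun _ => ltW t0).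
have hx (A : set R) : measurable A -> P [set w | A (u t x w)] = gaussian_prob 0 v A.
  by move=> mA; rewrite -hv//; congr (P _); apply/funext => w /=; rewrite big_ord1 mul1r.
by have [h _] := gaussian_variance v0 (measurable_funPT (u t x)) hx.
Qed.

(** The Gaussian hypothesis provides an unspecified variance v'. It is found as a second moment by
    expanding the square; products of field values are integrable since |p q| <= p^2 + q^2. *)
Lemma wave_combination_gaussian N (b : 'I_N -> R) :
  let L w := \sum_(j < N) b j * u t (obs lam rho j) w in
  let v := \int[vol]_x (trig_sq b (phase x) * wave_density beta theta t x) in
  0 <= v /\ forall A : set R, measurable A -> P [set w | A (L w)] = gaussian_prob 0 v A.
Proof.
move=> L v.
have [v' v'0 hv] := solu.1 N (fun j => (t, obs lam rho j)) b (fun _ => ltW t0).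
suff -> : v = v' by split.
have mu_ x : measurable_fun [set: Omega] (u t x) by exact: measurable_funPT.
have mL : measurable_fun [set: Omega] L.
  by apply: measurable_sum => j; exact: measurable_funM.
have [_ vE] := gaussian_variance v'0 mL hv; rewrite -vE => {vE}.
have iu (x y : 'rV[R]_dim) : rint P (fun w => u t x w * u t y w).
  apply: (@rintegrable_le _ _ _ _ _ (fun w => u t x w ^+ 2 + u t y w ^+ 2)).
  - exact: measurable_funM.
  - move=> w; rewrite normrM -(real_normK (num_real (u t x w))) -(real_normK (num_real (u t y w))).
    move: `|u t x w| `|u t y w| (normr_ge0 (u t x w)) (normr_ge0 (u t y w)) => p q p0 q0; nra.
  - by apply: rintegrableD; exact: rv_gaussian_sq.
have E (i j : 'I_N) : \int[P]_w (u t (obs lam rho i) w * u t (obs lam rho j) w) =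
    phase_coef vol phase (wave_density beta theta t) (i%:R - j%:R).
  rewrite -Re_wave_cov -(solu.2 t t _ _ (ltW t0) (ltW t0)) /=.
  by rewrite expectation.unlock.
have iD := wave_density_rint beta0 beta2 betad theta0 t0.
have [_ HE] := toeplitz_form measurable_scaled_phase b iD.
rewrite /v -HE; transitivity (\int[P]_w (\sum_(i < N) \sum_(j < N) b i * b j * (u t (obs lam rho i) w *
  u t (obs lam rho j) w))).
  rewrite rintegral_sum; last by move=> i; apply: rintegrable_sum => j; exact: rintegrableZ.
  apply: eq_bigr => i _; rewrite rintegral_sum; last by move=> j; exact: rintegrableZ.
  by apply: eq_bigr => j _; rewrite RintegralZl// E.
apply: eq_Rintegral => w _; rewrite /L expr2 mulr_suml; apply: eq_bigr => i _.
by rewrite mulr_sumr; apply: eq_bigr => j _; ring.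
Qed.

(** The density of the increments in the variable omega = lambda xi, with its power of lambda taken
    out. Differencing contributes 16 sin^4, and off the origin the last factor tends to t/2 as
    lambda tends to 0. *)
Definition spatial_density (x : 'rV[R]_dim) : R :=
  16 / ((2 * pi) ^+ dim * theta) * g_sp beta rho x *
  (t / 2 - sin (2 * t * (Num.sqrt theta * (lam^-1 * enorm x))) / (4 * (Num.sqrt theta * (lam^-1 * enorm x)))).

Lemma wave_density_scale (x : 'rV[R]_dim) :
  16 * sin (dot rho x / 2) ^+ 4 * wave_density beta theta t (lam^-1 *: x) =
  lam `^ (dim%:R + 2 - beta) * spatial_density x.
Proof.
have li : 0 <= lam^-1 by rewrite invr_ge0 ltW.
rewrite wave_densityE// enormZ// /spatial_density /g_sp powRM ?enorm_ge0//.
have -> : lam^-1 `^ (beta - dim%:R - 2) = lam `^ (dim%:R + 2 - beta).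
  rewrite -powR_inv1 ?(ltW lam0)// -powRrM; congr (_ `^ _); ring.
set D := t / 2 - _; set q := sin _ ^+ 4; set p1 := lam `^ _; set p2 := enorm x `^ _.
by rewrite invfM; move: ((2 * pi) ^- dim) => w; ring.
Qed.

(** The exponent 2 - beta is dim + 2 - beta from the homogeneity of the density, less dim from the
    volume. Increments are numbered from 1 and ordinals from 0, hence [k.+1]. *)
Lemma increments_gaussian n (a : 'I_n -> R) :
  let L w := \sum_(k < n) a k * I_sp u t lam rho k.+1 w in
  let v := lam `^ (2 - beta) * \int[vol]_x (trig_sq a (dot rho x) * spatial_density x) in
  0 <= v /\ forall A : set R, measurable A -> P [set w | A (L w)] = gaussian_prob 0 v A.
Proof.
move=> L v; have [] := wave_combination_gaussian (second_diff a).
have -> : \int[vol]_x (trig_sq (second_diff a) (phase x) * wave_density beta theta t x) = v.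
  have iD := wave_density_rint beta0 beta2 betad theta0 t0.
  have [iT _] := toeplitz_form measurable_scaled_phase (second_diff a) iD.
  have li : 0 < lam^-1 by rewrite invr_gt0.
  have l0 : lam != 0 by rewrite gt_eqF.
  have f0 x : 0 <= trig_sq (second_diff a) (phase x) * wave_density beta theta t x.
    by rewrite mulr_ge0 ?trig_sq_ge0// wave_density_ge0.
  have [iS ES] := rintegral_rV_scale li iT f0.
  have p0 : lam `^ (dim%:R + 2 - beta) != 0 by rewrite gt_eqF// powR_gt0.
  have TE x : trig_sq a (dot rho x) * spatial_density x = (lam `^ (dim%:R + 2 - beta))^-1 *
      (trig_sq (second_diff a) (phase (lam^-1 *: x)) * wave_density beta theta t (lam^-1 *: x)).
    rewrite trig_sq_second_diff dotZr (mulVKf l0) [X in _^-1 * X]mulrAC wave_density_scale.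
    by rewrite -[X in _^-1 * X]mulrA mulKf// mulrC.
  have -> : v = lam `^ (2 - beta) * ((lam `^ (dim%:R + 2 - beta))^-1 *
      (lam^-1 ^- dim * \int[vol]_x (trig_sq (second_diff a) (phase x) * wave_density beta theta t x))).
    by rewrite -ES -(RintegralZl _ measurableT iS); congr (_ * _); apply: eq_Rintegral => x _; exact: TE.
  rewrite !mulrA -[LHS]mul1r; congr (_ * _); rewrite exprVn invrK -(@powR_mulrn _ lam dim) ?(ltW lam0)//.
  rewrite mulrAC -powRD ?l0 ?implybT//.
  by rewrite (_ : 2 - beta + dim%:R = dim%:R + 2 - beta) ?divff//; ring.
move=> v0 hv; split => // A mA; rewrite -hv//; congr (P _).
apply/seteqP; split => w /=; rewrite (sum_second_diff a (fun j => u t (obs lam rho j) w)).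
  by [].
by [].
Qed.

End wave_increments.

(** * Convergence in distribution *)

Section logistic_convergence.
Context {R : realType}.

Lemma logistic_le (x delta e y : R) : 0 < e -> x + delta <= y ->
  logistic x e y <= expR (- (delta / e)).
Proof.
move=> e0 xy; rewrite /logistic -[leRHS]invrK lef_pV2 ?posrE ?addr_gt0 ?invr_gt0 ?expR_gt0//.
rewrite -expRN opprK; apply: (@le_trans _ _ (expR ((y - x) / e))); last by rewrite lerDr.
by rewrite ler_expR ler_pM2r ?invr_gt0//; lra.
Qed.

Lemma logistic_ge (x delta e y : R) : 0 < e -> y <= x - delta ->
  1 - expR (- (delta / e)) <= logistic x e y.
Proof.
move=> e0 xy; rewrite /logistic; set a := expR ((y - x) / e).
have a0 : 0 < a by exact: expR_gt0.
apply: (@le_trans _ _ (1 - a)).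
  rewrite lerD2l lerN2 ler_expR -mulNr ler_pM2r ?invr_gt0//; lra.
have a1 : 0 < 1 + a by lra.
rewrite -[leRHS]mul1r ler_pdivlMr//; nra.
Qed.

(** The logistic function centred at x is within [eta] of 1 to the left of x - delta and within
    [eta] of 0 to the right of x + delta. *)
Lemma logistic_integral_bounds {d : measure_display} {T : measurableType d}
    (P : probability T R) (F : T -> R) (x delta e : R) :
  measurable_fun [set: T] F -> 0 < e ->
  \int[P]_w logistic x e (F w) <= fine (P [set w | F w <= x + delta]) + expR (- (delta / e)) /\
  fine (P [set w | F w <= x - delta]) - expR (- (delta / e)) <= \int[P]_w logistic x e (F w).
Proof.
move=> mF e0; set eta := expR _; have eta0 : 0 < eta by exact: expR_gt0.
have mS z : measurable [set w | F w <= z].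
  have := mF measurableT _ (measurable_itv `]-oo, z]%R); rewrite setTI.
  by congr measurable; apply/seteqP; split => w /=; rewrite in_itv.
pose I (z : R) (w : T) : R := \1_[set w | F w <= z] w.
have mI z : measurable_fun [set: T] (I z) by exact: measurable_indic.
have IE z w : I z w = (F w <= z)%R%:R.
  by rewrite /I indicE; congr (nat_of_bool _)%:R; apply/idP/idP; rewrite inE.
have iI z : rint P (I z).
  apply: (@rintegrable_bounded _ _ _ P _ 1); first exact: mI.
  by move=> y; rewrite IE; case: (F y <= z); rewrite ?normr1 ?normr0.
have EI z : \int[P]_w I z w = fine (P [set w | F w <= z]).
  by rewrite /Rintegral /I integral_indic// setIT.
have [ml _] := @bmeas_logistic R x e.
have il : rint P (fun w => logistic x e (F w)).
  apply: (@rintegrable_bounded _ _ _ P _ 1); first exact: (measurableT_comp ml mF).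
  by move=> y; rewrite gtr0_norm ?logistic_gt0// ltW// logistic_lt1.
have ic : rint P (fun=> eta) by exact: finite_measure_integrable_cst.
split.
- rewrite -EI -[X in _ + X](rintegral_cst P eta) -(RintegralD measurableT (iI _) ic).
  apply: le_Rintegral => //; first exact: rintegrableD.
  move=> w _; rewrite IE; have [h|h] := leP (F w) (x + delta).
    by rewrite (le_trans (ltW (logistic_lt1 x e _)))// lerDl ltW.
  by rewrite add0r; apply: logistic_le => //; exact: ltW.
- rewrite -EI -[X in _ - X](rintegral_cst P eta) -(RintegralB measurableT (iI _) ic).
  apply: le_Rintegral => //; first exact: rintegrableB.
  move=> w _; rewrite IE; have [h|h] := leP (F w) (x - delta).
    exact: logistic_ge.
  by rewrite sub0r (le_trans (_ : - eta <= 0)) ?oppr_le0 ?ltW// logistic_gt0.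
Qed.

(** Logistic functions centred at x + delta and x - delta enclose the distribution function of F n
    at x; their limits are controlled by G at x + 2 delta and x - 2 delta, and continuity at x
    closes the gap. *)
Lemma logistic_cvg_in_distribution {d : measure_display} {T : measurableType d}
    (P : probability T R) (F : nat -> T -> R) (mu : probability (measurableTypeR R) R) :
  (forall n, measurable_fun [set: T] (F n)) ->
  (forall m e, 0 < e ->
    \int[P]_w logistic m e (F n w) @[n --> \oo] --> \int[mu]_y logistic m e y) ->
  cvg_in_distribution P F mu.
Proof.
move=> mF HF x cx.
pose G (y : R) : R := fine (mu [set` `]-oo, y]]).
have GE y : mu [set` `]-oo, y]] = (G y)%:E.
  by rewrite /G fineK// fin_num_measure//; exact: measurable_itv.
pose p n : R := fine (P [set w | F n w <= x]).
have mFn n z : measurable [set w | F n w <= z].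
  have := mF n measurableT _ (measurable_itv `]-oo, z]%R); rewrite setTI.
  by congr measurable; apply/seteqP; split => w /=; rewrite in_itv.
have pE n : P [set w | F n w <= x] = (p n)%:E by rewrite /p fineK// fin_num_measure.
rewrite GE (_ : (fun n => P _) = (fun n => (p n)%:E)); last by apply/funext => n; exact: pE.
apply: cvg_EFin; first exact: nearW.
have cG : {for x, continuous G}.
  move: cx; rewrite (_ : (fun y => mu _) = (fun y => (G y)%:E)); last by apply/funext.
  by move=> /fine_cvgP[].
apply/cvgrPdist_le => eps eps0.
(* Four errors of size eps/4 add up: one from convergence, one from the oscillation of G, two from
   logistic tails. *)
pose e4 := eps / 4; have e40 : 0 < e4 by rewrite divr_gt0.
have [r /= r0 hr] : exists2 r : R, 0 < r & forall y, `|x - y| < r -> `|G x - G y| <= e4.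
  have /cvgrPdist_le/(_ _ e40) := cG.
  by move=> [r r0 hr]; exists r => // y; exact: hr.
(* The third of r keeps x + 2 delta and x - 2 delta within r of x. The width e is chosen so that
   exp(-delta/e) = exp(-(1 + 1/e4)), which is at most e4. *)
pose delta := r / 3; have delta0 : 0 < delta by rewrite divr_gt0.
pose e := delta / (1 + e4^-1).
have e0 : 0 < e by rewrite divr_gt0// addr_gt0// invr_gt0.
have etaE : expR (- (delta / e)) <= e4.
  have -> : delta / e = 1 + e4^-1.
    by rewrite /e invfM invrK mulrA divff ?mul1r// gt_eqF.
  rewrite expRN -[leRHS]invrK lef_pV2 ?posrE ?expR_gt0 ?invr_gt0//.
  by apply: le_trans (expR_ge1Dx _); rewrite addrA lerDr addr_ge0.
have S z : [set w : measurableTypeR R | w <= z] = [set` `]-oo, z]].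
  by rewrite set_itvE.
have [U _] := @logistic_integral_bounds _ (measurableTypeR R) mu id (x + delta) delta e (@measurable_id
  _ _ _) e0.
have [_ L] := @logistic_integral_bounds _ (measurableTypeR R) mu id (x - delta) delta e (@measurable_id
  _ _ _) e0.
rewrite S -/(G _) in U; rewrite S -/(G _) in L.
have hu : G (x + delta + delta) <= G x + e4.
  have xr : `|x - (x + delta + delta)| < r.
    have -> : x - (x + delta + delta) = - (delta + delta) by ring.
    by rewrite normrN gtr0_norm ?addr_gt0// /delta; lra.
  by have := hr _ xr; rewrite ler_norml => /andP[h1 _]; lra.
have hl : G x - e4 <= G (x - delta - delta).
  have xr : `|x - (x - delta - delta)| < r.
    have -> : x - (x - delta - delta) = delta + delta by ring.
    by rewrite gtr0_norm ?addr_gt0// /delta; lra.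
  by have := hr _ xr; rewrite ler_norml => /andP[_ h1]; lra.
have /cvgrPdist_le/(_ _ e40) cu := HF (x + delta) e e0.
have /cvgrPdist_le/(_ _ e40) cl := HF (x - delta) e e0.
apply: filterS2 cu cl => n /ler_normlP[u1 u2] /ler_normlP[l1 l2].
have [_ Un] := @logistic_integral_bounds _ _ P (F n) (x + delta) delta e (mF n) e0.
have [Ln _] := @logistic_integral_bounds _ _ P (F n) (x - delta) delta e (mF n) e0.
rewrite addrK -/(p n) in Un; rewrite subrK -/(p n) in Ln.
have -> : eps = 4 * e4 by rewrite /e4; field.
move: etaE U L hu hl u1 u2 l1 l2 Un Ln;
  move: (expR _) (\int[mu]_y _) (\int[mu]_y _) (\int[P]_w _) (\int[P]_w _).
clearbody e4 G p => *.
by rewrite ler_norml; apply/andP; split; lra.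
Qed.

End logistic_convergence.

(** * Gaussian quadratic forms *)

Section quadratic_form.
Context {R : realType} {d : measure_display} {T : measurableType d}.
Variables (P : probability T R) (n : nat) (X : 'I_n -> T -> R) (C : 'I_n -> 'I_n -> R).
Hypothesis mX : forall k, measurable_fun [set: T] (X k).
Hypothesis symC : forall k l, C k l = C l k.
Local Notation form a := (\sum_(k < n) \sum_(l < n) a k * a l * C k l).
Hypothesis gX : forall a : 'I_n -> R, 0 <= form a /\
  forall A : set R, measurable A ->
    P [set w | A (\sum_(k < n) a k * X k w)] = gaussian_prob 0 (form a) A.
Local Notation gamma := (@stdnormal R).

(* s lists the eigenvalues of C; in an eigenbasis the coordinates of X become
   independent Gaussians. *)
Lemma quadratic_form_law (K : R) : (forall a, form a <= K * \sum_(k < n) a k ^+ 2) ->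
  exists s : seq R,
  [/\ forall a, a \in s -> 0 <= a <= K,
      \sum_(a <- s) a = \sum_(k < n) C k k,
      \sum_(a <- s) a ^+ 2 = \sum_(k < n) \sum_(l < n) C k l ^+ 2 &
      forall m e, 0 < e ->
        \int[P]_w logistic m e (\sum_(k < n) X k w ^+ 2) = chisq_law s (logistic m e) 0].
Proof.
move=> hK.
pose A : 'M[R]_n := \matrix_(k, l) C k l.
have symA : A^T = A by apply/matrixP => k l; rewrite !mxE symC.
have [V [D [VV VAV]]] := real_spectral symA.
have VV' : V^T *m V = 1%:M by exact: mulmx1C.
have formE (b : 'rV[R]_n) (a := fun k => (b *m V) ord0 k) :
    form a = \sum_(j < n) b ord0 j ^+ 2 * D ord0 j.
  transitivity ((b *m V *m A *m (b *m V)^T) ord0 ord0).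
    rewrite mxE exchange_big; apply: eq_bigr => l _ /=.
    rewrite !mxE big_distrl /=; apply: eq_bigr => k _ /=.
    by rewrite /a !mxE; ring.
  rewrite trmx_mul !mulmxA -(mulmxA b V) -(mulmxA b (V *m A)) VAV mxE.
  by apply: eq_bigr => j _; rewrite mul_mx_diag !mxE; ring.
have normE (b : 'rV[R]_n) : \sum_(k < n) (b *m V) ord0 k ^+ 2 = \sum_(j < n) b ord0 j ^+ 2.
  transitivity ((b *m V *m (b *m V)^T) ord0 ord0).
    by rewrite mxE; apply: eq_bigr => k _; rewrite expr2; congr (_ * _); rewrite [RHS]mxE.
  rewrite trmx_mul mulmxA -(mulmxA b) VV mulmx1 mxE.
  by apply: eq_bigr => j _; rewrite mxE expr2.
(* Each eigenvalue is the value of the form at a unit row of V, so positivity and the bound K carry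
   over to it. *)
have DE (j : 'I_n) : form (fun k => V j k) = D ord0 j /\ \sum_(k < n) V j k ^+ 2 = 1.
  pose dj : 'rV[R]_n := delta_mx 0 j.
  have bV k : (dj *m V) ord0 k = V j k by rewrite /dj -rowE mxE.
  have := formE dj; have := normE dj.
  under eq_bigr do rewrite bV; move=> -> F.
  split; last by rewrite (bigD1 j)//= mxE !eqxx expr1n big1 ?addr0// => i ij;
    rewrite mxE eqxx (negbTE ij) expr0n.
  transitivity (form (fun k => (dj *m V) ord0 k)).
    by apply: eq_bigr => k _; apply: eq_bigr => l _; rewrite !bV.
  rewrite F (bigD1 j)//= mxE !eqxx expr1n mul1r big1 ?addr0// => i ij.
  by rewrite mxE eqxx (negbTE ij) expr0n mul0r.
have D0 j : 0 <= D ord0 j by have [<- _] := DE j; have [] := gX (fun k => V j k).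
have DK j : D ord0 j <= K.
  by have [<- h] := DE j; apply: le_trans (hK _) _; rewrite h mulr1.
exists [seq D ord0 j | j <- enum 'I_n]; split.
- by move=> a /mapP[j _ ->]; rewrite D0 DK.
- rewrite big_map big_enum /=; transitivity (\tr (diag_mx D)); first by rewrite mxtrace_diag.
  rewrite -VAV mxtrace_mulC mulmxA VV' mul1mx; apply: eq_bigr => k _; rewrite mxE //.
- rewrite big_map big_enum /=; transitivity (\tr (diag_mx D *m (diag_mx D)^T)).
    by apply: eq_bigr => j _; rewrite tr_diag_mx mulmx_diag !mxE eqxx expr2.
  rewrite -VAV !trmx_mul trmxK symA !mulmxA mxtrace_mulC !mulmxA VV' mul1mx -(mulmxA A) VV' mulmx1.
  apply: eq_bigr => k _; rewrite mxE; apply: eq_bigr => l _.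
  by rewrite !mxE (symC l) expr2.
(* Eigenbasis coordinates and eigenvalues, extended by 0 to all natural indices to fit
   [laplace_sum_sq]. *)
pose W (j : nat) (w : T) : R := if insub j is Some i then \sum_(k < n) V i k * X k w else 0.
pose mu (j : nat) : R := if insub j is Some i then D ord0 i else 0.
have WE (j : 'I_n) w : W j w = \sum_(k < n) V j k * X k w by rewrite /W valK.
have muE (j : 'I_n) : mu j = D ord0 j by rewrite /mu valK.
have mW j : measurable_fun [set: T] (W j).
  rewrite /W; case: insubP => [i _ _|_]; last exact: measurable_cst.
  by apply: measurable_sum => k; exact: measurable_funM.
have mu0 j : 0 <= mu j by rewrite /mu; case: insubP.
have QE w : \sum_(k < n) X k w ^+ 2 = \sum_(0 <= j < n) W j w ^+ 2.
  rewrite big_mkord; under [RHS]eq_bigr do rewrite WE.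
  pose x : 'rV[R]_n := \row_k X k w.
  transitivity ((x *m x^T) ord0 ord0).
    by rewrite mxE; apply: eq_bigr => k _; rewrite !mxE expr2.
  transitivity ((x *m V^T *m (x *m V^T)^T) ord0 ord0).
    by rewrite trmx_mul trmxK mulmxA -(mulmxA x) VV' mulmx1.
  rewrite mxE; apply: eq_bigr => j _; rewrite [(_ ^T) j ord0]mxE -expr2; congr (_ ^+ 2); rewrite mxE.
  by apply: eq_bigr => k _; rewrite !mxE mulrC.
have HW (b : nat -> R) : \int[P]_w cos (\sum_(0 <= j < n) b j * W j w) =
    expR (- ((\sum_(0 <= j < n) b j ^+ 2 * mu j) / 2)).
  pose bb : 'rV[R]_n := \row_j b j.
  have [v0 hv] := gX (fun k => (bb *m V) ord0 k).
  have mL : measurable_fun [set: T] (fun w => \sum_(k < n) (bb *m V) ord0 k * X k w).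
    by apply: measurable_sum => k; exact: measurable_funM.
  have -> : \sum_(0 <= j < n) b j ^+ 2 * mu j = form (fun k => (bb *m V) ord0 k).
    by rewrite formE big_mkord; apply: eq_bigr => j _; rewrite muE mxE.
  rewrite -(gaussian_cos v0 mL hv); apply: eq_Rintegral => w _; congr cos.
  rewrite big_mkord; under eq_bigr do rewrite WE mulr_sumr.
  rewrite exchange_big; apply: eq_bigr => k _ /=.
  by rewrite mxE mulr_suml; apply: eq_bigr => j _; rewrite !mxE mulrA.
move=> m e e0; apply: laplace_logistic => //.
- by apply: measurable_sum => k; exact: measurable_funX.
- by move=> w; apply: sumr_ge0 => k _; exact: sqr_ge0.
- by move=> a /mapP[j _ ->].
- move=> s s0; under eq_Rintegral do rewrite QE.
  rewrite (laplace_sum_sq s0 mu0 mW HW) big_map big_enum /= big_mkord.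
  by apply: eq_bigr => j _; rewrite muE.
Qed.

(** The centring is moved into the location m of the logistic function, because the Laplace
    comparison concerns the uncentred sum, which is nonnegative. Trace and squared entries replace
    the power sums of the eigenvalues, so the bound can be computed from C alone. *)
Lemma quadratic_form_clt_bound (K m e : R) : 0 < e ->
  (forall a, form a <= K * \sum_(k < n) a k ^+ 2) ->
  `|\int[P]_w logistic m e (\sum_(k < n) X k w ^+ 2 - \sum_(k < n) C k k) -
    gauss_law (Num.sqrt (2 * \sum_(k < n) \sum_(l < n) C k l ^+ 2)) (logistic m e) 0| <=
  e^-1 ^+ 3 * lindeberg_moment * (K * \sum_(k < n) \sum_(l < n) C k l ^+ 2).
Proof.
move=> e0 hK; set tr := \sum_(k < n) C k k; set hs := \sum_(k < n) \sum_(l < n) _;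
  have [s [s0 str shs sQ]] := quadratic_form_law hK.
have sh (y c : R) : logistic m e (y - c) = logistic (m + c) e y.
  by rewrite /logistic; congr (1 + expR (_ / e))^-1; ring.
under eq_Rintegral do rewrite sh.
rewrite (sQ _ _ e0).
have K0 : 0 <= e^-1 ^+ 3 by rewrite exprn_ge0// invr_ge0 ltW.
have s00 a : a \in s -> 0 <= a by move=> /s0/andP[].
have := lindeberg_chisq tr K0 s00 (taylor_logistic (m + tr) e0).
rewrite str shs subrr -/hs.
have -> : gauss_law (Num.sqrt (2 * hs)) (logistic (m + tr) e) tr =
    gauss_law (Num.sqrt (2 * hs)) (logistic m e) 0.
  by apply: eq_Rintegral => z _; rewrite -sh; congr logistic; ring.
move=> h; apply: le_trans h _; apply: ler_wpM2l.
  rewrite mulr_ge0// /lindeberg_moment; apply: Rintegral_ge0 => z _.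
  by rewrite addr_ge0// exprn_ge0.
rewrite /hs -shs mulr_sumr big_seq [leRHS]big_seq; apply: ler_sum => a /s0/andP[a0 aK].
by rewrite exprS ler_wpM2r// sqr_ge0.
Qed.

End quadratic_form.

Section quadratic_form_mean.
Context {R : realType} {d : measure_display} {T : measurableType d}.
Variables (P : probability T R) (n : nat) (X : 'I_n -> T -> R) (C : 'I_n -> 'I_n -> R).
Hypothesis mX : forall k, measurable_fun [set: T] (X k).
Local Notation form a := (\sum_(k < n) \sum_(l < n) a k * a l * C k l).
Hypothesis gX : forall a : 'I_n -> R, 0 <= form a /\
  forall A : set R, measurable A ->
    P [set w | A (\sum_(k < n) a k * X k w)] = gaussian_prob 0 (form a) A.

Lemma quadratic_form_mean : rint P (fun w => \sum_(k < n) X k w ^+ 2) /\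
  \int[P]_w (\sum_(k < n) X k w ^+ 2) = \sum_(k < n) C k k.
Proof.
have single (k : 'I_n) : rint P (fun w => X k w ^+ 2) /\ \int[P]_w X k w ^+ 2 = C k k.
  have [v0 hv] := gX (fun j => (j == k)%:R).
  have pick (F : 'I_n -> R) : \sum_(j < n) (j == k)%:R * F j = F k.
    rewrite (bigD1 k)//= eqxx mul1r big1 ?addr0// => j /negbTE ->; exact: mul0r.
  have fE : form (fun j => (j == k)%:R) = C k k.
    transitivity (\sum_(j < n) (j == k)%:R * (\sum_(l < n) (l == k)%:R * C j l)).
      by apply: eq_bigr => j _; rewrite mulr_sumr; apply: eq_bigr => l _; rewrite mulrA.
    by rewrite pick pick.
  rewrite fE in v0 hv; apply: (gaussian_variance v0 (mX k)) => A mA.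
  by rewrite -hv//; congr (P _); apply/funext => w /=; rewrite (pick (X ^~ w)).
split; first by apply: rintegrable_sum => k; have [] := single k.
rewrite rintegral_sum; last by move=> k; have [] := single k.
by apply: eq_bigr => k _; have [_ ->] := single k.
Qed.

End quadratic_form_mean.

(** * The limit theorem *)

Lemma rintegral_dominated_cvg0 {d : measure_display} {T : measurableType d} {R : realType}
    (mu : {measure set T -> \bar R}) (f : nat -> T -> R) (h : T -> R) :
  (forall n, measurable_fun [set: T] (f n)) -> rint mu h ->
  (forall n x, `|f n x| <= h x) -> (forall x, f n x @[n --> \oo] --> 0) ->
  \int[mu]_x `|f n x| @[n --> \oo] --> 0.
Proof.
move=> mf ih fh f0.
have mf' n : measurable_fun [set: T] (fun x => `|f n x|%:E).
  by apply/measurable_EFinP; exact: measurableT_comp.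
have cf x : [set: T] x -> `|f n x|%:E @[n --> \oo] --> 0%:E.
  move=> _; apply: cvg_EFin; first exact: nearW.
  by apply/norm_cvg0P; exact: f0.
have df x n : [set: T] x -> (`| `|f n x|%:E | <= (EFin \o h) x)%E.
  by move=> _; rewrite lee_fin normr_id.
have [_ _] := @dominated_convergence _ _ _ mu _ measurableT (fun n x => `|f n x|%:E)
  (fun=> 0%:E) (EFin \o h) mf' (measurable_cst _) (aeW _ cf) ih (aeW _ df).
by rewrite integral0 => /fine_cvgP[].
Qed.

Section gauss_law_continuity.
Context {R : realType}.
Local Notation gamma := (@stdnormal R).

Lemma gauss_law_logistic_dist (c c' m e : R) : 0 < e ->
  `|gauss_law c (logistic m e) 0 - gauss_law c' (logistic m e) 0| <=
  \int[gamma]_z (e^-1 * `|c - c'| * `|z|).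
Proof.
move=> e0.
have iN : rint gamma (fun z => e^-1 * `|c - c'| * `|z|).
  apply: rintegrableZ; have := @stdnormal_rintegrableX R 1 isT.
  by move/integrable_abse.
have il (b : R) : rint gamma (fun z => logistic m e (0 + b * z)).
  by apply: (bmeas_rint 0 (g := fun z => b * z)); [exact: measurable_funM|exact: bmeas_logistic].
rewrite /gauss_law /average -(RintegralB measurableT (il c) (il c')).
apply: rintegral_norm_le => //.
  have [ml _] := @bmeas_logistic R m e.
  apply: measurable_funB; apply: (measurableT_comp ml); apply: measurable_funD => //;
    exact: measurable_funM.
move=> z; rewrite !add0r.
have := @lipschitz_increment R (logistic m e) (fun y => e^-1 * (logistic m e y ^+ 2 - logistic m e y))
  (c' * z) ((c - c') * z) e^-1.
rewrite (_ : c' * z + (c - c') * z = c * z); last by ring.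
rewrite normrM mulrA; apply; first by rewrite invr_ge0 ltW.
  by move=> y; exact: is_derive_logistic.
move=> y _; rewrite normrM gtr0_norm ?invr_gt0// ger_pMr ?invr_gt0//.
have := logistic_gt0 m e y; have := logistic_lt1 m e y; move: (logistic m e y) => s s1 s0.
by rewrite ler_norml; apply/andP; split; nra.
Qed.

(** Continuity in the standard deviation covers a vanishing limit variance as well. *)
Lemma gauss_law_logistic_cvg (c : nat -> R) (l m e : R) : 0 < e -> c n @[n --> \oo] --> l ->
  gauss_law (c n) (logistic m e) 0 @[n --> \oo] --> gauss_law l (logistic m e) 0.
Proof.
move=> e0 cl; apply/cvgrPdist_le => eps eps0.
pose A := \int[gamma]_z `|z| : R.
have A0 : 0 <= A by apply: Rintegral_ge0 => z _.
have i1 : rint gamma (fun z => `|z|).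
  by have := @stdnormal_rintegrableX R 1 isT; move/integrable_abse.
have d0 : 0 < eps * e / (1 + A) by rewrite divr_gt0 ?mulr_gt0// ltr_wpDr.
have /cvgrPdist_le/(_ _ d0) := cl; apply: filterS => n h.
apply: le_trans (gauss_law_logistic_dist _ _ _ e0) _.
rewrite (RintegralZl _ measurableT i1) -/A -mulrA mulrC ler_pdivrMr//.
apply: (@le_trans _ _ (eps * e / (1 + A) * (1 + A))).
  by apply: ler_pM => //; rewrite lerDr.
by rewrite divfK// gt_eqF// ltr_wpDr.
Qed.

Lemma gaussian_prob_logistic (v m e : R) : 0 <= v ->
  \int[gaussian_prob 0 v]_y logistic m e y = gauss_law (Num.sqrt v) (logistic m e) 0.
Proof.
move=> v0; have [ml [M lM]] := @bmeas_logistic R m e.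
rewrite (@gaussian_expectation R _ _ (gaussian_prob 0 v) id v v0 (@measurable_id _ _ _)
  (fun A mA => erefl) (logistic m e) M ml lM).
by apply: eq_Rintegral => z _; rewrite add0r.
Qed.

End gauss_law_continuity.

(** * Convergence of the rescaled spectral density *)

Section density_limit.
Context {R : realType} {d : nat}.
Local Notation vol := (lebesgue_rV R d).
Variables (beta theta t : R) (rho : 'rV[R]_d).
Hypotheses (beta0 : 0 < beta) (beta2 : beta < 2) (betad : beta < d%:R).
Hypotheses (theta0 : 0 < theta) (t0 : 0 < t) (rho1 : enorm rho = 1).
Local Notation g := (g_sp beta rho).
Local Notation G lam := (spatial_density beta theta t rho lam).

(** The prefactor 16/((2 pi)^d theta) times t/2, the limit of the last factor of
    [spatial_density]. *)
Definition limit_coef : R := 8 * t / ((2 * pi) ^+ d * theta).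
Local Notation c1 := limit_coef.

Lemma limit_coef_ge0 : 0 <= c1.
Proof.
apply: divr_ge0; first by apply: mulr_ge0 => //; exact: ltW.
by apply: mulr_ge0; [rewrite exprn_ge0// mulr_ge0// pi_ge0|exact: ltW].
Qed.

Lemma spatial_density_diff lam x : G lam x - c1 * g x =
  - (2 * c1 / t * g x * (sin (2 * t * (Num.sqrt theta * (lam^-1 * enorm x))) /
      (4 * (Num.sqrt theta * (lam^-1 * enorm x))))).
Proof.
rewrite /spatial_density /limit_coef; set s := sin _ / _; move: s => s.
have t1 : t != 0 by rewrite gt_eqF.
have D0 : (2 * pi) ^+ d * theta != 0 by rewrite mulf_neq0 ?gt_eqF// exprn_gt0// mulr_gt0// pi_gt0.
by move: ((2 * pi) ^+ d * theta) D0 => D D0; field; rewrite t1 D0.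
Qed.

(** By |sin y| <= |y| the oscillating term is at most t/2 whatever lambda is, so the error is
    dominated by a fixed multiple of [g_sp]; hence lambda_n may tend to 0 at any rate. *)
Lemma spatial_density_dist lam x : 0 < lam -> `|G lam x - c1 * g x| <= c1 * g x.
Proof.
move=> l0; rewrite spatial_density_diff normrN normrM.
have li : 0 < lam^-1 by rewrite invr_gt0.
have k0 : 0 <= Num.sqrt theta * (lam^-1 * enorm x).
  by rewrite mulr_ge0 ?sqrtr_ge0// mulr_ge0 ?enorm_ge0// ltW.
move: (Num.sqrt theta * _) k0 => k k0.
have h : `|sin (2 * t * k) / (4 * k)| <= t / 2.
  have [->|k1] := eqVneq k 0; first by rewrite !mulr0 invr0 mulr0 normr0 divr_ge0// ltW.
  have kp : 0 < k by rewrite lt_neqAle eq_sym k1.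
  rewrite normrM normfV (gtr0_norm (x := 4 * k)) ?mulr_gt0// ler_pdivrMr ?mulr_gt0//.
  apply: le_trans (normr_sin_le _) _; rewrite ger0_norm; first by lra.
  by rewrite !mulr_ge0// ltW.
have c0 := limit_coef_ge0; have g0 := g_sp_ge0 beta rho x.
rewrite ger0_norm; last first.
  by apply: mulr_ge0 => //; apply: divr_ge0; [exact: mulr_ge0|exact: ltW].
apply: (@le_trans _ _ (2 * c1 / t * g x * (t / 2))).
  apply: ler_wpM2l => //.
  by apply: mulr_ge0 => //; apply: divr_ge0; [exact: mulr_ge0|exact: ltW].
by rewrite le_eqVlt; apply/orP; left; apply/eqP; field; rewrite gt_eqF.
Qed.

Lemma measurable_spatial_density lam : 0 < lam -> measurable_fun [set: 'rV[R]_d] (G lam).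
Proof.
move=> l0; have li : 0 <= lam^-1 by rewrite invr_ge0 ltW.
have mk : measurable_fun [set: 'rV[R]_d] (fun x => Num.sqrt theta * (lam^-1 * enorm x)).
  by apply: measurable_funM => //; apply: measurable_funM => //; exact: measurable_enorm.
apply: measurable_funM; first by apply: measurable_funM => //; exact: measurable_g_sp.
apply: measurable_funB => //; apply: measurable_funM.
  apply: measurableT_comp; first by apply: continuous_measurable_fun; exact: continuous_sin.
  exact: measurable_funM.
rewrite (_ : (fun x => _) = (fun x => (4 * (Num.sqrt theta * (lam^-1 * enorm x))) `^ (-1))).
  by apply: (measurableT_comp (measurable_powR _)); exact: measurable_funM.
by apply/funext => x; rewrite powR_inv1// !mulr_ge0 ?enorm_ge0 ?sqrtr_ge0.
Qed.

Lemma spatial_density_cvg (lambda : nat -> R) : (forall n, 0 < lambda n) ->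
  lambda n @[n --> \oo] --> 0 ->
  \int[vol]_x `|G (lambda n) x - c1 * g x| @[n --> \oo] --> 0.
Proof.
move=> l0 lc; apply: (@rintegral_dominated_cvg0 _ _ _ vol _ (fun x => c1 * g x)).
- move=> n; apply: measurable_funB; first exact: measurable_spatial_density.
  by apply: measurable_funM => //; exact: measurable_g_sp.
- by apply: rintegrableZ; exact: g_sp_rint.
- by move=> n x; exact: spatial_density_dist.
- move=> x.
  have [x0|x0] := eqVneq (enorm x) 0.
    rewrite (_ : (fun n => _) = (fun=> 0)); first exact: cvg_cst.
    apply/funext => n; rewrite /spatial_density /g_sp x0 powR0 ?mulr0 ?mul0r ?subrr//.
    by apply/eqP => ?; have := betad; lra.
  have xp : 0 < enorm x by rewrite lt_neqAle eq_sym x0 enorm_ge0.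
  have q0 : 0 < Num.sqrt theta by rewrite sqrtr_gt0.
  (* Off the origin the difference is, up to sign, K lambda_n times a sine, and so tends to 0. *)
  pose K := 2 * c1 / t * g x / (4 * (Num.sqrt theta * enorm x)).
  have K0 : 0 <= K.
    apply: divr_ge0; last by rewrite !mulr_ge0// ltW.
    apply: mulr_ge0; last exact: g_sp_ge0.
    by apply: divr_ge0; [apply: mulr_ge0 => //; exact: limit_coef_ge0|exact: ltW].
  apply/cvgr0Pnorm_le => eps eps0.
  have d0 : 0 < eps / (1 + K) by rewrite divr_gt0// ltr_wpDr.
  have /cvgr0Pnorm_le/(_ _ d0) := lc; apply: filterS => n h.
  rewrite spatial_density_diff normrN.
  have -> : 2 * c1 / t * g x * (sin (2 * t * (Num.sqrt theta * ((lambda n)^-1 * enorm x))) /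
      (4 * (Num.sqrt theta * ((lambda n)^-1 * enorm x)))) =
      K * lambda n * sin (2 * t * (Num.sqrt theta * ((lambda n)^-1 * enorm x))).
    rewrite /K; move: (sin _) (g x) c1 => s y c; field.
    by rewrite !gt_eqF.
  rewrite normrM -[leRHS]mulr1; apply: ler_pM => //; last exact: sin_max.
  rewrite normrM (ger0_norm K0); apply: (@le_trans _ _ ((1 + K) * (eps / (1 + K)))).
    by apply: ler_pM => //; rewrite lerDr.
  by rewrite mulrC divfK// gt_eqF// ltr_wpDr.
Qed.

End density_limit.

(** * Convergence of the variances *)

Section variance_limit.
Context {R : realType} {d : nat}.
Local Notation vol := (lebesgue_rV R d).
Variables (beta theta t : R) (rho : 'rV[R]_d).
Hypotheses (beta0 : 0 < beta) (beta2 : beta < 2) (betad : beta < d%:R).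
Hypotheses (theta0 : 0 < theta) (t0 : 0 < t) (rho1 : enorm rho = 1).
Local Notation g := (g_sp beta rho).
Local Notation G lam := (spatial_density beta theta t rho lam).
Local Notation c1 := (@limit_coef R d theta t).
Local Notation coef := (phase_coef vol (dot rho)).

Lemma g_sp_form_bound : exists2 B, 0 <= B & forall n (a : 'I_n -> R),
  \int[vol]_x (trig_sq a (dot rho x) * g x) <= B * \sum_(k < n) a k ^+ 2.
Proof.
have [B B0 hB] := g_sp_bound beta0 beta2 betad rho1; exists B => // n a.
have [i1 _] := toeplitz_form (measurable_dot rho) a (g_sp_rint beta0 beta2 betad rho1).
rewrite -lee_fin (rintegral_EFin i1); apply: le_trans (hB n a).
by rewrite le_eqVlt; apply/orP; left; apply/eqP/eq_integral => x _; rewrite mulrC.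
Qed.

Lemma spatial_density_le lam x : 0 < lam -> `|G lam x| <= 2 * c1 * g x.
Proof.
move=> l0; have h : `|G lam x - c1 * g x| <= c1 * g x by exact: spatial_density_dist.
have c0 := @limit_coef_ge0 R d theta t theta0 t0; have g0 := g_sp_ge0 beta rho x.
have -> : G lam x = (G lam x - c1 * g x) + c1 * g x by rewrite subrK.
apply: le_trans (ler_normD _ _) _; rewrite (ger0_norm (mulr_ge0 c0 g0)).
by apply: le_trans (lerD h (lexx _)) _; rewrite -mulrA mulr_natl mulr2n.
Qed.

(** With p and q the coefficients of G_n and g, write p^2 - c1^2 q^2 = (p + c1 q)(p - c1 q). The
    first factor has a symbol dominated by 3 c1 g, the second one a symbol small in L^1, so
    [toeplitz_hs] bounds the normalised error by 3 c1 B times the L^1 distance. What remains is the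
    fixed symbol g. *)
Lemma hs_limit (lambda : nat -> R) : (forall n, 0 < lambda n) ->
  lambda n @[n --> \oo] --> 0 ->
  n%:R^-1 * \sum_(k < n) \sum_(l < n) coef (G (lambda n)) (k%:R - l%:R) ^+ 2 @[n --> \oo] -->
  c1 ^+ 2 * fine (\esum_(k in [set: int]) (coef g k%:~R ^+ 2)%:E)%E.
Proof.
move=> l0 lc; have [B B0 hB] := g_sp_form_bound.
have md := measurable_dot rho; have ig := g_sp_rint beta0 beta2 betad rho1.
have mg := measurable_g_sp beta rho; have g0 := g_sp_ge0 beta rho.
have c0 := @limit_coef_ge0 R d theta t theta0 t0.
have mG n := measurable_spatial_density beta theta t rho (l0 n).
have iG n : rint vol (G (lambda n)).
  by apply: (phase_dom_rint ig (mG n)) => x; exact: spatial_density_le.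
have icg : rint vol (fun x => c1 * g x) by exact: rintegrableZ.
have A : n%:R^-1 * \sum_(k < n) \sum_(l < n) coef g (k%:R - l%:R) ^+ 2 @[n --> \oo] -->
    fine (\esum_(k in [set: int]) (coef g k%:~R ^+ 2)%:E)%E.
  apply: (@toeplitz_cesaro R (fun m => coef g m ^+ 2) _ _ (B * \int[vol]_x `|g x|)).
  - by move=> m; exact: sqr_ge0.
  - by move=> m; rewrite phase_coefN.
  - move=> n; apply: le_trans (ler_norm _) _.
    have := toeplitz_hs md ig hB n ig mg ler01.
    rewrite mul1r (mulrC B) -mulrA; apply => x.
    by rewrite mul1r ger0_norm.
pose err n := n%:R^-1 * \sum_(k < n) \sum_(l < n)
  coef (fun x => G (lambda n) x + c1 * g x) (k%:R - l%:R) * coef (fun x => G (lambda n) x - c1 * g x)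
    (k%:R - l%:R).
have E n : n%:R^-1 * \sum_(k < n) \sum_(l < n) coef (G (lambda n)) (k%:R - l%:R) ^+ 2 =
    c1 ^+ 2 * (n%:R^-1 * \sum_(k < n) \sum_(l < n) coef g (k%:R - l%:R) ^+ 2) + err n.
  rewrite mulrCA -mulrDr; congr (_ * _); rewrite mulr_sumr -big_split; apply: eq_bigr => k _ /=.
  rewrite mulr_sumr -big_split; apply: eq_bigr => l _ /=.
  have -> : coef (fun x => G (lambda n) x - c1 * g x) (k%:R - l%:R) =
      coef (G (lambda n)) (k%:R - l%:R) - c1 * coef g (k%:R - l%:R).
    rewrite -mulNr -(phase_coefZ md _ _ ig) -(phase_coefD md _ (iG n)); last exact: rintegrableZ.
    by apply: eq_Rintegral => x _; rewrite mulNr.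
  by rewrite (phase_coefD md _ (iG n) icg) (phase_coefZ md _ _ ig); ring.
rewrite (funext E) -[X in _ --> X]addr0; apply: cvgD; first by apply: cvgM => //; exact: cvg_cst.
have Dc := spatial_density_cvg beta0 beta2 betad theta0 t0 rho1 l0 lc.
apply/norm_cvg0P; apply: (@squeeze_cvgr _ _ _ _ (fun=> 0)
  (fun n => 3 * c1 * B * \int[vol]_x `|G (lambda n) x - c1 * g x|)); last 2 first.
- exact: cvg_cst.
- by rewrite -[X in _ --> X](mulr0 (3 * c1 * B)); apply: cvgM => //; exact: cvg_cst.
apply: nearW => n; rewrite normr_ge0 /= /err normrM normfV (ger0_norm (ler0n R n)).
have iD : rint vol (fun x => G (lambda n) x - c1 * g x) by exact: rintegrableB.
have hp x : `|G (lambda n) x + c1 * g x| <= 3 * c1 * g x.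
  apply: le_trans (ler_normD _ _) _; rewrite (ger0_norm (mulr_ge0 c0 (g0 x))).
  apply: le_trans (lerD (spatial_density_le x (l0 n)) (lexx _)) _.
  by rewrite le_eqVlt; apply/orP; left; apply/eqP; ring.
have mp : measurable_fun [set: 'rV[R]_d] (fun x => G (lambda n) x + c1 * g x).
  by apply: measurable_funD => //; exact: measurable_funM.
have := toeplitz_hs md ig hB n iD mp (mulr_ge0 (ler0n R 3) c0) hp.
move=> h; apply: (@le_trans _ _ (n%:R^-1 * (3 * c1 * B * n%:R * \int[vol]_x `|G (lambda n) x - c1 * g x|))).
  by apply: ler_wpM2l => //; rewrite invr_ge0.
have I0 : 0 <= \int[vol]_x `|G (lambda n) x - c1 * g x| by apply: Rintegral_ge0.
(* For n = 0 the inverse of n is 0 and n cannot be cancelled, so this case is separate. *)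
case: n {h mp hp iD} I0 => [|n] I0.
  rewrite invr0 mul0r; apply: mulr_ge0 => //; apply: mulr_ge0 => //; exact: mulr_ge0.
rewrite le_eqVlt; apply/orP; left; apply/eqP.
have n0 : n.+1%:R != 0 :> R by rewrite pnatr_eq0.
by rewrite mulrA mulrCA mulVf// mulr1.
Qed.

(** The constant is 128 = 2 times 8^2: the 8 comes from [limit_coef], and 2 is the variance of Z^2 -
    1. *)
Lemma limit_varianceE : t ^+ 2 / theta ^+ 2 * C_spV beta rho =
  2 * (c1 ^+ 2 * fine (\esum_(k in [set: int]) (coef g k%:~R ^+ 2)%:E)%E).
Proof.
rewrite /C_spV /limit_coef.
have -> : (fun k : int => ((Fc g (k%:~R *: rho)) ^+ 2)%:E) = (fun k : int => (coef g k%:~R ^+ 2)%:E).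
  apply/funext => k; congr (_ ^+ 2)%:E.
  by apply: eq_Rintegral => x _; rewrite dotZl.
rewrite mulnC exprM; have : (2 * pi : R) ^+ d != 0 by rewrite expf_neq0// mulf_neq0// gt_eqF// pi_gt0.
move: ((2 * pi) ^+ d) (fine _) => D S D0.
by field; rewrite D0 gt_eqF.
Qed.

End variance_limit.

Theorem theorem3p9 (R : realType) (d : nat) (beta theta : R)
    (disp : measure_display) (Omega : measurableType disp)
    (P : probability Omega R) (u : R -> 'rV[R]_d -> {RV P >-> R})
    (t : R) (rho : 'rV[R]_d) (lambda : nat -> R) :
  0 < beta -> beta < Num.min 2 d%:R ->
  0 < theta ->
  wave_solution beta theta u ->
  0 < t ->
  enorm rho = 1 ->
  (forall n, 0 < lambda n) ->
  lambda n @[n --> \oo] --> (0 : R) ->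
  let Y n w := lambda n `^ (beta - 2) / n%:R * V_sp u t (lambda n) rho n w in
  cvg_in_distribution P
    (fun n w => Num.sqrt n%:R * (Y n w - fine 'E_P[Y n]))
    (gaussian_prob 0 (t ^+ 2 / theta ^+ 2 * C_spV beta rho)).
Proof.
move=> beta0 betam theta0 solu t0 rho1 l0 lc Y.
have [beta2 betad] : beta < 2 /\ beta < d%:R.
  by move: betam; rewrite lt_min => /andP[].
have [B B0 hB] := g_sp_form_bound beta0 beta2 betad rho1.
have md := measurable_dot rho; have ig := g_sp_rint beta0 beta2 betad rho1.
pose c1 := @limit_coef R d theta t; have c0 : 0 <= c1 := @limit_coef_ge0 R d theta t theta0 t0.
pose G n := spatial_density beta theta t rho (lambda n).
have mG n : measurable_fun [set: 'rV[R]_d] (G n) := measurable_spatial_density beta theta t rho (l0 n).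
have GB n x : `|G n x| <= 2 * c1 * g_sp beta rho x by exact: spatial_density_le.
have iG n : rint (lebesgue_rV R d) (G n) := phase_dom_rint ig (mG n) (GB n).
pose C n (k l : 'I_n) := (Num.sqrt n%:R)^-1 * phase_coef (lebesgue_rV R d) (dot rho) (G n) (k%:R - l%:R).
(* This is sqrt n times the normalisation lambda^(beta-2)/n; its square root is put into each
   increment, so that the statistic is a centred sum of squares. *)
pose s n := lambda n `^ (beta - 2) / Num.sqrt n%:R.
have s0 n : 0 <= s n by rewrite divr_ge0 ?powR_ge0 ?sqrtr_ge0.
pose X n (k : 'I_n) w := Num.sqrt (s n) * I_sp u t (lambda n) rho k.+1 w.
have mI n k : measurable_fun [set: Omega] (I_sp u t (lambda n) rho k).
  apply: measurable_funB; last by apply: measurable_funM => //; exact: measurable_funPT.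
  by apply: measurable_funD; exact: measurable_funPT.
have mX n k : measurable_fun [set: Omega] (X n k) by exact: measurable_funM.
have symC n (k l : 'I_n) : C n k l = C n l k.
  by rewrite /C -phase_coefN opprB.
have formE n (a : 'I_n -> R) : \sum_(k < n) \sum_(l < n) a k * a l * C n k l =
    (Num.sqrt n%:R)^-1 * \sum_(k < n) \sum_(l < n) a k * a l *
      phase_coef (lebesgue_rV R d) (dot rho) (G n) (k%:R - l%:R).
  rewrite mulr_sumr; apply: eq_bigr => k _; rewrite mulr_sumr; apply: eq_bigr => l _.
  by rewrite /C mulrCA.
have gX n (a : 'I_n -> R) : 0 <= \sum_(k < n) \sum_(l < n) a k * a l * C n k l /\
    forall A : set R, measurable A -> P [set w | A (\sum_(k < n) a k * X n k w)] =
      gaussian_prob 0 (\sum_(k < n) \sum_(l < n) a k * a l * C n k l) A.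
  have := increments_gaussian (t := t) rho beta0 beta2 betad theta0 t0 (l0 n) solu
    (fun k : 'I_n => a k * Num.sqrt (s n)).
  have [_ <-] := toeplitz_form md (fun k : 'I_n => a k * Num.sqrt (s n)) (iG n).
  have -> : lambda n `^ (2 - beta) * (\sum_(k < n) \sum_(l < n)
      a k * Num.sqrt (s n) * (a l * Num.sqrt (s n)) *
      phase_coef (lebesgue_rV R d) (dot rho) (G n) (k%:R - l%:R)) =
      \sum_(k < n) \sum_(l < n) a k * a l * C n k l.
    (* The powers lambda^(2-beta) from the increments and lambda^(beta-2) from [s n] cancel and
       leave n^(-1/2). *)
    rewrite formE (_ : (Num.sqrt n%:R)^-1 = lambda n `^ (2 - beta) * Num.sqrt (s n) ^+ 2); last first.
      rewrite sqr_sqrtr// /s mulrA -powRD; last by rewrite (gt_eqF (l0 n)) implybT.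
      by rewrite (_ : 2 - beta + (beta - 2) = 0) ?powRr0 ?mul1r//; ring.
    rewrite -mulrA; congr (_ * _); rewrite mulr_sumr; apply: eq_bigr => k _.
    by rewrite mulr_sumr; apply: eq_bigr => l _; ring.
  move=> [h1 h2]; split => // A mA; rewrite -h2//; congr (P _); apply/funext => w /=.
  by congr A; apply: eq_bigr => k _; rewrite /X mulrA.
have hK n (a : 'I_n -> R) : \sum_(k < n) \sum_(l < n) a k * a l * C n k l <=
    (Num.sqrt n%:R)^-1 * (2 * c1 * B) * \sum_(k < n) a k ^+ 2.
  rewrite formE -mulrA; apply: ler_wpM2l; first by rewrite invr_ge0 sqrtr_ge0.
  apply: le_trans (ler_norm _) _.
  exact: (toeplitz_form_le md ig hB a (mG n) (mulr_ge0 (ler0n R 2) c0) (GB n)).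
have QE n w : \sum_(k < n) X n k w ^+ 2 = s n * V_sp u t (lambda n) rho n w.
  rewrite /V_sp big_add1 /= big_mkord mulr_sumr; apply: eq_bigr => k _.
  by rewrite /X exprMn sqr_sqrtr.
have YE n w : Y n w = (Num.sqrt n%:R)^-1 * \sum_(k < n) X n k w ^+ 2.
  rewrite QE /Y /s !mulrA; congr (_ * _); by rewrite [RHS]mulrAC -invfM -expr2 sqr_sqrtr// mulrC.
have EY n : fine 'E_P[Y n] = (Num.sqrt n%:R)^-1 * \sum_(k < n) C n k k.
  have [iQ <-] := quadratic_form_mean (mX n) (gX n).
  rewrite expectation.unlock -(RintegralZl _ measurableT iQ).
  by apply: eq_Rintegral => w _; exact: YE.
have FE n w : Num.sqrt n%:R * (Y n w - fine 'E_P[Y n]) =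
    \sum_(k < n) X n k w ^+ 2 - \sum_(k < n) C n k k.
  (* For n = 0 both sides are 0, as the sums are empty. *)
  rewrite EY YE -mulrBr mulrA; case: n => [|n]; first by rewrite !big_ord0 subr0 mulr0.
  by rewrite divff ?mul1r// sqrtr_eq0 -ltNge ltr0n.
pose hs n := n%:R^-1 * \sum_(k < n) \sum_(l < n)
  phase_coef (lebesgue_rV R d) (dot rho) (G n) (k%:R - l%:R) ^+ 2.
have hsE n : \sum_(k < n) \sum_(l < n) C n k l ^+ 2 = hs n.
  rewrite /hs mulr_sumr; apply: eq_bigr => k _; rewrite mulr_sumr; apply: eq_bigr => l _.
  by rewrite /C exprMn exprVn sqr_sqrtr.
have hsl := hs_limit beta0 beta2 betad theta0 t0 rho1 l0 lc; rewrite -/hs in hsl.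
rewrite (limit_varianceE beta t rho theta0) (_ : (fun n w => _) =
  (fun n w => \sum_(k < n) X n k w ^+ 2 - \sum_(k < n) C n k k)); last first.
  by apply/funext => n; apply/funext => w; exact: FE.
set L := c1 ^+ 2 * _ in hsl *.
have L0 : 0 <= 2 * L.
  rewrite mulr_ge0// mulr_ge0 ?sqr_ge0// fine_ge0//.
  by apply: esum_ge0 => k _; rewrite lee_fin sqr_ge0.
apply: logistic_cvg_in_distribution => [n|m e e0].
  by apply: measurable_funB => //; apply: measurable_sum => k; exact: measurable_funX.
rewrite gaussian_prob_logistic//.
have gl : gauss_law (Num.sqrt (2 * hs n)) (logistic m e) 0 @[n --> \oo] -->
    gauss_law (Num.sqrt (2 * L)) (logistic m e) 0.
  apply: gauss_law_logistic_cvg => //.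
  have cs : 2 * hs n @[n --> \oo] --> 2 * L by apply: cvgM => //; exact: cvg_cst.
  by apply: (cvg_comp _ _ cs); exact: sqrt_continuous.
have sq0 : (Num.sqrt n%:R)^-1 @[n --> \oo] --> (0 : R).
  rewrite -(@cvg_shiftS _ _ (nbhs (0 : R))).
  rewrite (_ : (fun n => _) = (fun n => Num.sqrt (@harmonic R n))); last first.
    by apply/funext => n; rewrite sqrtrV.
  rewrite -(@sqrtr0 R); apply: (cvg_comp _ _ (@cvg_harmonic R)); exact: sqrt_continuous.
(* The eigenvalue bound carries the factor n^(-1/2) and is multiplied by [hs n], which converges. *)
have er : e^-1 ^+ 3 * lindeberg_moment * ((Num.sqrt n%:R)^-1 * (2 * c1 * B) * hs n) @[n --> \oo] --> (0 : R).
  rewrite -[X in _ --> X](mulr0 (e^-1 ^+ 3 * lindeberg_moment)); apply: cvgM; first exact: cvg_cst.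
  rewrite -[X in _ --> X](mul0r L); apply: cvgM => //.
  by rewrite -[X in _ --> X](mul0r (2 * c1 * B)); apply: cvgM => //; exact: cvg_cst.
rewrite -[X in _ --> X]addr0.
rewrite (_ : (fun n => _) = (fun n => gauss_law (Num.sqrt (2 * hs n)) (logistic m e) 0 +
  (\int[P]_w logistic m e (\sum_(k < n) X n k w ^+ 2 - \sum_(k < n) C n k k) -
   gauss_law (Num.sqrt (2 * hs n)) (logistic m e) 0))); last first.
  by apply/funext => n; rewrite addrC subrK.
apply: cvgD => //; apply/norm_cvg0P; apply: (squeeze_cvgr _ (cvg_cst 0) er).
apply: nearW => n; rewrite normr_ge0 /=.
by have := quadratic_form_clt_bound (mX n) (symC n) (gX n) m e0 (hK n); rewrite hsE.
Qed.
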